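(* A parametrization of the isomorphism classes of $\mathrm{ind}(\mathrm{coh}\text{-}\mathbb{X}(p,q))$ is given as follows: (1) the indecomposable vector bundles are indexed by the homotopy classes of positive bridging curves $\pi([(\tfrac{j}{q})_{\partial'},(\tfrac{i}{p})_{\partial}])$ in $A_{p,q}$; (2) the objects in the stable tube of rank $p$ (resp. $q$) are indexed by the homotopy classes of peripheral curves $\pi([(\tfrac{i}{p})_{\partial},(\tfrac{j}{p})_{\partial}])$ (resp. $\pi([(\tfrac{i}{q})_{\partial'},(\tfrac{j}{q})_{\partial'}])$) in $A_{p,q}$; (3) the objects in homogeneous tubes are indexed by $\mathbf{k}^*$-parameterized $n$-cycles in $A_{p,q}$.
   Context: Sheaves. Let $\mathbf{k}$ be an algebraically closed field, $\mathbf{k}^*=\mathbf{k}\setminus\{0\}$, and $1\le p\le q$ integers. $\mathbb{L}(p,q)$ is the abelian group on generators $\vec{x}_1,\vec{x}_2$ with relation $p\vec{x}_1=q\vec{x}_2$. $S=\mathbf{k}[x_1,x_2]$ is $\mathbb{L}(p,q)$-graded with $\deg x_i=\vec{x}_i$. $\mathrm{coh}\text{-}\mathbb{X}(p,q)$, the category of coherent sheaves over the weighted projective line of type $(p,q)$, is the quotient of the category of finitely generated $\mathbb{L}(p,q)$-graded $S$-modules by the Serre subcategory of finite dimensional modules. $\mathrm{ind}(\mathrm{coh}\text{-}\mathbb{X}(p,q))$ is its full subcategory of indecomposable objects. Every indecomposable sheaf is a vector bundle or has finite length. The finite length sheaves decompose into connected uniserial length categories $\mathcal{U}_\lambda$,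 $\lambda\in\mathbf{k}\cup\{\infty\}$, whose Auslander-Reiten quivers are stable tubes: of rank $p$ for $\lambda=\infty$ and of rank $q$ for $\lambda=0$ (these are the stable tubes of rank $p$, resp. $q$, in (2)), and of rank $1$ for $\lambda\in\mathbf{k}^*$ (the homogeneous tubes). Annulus. $A_{p,q}$ is an annulus with $p$ marked points on the inner boundary $\partial$ and $q$ marked points on the outer boundary $\partial'$. Let $\mathbb{U}=\mathbb{R}\times[0,1]$ and let $\pi:\mathbb{U}\to A_{p,q}$ be the universal covering identifying $(x,y)$ with $(x+1,y)$; the line $y=1$ covers $\partial$ and $y=0$ covers $\partial'$. The marked points of $\mathbb{U}$ are $(\tfrac{i}{p})_\partial:=(\tfrac{i}{p},1)$ and $(\tfrac{j}{q})_{\partial'}:=(\tfrac{j}{q},0)$, $i,j\in\mathbb{Z}$; those of $A_{p,q}$ are their images. Curves are considered up to homotopy. $[P,Q]$ denotes the arc in $\mathbb{U}$ starting at the marked point $P$ and ending at the marked point $Q$ (with interior in the interior of $\mathbb{U}$ and without self-intersections). A positive bridging arc is an arc $[(\tfrac{j}{q})_{\partial'},(\tfrac{i}{p})_{\partial}]$, $i,j\in\mathbb{Z}$; a peripheral arc is an arc $[(\tfrac{i}{p})_{\partial},(\tfrac{j}{p})_{\partial}]$ or $[(\tfrac{i}{q})_{\partial'},(\tfrac{j}{q})_{\partial'}]$ with $i,j\in\mathbb{Z}$ and $j-i\ge 2$. Positive bridging curves and peripheral curves in $A_{p,q}$ are the images under $\pi$ of positive bridging arcs and peripheral arcs. For $n\ge1$,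 an $n$-cycle in $A_{p,q}$ is a curve $\pi(c)$ with $c$ a curve in the interior of $\mathbb{U}$ such that $c(1)-c(0)=(n,0)$; a $1$-cycle is called a loop. The $\mathbf{k}^*$-parameterized $n$-cycles are the elements of $\{(\lambda,L^n)\mid\lambda\in\mathbf{k}^*\}$, where $L$ is a loop in $A_{p,q}$ oriented anti-clockwise. *)

(* Defs.v *)
From HB Require Import structures.
From mathcomp Require Import all_boot all_order all_algebra.
From mathcomp Require Import all_classical all_reals all_analysis.
From mathcomp Require mpoly.
(* The notations of mpoly clash with those of analysis; only its structures
   are imported. *)
Import (canonicals, coercions) mpoly.

Set Implicit Arguments.
Unset Strict Implicit.
Unset Printing Implicit Defensive.

Import Order.TTheory GRing.Theory Num.Theory numFieldNormedType.Exports.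

Local Open Scope classical_set_scope.
Local Open Scope ring_scope.

Definition Lrel (p q : nat) : {pred int * int} :=
  fun u => `[< exists n : int, u = (p%:Z, - q%:Z) *~ n >].

Fact Lrel_zmod_closed p q : zmod_closed (Lrel p q).
Proof.
split=> [|u v]; first by apply/asboolP; exists 0; rewrite mulr0z.
move=> /asboolP[m ->] /asboolP[n ->]; apply/asboolP; exists (m - n).
by rewrite mulrzBr.
Qed.

HB.instance Definition _ p q :=
  GRing.isZmodClosed.Build (int * int)%type (Lrel p q) (Lrel_zmod_closed p q).

Definition Lgrp (p q : nat) : zmodType := Quotient.quot (Lrel p q).

Definition Lx1 (p q : nat) : Lgrp p q := \pi_(Lgrp p q)%qT (1, 0).
Definition Lx2 (p q : nat) : Lgrp p q := \pi_(Lgrp p q)%qT (0, 1).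

Definition Sring (k : closedFieldType) : comNzRingType := mpoly.mpoly 2 k.

Definition Sx1 (k : closedFieldType) : Sring k :=
  mpoly.mpolyX k (mpoly.mnm1 ord0).
Definition Sx2 (k : closedFieldType) : Sring k :=
  mpoly.mpolyX k (mpoly.mnm1 ord_max).
Definition Sconst (k : closedFieldType) (a : k) : Sring k := mpoly.mpolyC 2 a.

Definition mon_deg (p q : nat) (m : mpoly.multinom 2) : Lgrp p q :=
  Lx1 p q *+ m ord0 + Lx2 p q *+ m ord_max.

Definition S_homog (k : closedFieldType) (p q : nat) (l : Lgrp p q)
  (s : Sring k) : Prop := forall m, m \in mpoly.msupp s -> mon_deg p q m = l.

(* [deg l] is the component of degree [l].  The last two grading axioms say
   that the module is the direct sum of its components. *)
Record gmod (k : closedFieldType) (p q : nat) := GMod {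
  carrier :> lmodType (Sring k);
  deg : Lgrp p q -> carrier -> Prop;
  deg0 : forall l, deg l 0;
  degB : forall l u v, deg l u -> deg l v -> deg l (u - v);
  degZ : forall a l s u, S_homog a s -> deg l u -> deg (a + l) (s *: u);
  deg_sum : forall u, exists (ls : seq (Lgrp p q)) (f : Lgrp p q -> carrier),
    [/\ uniq ls, forall l, deg l (f l) & u = \sum_(l <- ls) f l];
  deg_direct : forall (ls : seq (Lgrp p q)) (f : Lgrp p q -> carrier),
    uniq ls -> (forall l, deg l (f l)) -> \sum_(l <- ls) f l = 0 ->
    forall l, l \in ls -> f l = 0;
  fin_gen : exists gs : seq carrier, forall u, exists c : nat -> Sring k,
    u = \sum_(i < size gs) c i *: gs`_i
}.
Arguments deg {k p q} M l u : rename.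

Definition graded_submod (k : closedFieldType) (p q : nat)
    (V : lmodType (Sring k)) (dV : Lgrp p q -> V -> Prop) (W : V -> Prop) :
  Prop :=
  [/\ W 0,
      forall s u v, W u -> W v -> W (s *: u + v) &
      forall u, W u -> exists (ls : seq (Lgrp p q)) (f : Lgrp p q -> V),
        [/\ uniq ls, forall l, dV l (f l) /\ W (f l) &
            u = \sum_(l <- ls) f l]].

Definition kcomb (k : closedFieldType) (V : lmodType (Sring k)) (vs : seq V)
  (c : nat -> k) : V := \sum_(i < size vs) Sconst (c i) *: vs`_i.

Definition findim (k : closedFieldType) (V : lmodType (Sring k))
  (W : V -> Prop) : Prop :=
  exists vs : seq V, forall u, W u -> exists c, u = kcomb vs c.

Definition cofindim (k : closedFieldType) (V : lmodType (Sring k))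
  (W : V -> Prop) : Prop :=
  exists vs : seq V, forall u, exists c, W (u - kcomb vs c).

(* By Gabriel's construction, a morphism M -> N of the quotient by the Serre
   subcategory of finite dimensional modules is the class, in the colimit over
   (M', N'), of a morphism of graded modules M' -> N / N', where M' is a graded
   submodule of M with M / M' finite dimensional and N' is a finite dimensional
   graded submodule of N.  Such a morphism M' -> N / N' is the same thing as its
   graph {(m, n) | m in M', n in the coset assigned to m}, a graded submodule
   of M * N from which M' is recovered as the domain and N' as the fibre over 0.
   Composition in the quotient is then composition of relations. *)

Definition mor_rel (k : closedFieldType) (p q : nat) (M N : gmod k p q) :
  Type := M -> N -> Prop.

Definition is_mor (k : closedFieldType) (p q : nat) (M N : gmod k p q)
    (G : mor_rel M N) : Prop :=
  [/\ @graded_submod k p q (M * N)%type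
        (fun l u => deg M l u.1 /\ deg N l u.2) (fun u => G u.1 u.2),
      cofindim (fun m => exists n, G m n) &
      findim (fun n => G 0 n)].

(* Equality in the colimit: after restricting to a smaller M'' and enlarging to
   a larger N'', both graphs define the same morphism M'' -> N / N''. *)
Definition mor_eq (k : closedFieldType) (p q : nat) (M N : gmod k p q)
    (G H : mor_rel M N) : Prop :=
  exists (M'' : M -> Prop) (N'' : N -> Prop),
    [/\ graded_submod (deg M) M'' /\ cofindim M'',
        graded_submod (deg N) N'' /\ findim N'',
        forall m, M'' m -> (exists n, G m n) /\ (exists n, H m n) &
        forall m n n', M'' m -> G m n -> H m n' -> N'' (n - n')].

Definition mor_id (k : closedFieldType) (p q : nat) (M : gmod k p q) :
  mor_rel M M := fun m n => m = n.

(* First G, then H. *)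
Definition mor_comp (k : closedFieldType) (p q : nat) (M N P : gmod k p q)
  (G : mor_rel M N) (H : mor_rel N P) : mor_rel M P :=
  fun m u => exists2 n, G m n & H n u.

Definition is_iso (k : closedFieldType) (p q : nat) (M N : gmod k p q)
    (G : mor_rel M N) : Prop :=
  is_mor G /\ exists H : mor_rel N M,
    [/\ is_mor H, mor_eq (mor_comp G H) (@mor_id k p q M) &
        mor_eq (mor_comp H G) (@mor_id k p q N)].

Definition coh_iso (k : closedFieldType) (p q : nat) (M N : gmod k p q) :
  Prop := exists G : mor_rel M N, is_iso G.

Definition is_mono (k : closedFieldType) (p q : nat) (M N : gmod k p q)
    (G : mor_rel M N) : Prop :=
  is_mor G /\
  forall (Z : gmod k p q) (u v : mor_rel Z M), is_mor u -> is_mor v ->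
    mor_eq (mor_comp u G) (mor_comp v G) -> mor_eq u v.

Definition coh_zero (k : closedFieldType) (p q : nat) (M : gmod k p q) :
  Prop := forall N : gmod k p q,
  (forall u v : mor_rel M N, is_mor u -> is_mor v -> mor_eq u v) /\
  (forall u v : mor_rel N M, is_mor u -> is_mor v -> mor_eq u v).

(* M is the direct sum (coproduct) of A and B, with inclusions i and j. *)
Definition is_coprod (k : closedFieldType) (p q : nat) (M A B : gmod k p q)
    (i : mor_rel A M) (j : mor_rel B M) : Prop :=
  [/\ is_mor i, is_mor j &
   forall (Z : gmod k p q) (u : mor_rel A Z) (v : mor_rel B Z),
     is_mor u -> is_mor v ->
     exists w : mor_rel M Z,
       [/\ is_mor w, mor_eq (mor_comp i w) u, mor_eq (mor_comp j w) v &
        forall w' : mor_rel M Z, is_mor w' -> mor_eq (mor_comp i w') u ->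
          mor_eq (mor_comp j w') v -> mor_eq w' w]].

Definition indecomposable (k : closedFieldType) (p q : nat)
    (M : gmod k p q) : Prop :=
  ~ coh_zero M /\
  forall (A B : gmod k p q) (i : mor_rel A M) (j : mor_rel B M),
    is_coprod i j -> coh_zero A \/ coh_zero B.

(* There is a chain of n proper subobjects M_n < ... < M_1 < M. *)
Fixpoint has_chain (k : closedFieldType) (p q : nat) (n : nat)
    (M : gmod k p q) : Prop :=
  if n is n'.+1 then
    exists (A : gmod k p q) (G : mor_rel A M),
      [/\ is_mono G, ~ is_iso G & has_chain n' A]
  else True.

Definition finite_length (k : closedFieldType) (p q : nat) (M : gmod k p q) :
  Prop := exists n, ~ has_chain n M.

(* Vector bundles: torsion-free sheaves, i.e. those without nonzero subobject
   of finite length. *)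
Definition vector_bundle (k : closedFieldType) (p q : nat) (M : gmod k p q) :
  Prop := forall (A : gmod k p q) (G : mor_rel A M),
  is_mono G -> finite_length A -> coh_zero A.

(* Homogeneous prime of S defining the point lambda of the weighted projective
   line; None stands for infinity. *)
Definition point_prime (k : closedFieldType) (p q : nat) (lam : option k) :
  Sring k :=
  match lam with
  | None => Sx1 k
  | Some a => if a == 0 then Sx2 k else Sx2 k ^+ q - Sconst a * Sx1 k ^+ p
  end.

(* The category U_lambda of finite length sheaves concentrated at lambda. *)
Definition tube (k : closedFieldType) (p q : nat) (lam : option k)
    (M : gmod k p q) : Prop :=
  finite_length M /\ exists n : nat,
    findim (fun u : M => exists v : M, u = point_prime p q lam ^+ n *: v).

(* M is isomorphic, as a sheaf, to the graded module (S / fS)(l): the latter is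
   the graded module with one generator, in degree -l, whose annihilator is fS.
   For f = 0 this is the line bundle O(l). *)
Definition cyclic_sheaf (k : closedFieldType) (p q : nat) (f : Sring k)
    (l : Lgrp p q) (M : gmod k p q) : Prop :=
  exists N : gmod k p q, coh_iso M N /\
  exists g : N,
    [/\ deg N (- l) g, forall u : N, exists s : Sring k, u = s *: g &
        forall s : Sring k, s *: g = 0 <-> exists t, s = t * f].

Definition unit_itv (R : realType) : set R := [set t | 0 <= t <= 1].

(* Only the values on [0, 1] matter. *)
Definition curve (R : realType) : Type := R -> R * R.

Definition curve_continuous (R : realType) (c : curve R) : Prop :=
  {within @unit_itv R, continuous c}.

Definition annulus (R : realType) : set (R * R) :=
  [set u | 1 <= u.1 ^+ 2 + u.2 ^+ 2 <= 4].

(* The covering of the annulus by the strip R x [0, 1]: the line y = 1 covers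
   the inner boundary (radius 1) and y = 0 the outer one (radius 2), and
   increasing x turns anti-clockwise. *)
Definition annulus_cover (R : realType) (u : R * R) : R * R :=
  ((2 - u.2) * cos (2 * pi * u.1), (2 - u.2) * sin (2 * pi * u.1)).

Definition inner_pt (R : realType) (p : nat) (i : int) : R * R :=
  (i%:~R / p%:R, 1).
Definition outer_pt (R : realType) (q : nat) (j : int) : R * R :=
  (j%:~R / q%:R, 0).

Definition strip_arc (R : realType) (P Q : R * R) (c : curve R) : Prop :=
  [/\ curve_continuous c, c 0 = P, c 1 = Q,
      forall t, 0 < t < 1 -> 0 < (c t).2 < 1 &
      {in @unit_itv R &, injective c}].

Definition bridging_lift (R : realType) (p q : nat) (j i : int)
    (c : curve R) : Prop :=
  strip_arc (outer_pt R q j) (inner_pt R p i) c.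

Definition inner_lift (R : realType) (p : nat) (i j : int) (c : curve R) :
  Prop := 2 <= j - i /\ strip_arc (inner_pt R p i) (inner_pt R p j) c.

Definition outer_lift (R : realType) (q : nat) (i j : int) (c : curve R) :
  Prop := 2 <= j - i /\ strip_arc (outer_pt R q i) (outer_pt R q j) c.

Definition bridging_curve (R : realType) (p q : nat) (g : curve R) : Prop :=
  exists j i c, bridging_lift p q j i c /\ g = @annulus_cover R \o c.

Definition inner_curve (R : realType) (p : nat) (g : curve R) : Prop :=
  exists i j c, inner_lift p i j c /\ g = @annulus_cover R \o c.

Definition outer_curve (R : realType) (q : nat) (g : curve R) : Prop :=
  exists i j c, outer_lift q i j c /\ g = @annulus_cover R \o c.

Definition ncycle (R : realType) (n : nat) (g : curve R) : Prop :=
  exists c : curve R,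
    [/\ curve_continuous c, forall t, 0 <= t <= 1 -> 0 < (c t).2 < 1,
        c 1 = c 0 + (n%:R, 0) & g = @annulus_cover R \o c].

Definition loop (R : realType) (g : curve R) : Prop := ncycle 1 g.

Definition curve_pow (R : realType) (g : curve R) (n : nat) : curve R :=
  fun t => g (n%:R * t - (Num.floor (n%:R * t))%:~R).

Definition annulus_homotopy (R : realType) (g h : curve R)
    (H : R * R -> R * R) : Prop :=
  [/\ {within @unit_itv R `*` @unit_itv R, continuous H},
      forall s t, 0 <= s <= 1 -> 0 <= t <= 1 -> annulus (H (s, t)),
      forall t, 0 <= t <= 1 -> H (0, t) = g t &
      forall t, 0 <= t <= 1 -> H (1, t) = h t].

Definition homotopic (R : realType) (g h : curve R) : Prop :=
  exists2 H, annulus_homotopy g h H &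
    forall s, 0 <= s <= 1 -> H (s, 0) = g 0 /\ H (s, 1) = g 1.

Definition freely_homotopic (R : realType) (g h : curve R) : Prop :=
  exists2 H, annulus_homotopy g h H &
    forall s, 0 <= s <= 1 -> H (s, 0) = H (s, 1).

Definition param_cycle (k : closedFieldType) (R : realType)
    (n : nat) (x : k * curve R) : Prop :=
  [/\ x.1 != 0, (0 < n)%N & exists2 g, loop g & x.2 = curve_pow g n].

Inductive datum (k : closedFieldType) (R : realType) (p q : nat) : Type :=
| Bridging of {g : curve R | bridging_curve p q g}
| Inner of {g : curve R | inner_curve p g}
| Outer of {g : curve R | outer_curve q g}
| Cycle of {x : k * curve R | exists n, param_cycle n x}.

Arguments Bridging k {R p q}.
Arguments Inner k {R p} q.
Arguments Outer k {R} p {q}.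
Arguments Cycle {k R} p q.

Definition same_datum (k : closedFieldType) (R : realType) (p q : nat)
    (d e : datum k R p q) : Prop :=
  match d, e with
  | Bridging g, Bridging h => homotopic (sval g) (sval h)
  | Inner g, Inner h => homotopic (sval g) (sval h)
  | Outer g, Outer h => homotopic (sval g) (sval h)
  | Cycle x, Cycle y =>
      (sval x).1 = (sval y).1 /\ freely_homotopic (sval x).2 (sval y).2
  | _, _ => False
  end.

(* F induces a bijection from the classes of I modulo eqI onto the isomorphism
   classes of the sheaves satisfying P. *)
Definition parametrizes (k : closedFieldType) (p q : nat) (I : Type)
    (eqI : I -> I -> Prop) (P : gmod k p q -> Prop) (F : I -> gmod k p q) :
  Prop :=
  [/\ forall d, P (F d),
      forall d e, eqI d e <-> coh_iso (F d) (F e) &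
      forall M, P M -> exists d, coh_iso M (F d)].

(* Main.v *)
Require Import Defs.
From HB Require Import structures.
From mathcomp Require Import all_boot all_order all_algebra.
From mathcomp Require Import all_classical all_reals all_analysis.
From mathcomp Require mpoly.
Import (canonicals, coercions) mpoly.
From mathcomp Require Import ring lra zify.
Import Order.TTheory GRing.Theory Num.Theory numFieldNormedType.Exports.
Local Open Scope ring_scope.

Set Implicit Arguments.
Unset Strict Implicit.
Unset Printing Implicit Defensive.

(* A correspondence [G] between graded modules is an isomorphism of sheaves iff,
   up to multiplication by high powers of both [x_1] and [x_2], it is everywhere
   defined, surjective, injective and single-valued; this turns every question on
   coherent sheaves into one on modules up to such powers. Homogeneous forms factor
   into the primes of the points of the line, because [k] is algebraically closed,
   and distinct points give coprime primes.
   If [M] is indecomposable and not torsion, a suitable form [f] multiplies [M]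
   into a free graded submodule, where the saturation of [f M] has depth two, hence
   is free; since H^2 of torsion vanishes, a rank one summand of it lifts along the
   multiplication by [f] to a direct summand of [M], so the sheaf is O(l). If [M]
   is torsion, coprimality leaves a single point lambda, and a cyclic submodule
   [m S] of maximal exponent [n] has a complement, a graded submodule maximal among
   those meeting [m S] trivially, so the sheaf is [S / pt^n] twisted.
   Conversely these cyclic modules are uniform, hence indecomposable. O(l)
   determines [l]; a torsion one determines [lambda], [n] and the twist modulo the
   degrees of forms invertible at lambda. On the annulus, homotopies with fixed
   ends (resp. free homotopies of closed curves) preserve the total angular
   variation, so lifts of homotopic curves differ by an integral translation (resp.
   closed curves have the same winding number), and straight-line homotopies in the
   strip give the converse. *)

(** * The coordinate ring *)

Section Noetherian.

(** Finite dimension is handled through powers of the two variables. If both [x_1^K] and [x_2^K]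
    kill the generators, finitely many monomials span, and noetherianity supplies generators for
    every submodule; conversely, the powers of one variable applied to a homogeneous element have
    pairwise distinct degrees. The algebra rests on [x_1], [x_2] being a regular sequence. It makes
    principal ideals saturated, so that [S / f] has no negligible elements and can be computed with
    directly, without passing to the quotient category. The grading group may have torsion, so
    degrees carry no convenient total order. Degree arguments use instead that [1] is the only
    monomial of degree zero and that monomials in a single variable are determined by their degree.
    On the topological side no homotopy is lifted to the strip. Angles between consecutive points of
    a fine grid are summed instead; the sum varies continuously along the homotopy, and at both ends
    of the homotopy it is [2 pi] times the displacement of a lift that is already known. *)

Definition is_submod (A : comNzRingType) (V : lmodType A) (W : V -> Prop) :=
  W 0 /\ forall a x y, W x -> W y -> W (a *: x + y).

(** The impredicative form, as an intersection of submodules, replaces manipulations of coefficients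
    by the choice of a submodule to test against; [span_comb] recovers coefficients. *)
Definition span (A : comNzRingType) (V : lmodType A) (s : seq V) (x : V) :=
  forall W, is_submod W -> (forall y, y \in s -> W y) -> W x.

Definition fg_submod (A : comNzRingType) (V : lmodType A) (W : V -> Prop) :=
  exists2 s : seq V, forall x, x \in s -> W x & forall x, W x -> span s x.

Definition noetherian (A : comNzRingType) :=
  forall I : A^o -> Prop, is_submod I -> fg_submod I.

Section Submod.
Variables (A : comNzRingType) (V : lmodType A).
Implicit Types (W : V -> Prop) (s : seq V).

Lemma submod0 W : is_submod W -> W 0. Proof. by case. Qed.

Lemma submodZ W a x : is_submod W -> W x -> W (a *: x).
Proof. by move=> [W0 WD] Wx; rewrite -[_ *: _]addr0; apply: WD. Qed.

Lemma submodD W x y : is_submod W -> W x -> W y -> W (x + y).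
Proof. by move=> [_ WD] Wx Wy; rewrite -[x]scale1r; apply: WD. Qed.

Lemma submodN W x : is_submod W -> W x -> W (- x).
Proof. by move=> hW Wx; rewrite -scaleN1r; apply: submodZ. Qed.

Lemma submodB W x y : is_submod W -> W x -> W y -> W (x - y).
Proof. by move=> hW Wx Wy; apply: submodD => //; apply: submodN. Qed.

Lemma submod_sum W (I : eqType) (r : seq I) (F : I -> V) :
  is_submod W -> (forall i, i \in r -> W (F i)) -> W (\sum_(i <- r) F i).
Proof.
move=> hW hF; rewrite big_seq; apply: (big_ind W) => //; first exact: submod0.
by move=> x y; apply: submodD.
Qed.

Lemma submod_sum_ord W n (F : 'I_n -> V) :
  is_submod W -> (forall i, W (F i)) -> W (\sum_(i < n) F i).
Proof.
move=> hW hF; apply: (big_ind W) => //; first exact: submod0.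
by move=> x y; apply: submodD.
Qed.

Lemma span_submod s : is_submod (span s).
Proof.
split=> [W hW _|a x y hx hy W hW hs]; first exact: submod0.
by case: (hW) => _; apply; [apply: hx|apply: hy].
Qed.

Lemma mem_span s x : x \in s -> span s x.
Proof. by move=> xs W _; apply. Qed.

Lemma span_min s W x :
  is_submod W -> (forall y, y \in s -> W y) -> span s x -> W x.
Proof. by move=> hW hs; apply. Qed.

Lemma span_comb s x :
  span s x -> exists c : nat -> A, x = \sum_(i < size s) c i *: s`_i.
Proof.
move=> hx; apply: (hx (fun x => exists c : nat -> A, _)).
  split=> [|a y z [c ->] [d ->]].
    by exists (fun=> 0); rewrite big1 // => i _; rewrite scale0r.
  exists (fun i => a * c i + d i); rewrite scaler_sumr -big_split /=.
  by apply: eq_bigr => i _; rewrite scalerDl scalerA.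
move=> y ys; exists (fun i => (i == index y s)%:R).
rewrite -index_mem in ys; rewrite (bigD1 (Ordinal ys)) //= eqxx scale1r.
rewrite big1 ?addr0 => [|i /negP ne]; first by rewrite nth_index // -index_mem.
by case: eqP => [e|_]; [case: ne; apply/eqP/val_inj|rewrite scale0r].
Qed.

Lemma span_cons g s x : span (g :: s) x -> exists a, span s (x - a *: g).
Proof.
apply: (span_min (W := fun x => exists a, span s (x - a *: g))).
  have hs := span_submod s; split=> [|a y z [c hc] [d hd]].
    by exists 0; rewrite scale0r subr0; apply: submod0 hs.
  exists (a * c + d).
  have -> : a *: y + z - (a * c + d) *: g = a *: (y - c *: g) + (z - d *: g).
    by rewrite scalerBr scalerA scalerDl opprD addrACA.
  by case: hs => _; apply.
move=> y; rewrite inE => /predU1P[->|ys].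
  by exists 1; rewrite scale1r subrr; apply: submod0 (span_submod s).
by exists 0; rewrite scale0r subr0; apply: mem_span.
Qed.

(** Induction on the number of generators: [W] is generated by lifts of generators of its ideal of
    coefficients along [g], together with generators of its part inside the span of the remaining
    elements. *)
Lemma noetherian_fg (hA : noetherian A) s W :
  is_submod W -> (forall x, W x -> span s x) -> fg_submod W.
Proof.
elim: s W => [|g s IH] W hW hWs.
  by exists [::].
have hs := span_submod s.
(* The ideal of coefficients that [g] takes in elements of [U], modulo the span of [s]. *)
pose J U (a : A^o) := exists2 y, span s y & U (a *: g + y).
have hJ (U : V -> Prop) : is_submod U -> is_submod (J U).
  move=> hU; split=> [|a b c [y hy Uy] [z hz Uz]].
    by exists 0; rewrite ?scale0r ?addr0; apply: submod0.
  exists (a *: y + z); first by case: hs => _; apply.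
  have -> : (a *: b + c : A^o) *: g + (a *: y + z)
      = a *: (b *: g + y) + (c *: g + z).
    by rewrite scalerDl scalerDr -scalerA addrACA.
  by case: hU => _; apply.
have [t htJ htgen] := hA _ (hJ _ hW).
(* Each generator of the ideal is realised by an element of [W]. The conclusion is stated for every
   [U] containing these elements, so that it can be fed the submodule coming from the definition of
   [span]. *)
have [ws hws hwsJ] : exists2 ws : seq V, forall x, x \in ws -> W x &
    forall U : V -> Prop, (forall x, x \in ws -> U x) ->
    forall a, a \in t -> J (fun x => W x /\ U x) a.
  elim: t htJ {htgen} => [|a t IHt] htJ; first by exists [::].
  have [|ws hws hwsJ] := IHt; first by move=> b bt; apply: htJ; rewrite inE bt orbT.
  have [y hy Wy] := htJ a (mem_head _ _).
  exists (a *: g + y :: ws) => [x|U hU b].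
    by rewrite inE => /predU1P[->|/hws].
  rewrite inE => /predU1P[->|bt]; first by exists y => //; split=> //; apply: hU; rewrite mem_head.
  by apply: hwsJ bt => x xs; apply: hU; rewrite inE xs orbT.
have [| |t' ht' ht'gen] := IH (fun x => W x /\ span s x).
- by split=> [|a x y [? ?] [? ?]]; split; [apply: submod0|apply: submod0|case: hW=> _; apply|case: hs => _; apply].
- by move=> x [].
exists (ws ++ t') => [x|x Wx U hU hUs].
  by rewrite mem_cat => /orP[/hws|/ht'[]].
have hUs1 y : y \in ws -> U y by move=> h; apply: hUs; rewrite mem_cat h.
have hUs2 y : y \in t' -> U y by move=> h; apply: hUs; rewrite mem_cat h orbT.
have [a ha] := span_cons (hWs _ Wx).
have Ja : J W a by exists (x - a *: g) => //; rewrite addrC subrK.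
have hWU : is_submod (fun x => W x /\ U x).
  by split=> [|b y z [? ?] [? ?]]; split; [apply: submod0|apply: submod0|case: hW=> _; apply|case: hU => _; apply].
have [y hy [Wy Uy]] := htgen a Ja _ (hJ _ hWU) (hwsJ U hUs1).
rewrite -[x](subrK (a *: g + y)); apply: submodD => //.
apply: (ht'gen _ _ U) => //; split; first exact: submodB.
by rewrite opprD addrA; apply: (submodB hs).
Qed.

End Submod.

Lemma noetherian_surj (A B : comNzRingType) (f : {rmorphism A -> B}) :
  (forall b, exists a, f a = b) -> noetherian A -> noetherian B.
Proof.
move=> fsurj hA I hI.
have [|s hs hgen] := hA (fun a => I (f a)).
  split=> [|a x y Ix Iy]; first by rewrite rmorph0; exact: submod0 hI.
  by rewrite rmorphD rmorphM; case: hI => _; apply.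
exists (map f s) => [x /mapP[a /hs Ia ->] //|x Ix W hW hsW].
have [a e] := fsurj x; rewrite -e in Ix *.
apply: (hgen _ Ix (fun a => W (f a))) => [|y ys].
  split=> [|b y z Wy Wz]; first by rewrite rmorph0; exact: submod0 hW.
  by rewrite rmorphD rmorphM; case: hW => _; apply.
exact/hsW/map_f.
Qed.

Lemma noetherian_field (k : fieldType) : noetherian k.
Proof.
move=> I hI; have [[a Ia a0]|no] := pselect (exists2 a, I a & a != 0).
  exists [:: a : k^o] => [x|x _ W hW hs]; first by rewrite inE => /eqP->.
  rewrite -[x](divfK a0); apply: (submodZ (V := k^o)) => //.
  by apply: hs; rewrite mem_head.
exists [::] => // x Ix W hW _; have [->|x0] := eqVneq x 0; first exact: submod0 hW.
by case: no; exists x.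
Qed.

(** Hilbert's basis theorem. The ideals of leading coefficients in degree [d] grow with [d] and are
    constant from some [D] on; polynomials realising generators of these ideals up to [D] generate
    [I], by induction on the size. *)
Lemma noetherian_poly (A : comNzRingType) : noetherian A -> noetherian {poly A}.
Proof.
move=> hA I hI.
(* The size of [p] may be smaller than [d.+1], in which case [a] is zero; this is what makes
   [lead J d] an ideal. *)
pose lead (J : {poly A} -> Prop) d (a : A^o) :=
  exists p, [/\ J p, (size p <= d.+1)%N & p`_d = a].
have hlead (J : {poly A}^o -> Prop) d : is_submod J -> is_submod (lead J d).
  move=> hJ; split=> [|a b c [p [Jp sp <-]] [r [Jr sr <-]]].
    by exists 0; rewrite size_poly0 coef0; split=> //; apply: (submod0 hJ).
  exists (a *: p + r); split.
  - by rewrite -mul_polyC; case: hJ => _; apply.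
  - by rewrite (leq_trans (size_polyD _ _)) // geq_max sr andbT (leq_trans (size_scale_leq _ _)).
  - by rewrite coefD coefZ.
have mulX (J : {poly A}^o -> Prop) d n a : is_submod J -> lead J d a -> lead J (n + d)%N a.
  move=> hJ [p [Jp sp <-]]; exists ('X^n * p); split.
  - exact: submodZ.
  - rewrite (leq_trans (size_polyMleq _ _)) // size_polyXn /= -addnS leq_add2l //.
  - by rewrite coefXnM ltnNge leq_addr /= addKn.
have mono d d' a : (d <= d')%N -> lead I d a -> lead I d' a.
  by move=> le; rewrite -(subnK le); apply: mulX.
have [|s hs hsgen] := hA (fun a => exists d, lead I d a).
  split=> [|a b c [d Hd] [d' Hd']]; first by exists 0%N; apply: submod0; exact: hlead.
  exists (maxn d d'); have [_] := hlead _ (maxn d d') hI.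
  by apply; [exact: mono (leq_maxl _ _) Hd|exact: mono (leq_maxr _ _) Hd'].
(* The union of the increasing chain is finitely generated, so all its generators occur in one
   degree. *)
have [D hD] : exists D, forall a, a \in s -> lead I D a.
  elim: s hs {hsgen} => [|a s IH] hs; first by exists 0%N.
  have [|D HD] := IH; first by move=> b bs; apply: hs; rewrite inE bs orbT.
  have [d Hd] := hs a (mem_head _ _).
  exists (maxn d D) => b; rewrite inE => /predU1P[->|/HD].
    exact: mono (leq_maxl _ _) Hd.
  exact: mono (leq_maxr _ _).
have leadD d a : lead I d a -> lead I (minn d D) a.
  move=> Ha; rewrite minnC /minn; case: ltnP => [|//] _.
  apply: (hsgen a) => //; [by exists d|exact: hlead].
have one d : exists2 t : seq {poly A}, forall p, p \in t -> I p &
    forall J, is_submod (V := {poly A}^o) J -> (forall p, p \in t -> J p) ->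
    forall a, lead I d a -> lead (fun p => I p /\ J p) d a.
  have [t ht htgen] := hA _ (hlead I d hI).
  have [t' It' Ht'] : exists2 t' : seq {poly A}, forall p, p \in t' -> I p &
     forall J : {poly A} -> Prop, (forall p, p \in t' -> J p) ->
     forall a, a \in t -> lead (fun p => I p /\ J p) d a.
    elim: t ht {htgen} => [|a t IH] ht; first by exists [::].
    have [|t' It' Ht'] := IH; first by move=> b bs; apply: ht; rewrite inE bs orbT.
    have [p [Ip sp e]] := ht a (mem_head _ _).
    exists (p :: t') => [r|J HJ b]; first by rewrite inE => /predU1P[->|/It'].
    rewrite inE => /predU1P[->|bt].
      by exists p; split=> //; split=> //; apply: HJ; rewrite mem_head.
    by apply: Ht' bt => r rt; apply: HJ; rewrite inE rt orbT.
  exists t' => // J hJ Jt' a /htgen; apply; last exact: Ht'.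
  apply: hlead; split=> [|b x y [? ?] [? ?]]; first by split; [apply: (submod0 hI)|apply: (submod0 hJ)].
  by split; [case: hI=> _; apply|case: hJ => _; apply].
have [t It Ht] : exists2 t : seq {poly A}, forall p, p \in t -> I p &
    forall J, is_submod (V := {poly A}^o) J -> (forall p, p \in t -> J p) ->
    forall d, (d <= D)%N -> forall a, lead I d a -> lead (fun p => I p /\ J p) d a.
  elim: (D) => [|n [t It Ht]].
    have [t It Ht] := one 0%N; exists t => // J hJ Jt d.
    by rewrite leqn0 => /eqP->; exact: Ht.
  have [t' It' Ht'] := one n.+1.
  exists (t ++ t') => [p|J hJ Jt d]; first by rewrite mem_cat => /orP[/It|/It'].
  have Jt1 p : p \in t -> J p by move=> pt; apply: Jt; rewrite mem_cat pt.
  have Jt2 p : p \in t' -> J p by move=> pt; apply: Jt; rewrite mem_cat pt orbT.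
  by rewrite leq_eqVlt => /predU1P[->|/Ht]; [exact: Ht'|exact].
exists t => // p Ip W hW htW.
move: {2}(size p) (leqnn (size p)) => n; elim: n p Ip => [|n IH] p Ip.
  by rewrite leqn0 size_poly_eq0 => /eqP->; exact: submod0 hW.
move=> sp; have : lead I n p`_n by exists p.
move=> /leadD /(Ht _ hW htW _ (geq_minr _ _)).
have hIW : is_submod (V := {poly A}^o) (fun p => I p /\ W p).
  by split=> [|b x y [? ?] [? ?]]; split; [apply: submod0|apply: submod0|case: hI=> _; apply|case: hW => _; apply].
move=> /(mulX _ _ (n - minn n D)%N _ hIW); rewrite subnK ?geq_minl // => -[r [[Ir Wr] sr er]].
rewrite -(subrK r p); apply: (submodD (V := {poly A}^o)) => //; apply: IH.
  exact: (submodB (V := {poly A}^o)).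
apply/leq_sizeP => j; rewrite leq_eqVlt coefB => /predU1P[<-|nj]; first by rewrite er subrr.
by rewrite !nth_default ?subrr // (leq_trans _ nj).
Qed.

End Noetherian.

(** * Regularity of the two variables, and comaximality up to their powers *)

Section CoordinateRing.
Variable k : closedFieldType.
Local Notation S := (Sring k).
Implicit Types (s t f g h : S) (b : bool).

(** The same polynomial ring with its integral domain structure, which the type of [Sring]
    forgets. *)
Definition Sdom : idomainType := mpoly.mpoly 2 k.

Lemma S_mulf_eq0 s t : s * t = 0 -> s = 0 \/ t = 0.
Proof.
move=> /eqP; have := mulf_eq0 (s : Sdom) t; move=> e.
by rewrite [X in is_true X -> _]e => /orP[]/eqP; [left|right].
Qed.

Lemma S_mulfI s t t' : s != 0 -> s * t = s * t' -> t = t'.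
Proof. by move=> s0; exact: (mulfI (R := Sdom) s0). Qed.

Lemma S_mulf_neq0 s t : s != 0 -> t != 0 -> s * t != 0.
Proof. by move=> s0 t0; apply/eqP => /S_mulf_eq0[] e; move: s0 t0; rewrite e eqxx. Qed.

Lemma S_expf_neq0 s n : s != 0 -> s ^+ n != 0.
Proof.
by move=> s0; elim: n => [|n IH]; rewrite ?expr0 ?oner_neq0 // exprS S_mulf_neq0.
Qed.

(** Indexing the variables by a boolean lets [~~ b] name the other one, so that symmetric statements
    are proved once. *)
Definition X b : S := if b then Sx1 k else Sx2 k.
Definition iv b : 'I_2 := if b then ord0 else ord_max.

Lemma XE b : X b = mpoly.mpolyX k (mpoly.mnm1 (iv b)).
Proof. by case: b. Qed.

Lemma iv_inj : injective iv. Proof. by case=> [] []. Qed.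

Lemma mnm_ext (m m' : mpoly.multinom 2) :
  (forall b, m (iv b) = m' (iv b)) -> m = m'.
Proof.
move=> e; apply/mpoly.mnmP => i.
have -> : i = iv (i == ord0).
  by case: eqP => [->//|]; case: i => [[|[|//]]] hi ne; [case: ne|]; apply: val_inj.
exact: e.
Qed.

Lemma monomialE (m : mpoly.multinom 2) :
  mpoly.mpolyX k m = X true ^+ m (iv true) * X false ^+ m (iv false).
Proof.
rewrite mpoly.mpolyXE_id big_ord_recl big_ord1 !XE.
by congr (_ * mpoly.mpolyX k (mpoly.mnm1 _) ^+ m _); apply: val_inj.
Qed.

Lemma SconstM (a : k) s : Sconst a * s = a *: (s : mpoly.mpoly 2 k).
Proof. exact: mpoly.mul_mpolyC. Qed.

Lemma Sconst0 : Sconst (0 : k) = 0. Proof. exact: rmorph0. Qed.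
Lemma Sconst1 : Sconst (1 : k) = 1. Proof. exact: rmorph1. Qed.
Lemma SconstD (a c : k) : Sconst (a + c) = Sconst a + Sconst c.
Proof. exact: rmorphD. Qed.
Lemma SconstN (a : k) : Sconst (- a) = - Sconst a.
Proof. exact: rmorphN. Qed.
Lemma SconstMM (a c : k) : Sconst (a * c) = Sconst a * Sconst c.
Proof. exact: rmorphM. Qed.

(** [S] is the image of a polynomial ring in two successive variables over [k], evaluated at [x_1]
    and [x_2]. *)
Lemma S_noetherian : noetherian S.
Proof.
have c1 : commr_rmorph (@mpoly.mpolyC 2 k) (X true) by move=> a; exact: mulrC.
pose f1 : {rmorphism {poly k} -> S} := horner_morph c1.
have c2 : commr_rmorph f1 (X false) by move=> a; exact: mulrC.
pose f2 : {rmorphism {poly {poly k}} -> S} := horner_morph c2.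
apply: (noetherian_surj (f := f2)); last first.
  exact/noetherian_poly/noetherian_poly/noetherian_field.
have fX b : exists a, f2 a = X b.
  by case: b; [exists ('X%:P)|exists 'X]; rewrite /f2 /= ?horner_morphC ?horner_morphX // /f1 /= horner_morphX.
have fXn b n : exists a, f2 a = X b ^+ n.
  by have [a <-] := fX b; exists (a ^+ n); rewrite rmorphXn.
move=> s; rewrite (mpoly.mpolyE s).
apply: (big_ind (fun s : S => exists a, f2 a = s)).
- by exists 0; rewrite rmorph0.
- by move=> x y [a <-] [c <-]; exists (a + c); rewrite rmorphD.
move=> m _; rewrite monomialE.
have [a1 e1] := fXn true (m (iv true)); have [a2 e2] := fXn false (m (iv false)).
exists ((mpoly.mcoeff m s)%:P%:P * (a1 * a2)).
rewrite !rmorphM e1 e2 -SconstM; congr (_ * _).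
by rewrite /f2 /= horner_morphC /f1 /= horner_morphC.
Qed.

Lemma mcoeff_XM b s m :
  mpoly.mcoeff (mpoly.mnm_add (mpoly.mnm1 (iv b)) m) (X b * s) = mpoly.mcoeff m s.
Proof. by rewrite mulrC XE mpoly.mcoeffMX. Qed.

Lemma mcoeff_XM0 b s (m : mpoly.multinom 2) : m (iv b) = 0%N -> mpoly.mcoeff m (X b * s) = 0.
Proof.
move=> m0; apply/eqP; rewrite mpoly.mcoeff_eq0; apply/negP.
rewrite mulrC XE (perm_mem (mpoly.msuppMX _ _)) => /mapP[m' _ e].
by move: m0; rewrite e mpoly.mnmDE mpoly.mnm1E eqxx.
Qed.

(** The remainder collects the monomials of [s] in which [X b] does not occur. *)
Lemma S_divX b s : exists t r, s = X b * t + r /\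
  forall m : mpoly.multinom 2, mpoly.mcoeff m r =
    if m (iv b) == 0%N then mpoly.mcoeff m s else 0.
Proof.
pose r : S := \sum_(m <- mpoly.msupp s | m (iv b) == 0%N)
   mpoly.mcoeff m s *: mpoly.mpolyX k m.
have er m : mpoly.mcoeff m r = if m (iv b) == 0%N then mpoly.mcoeff m s else 0.
  rewrite /r raddf_sum /=; case: ifP => mb; last first.
    rewrite big1 // => m' m'b; rewrite mpoly.mcoeffZ mpoly.mcoeffX.
    by case: eqP => [e|_]; rewrite ?mulr0 //; move: m'b; rewrite e mb.
  have [ms|ms] := boolP (m \in mpoly.msupp s); last first.
    rewrite big_seq_cond big1 => [|m' /andP[m's _]].
      by apply/esym/eqP; rewrite mpoly.mcoeff_eq0.
    rewrite mpoly.mcoeffZ mpoly.mcoeffX; case: eqP => [e|_]; rewrite ?mulr0 //.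
    by move: ms; rewrite -e m's.
  rewrite big_mkcond (bigD1_seq m) ?mpoly.msupp_uniq //= mb big1.
    by rewrite mpoly.mcoeffZ mpoly.mcoeffX eqxx mulr1 addr0.
  move=> m' ne; case: ifP => // _.
  by rewrite mpoly.mcoeffZ mpoly.mcoeffX (negPf ne) mulr0.
suff [t et] : exists t, s - r = X b * t by exists t, r; rewrite -et subrK.
rewrite (mpoly.mpolyE (s - r)) big_seq.
apply: (big_ind (fun u : S => exists t, u = X b * t)).
- by exists 0; rewrite mulr0.
- by move=> x y [t ->] [t' ->]; exists (t + t'); rewrite mulrDr.
move=> m; rewrite mpoly.mcoeff_msupp; set c := mpoly.mcoeff m (s - r) => c0.
have mb : (m (iv b) == 0%N) = false.
  by apply/negP => mb; move: c0; rewrite /c mpoly.mcoeffB er mb subrr eqxx.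
exists (c *: mpoly.mpolyX k (mpoly.mnm_sub m (mpoly.mnm1 (iv b)))).
have {1}-> : m = mpoly.mnm_add (mpoly.mnm1 (iv b)) (mpoly.mnm_sub m (mpoly.mnm1 (iv b))).
  apply/mpoly.mnmP => i; rewrite mpoly.mnmDE mpoly.mnmBE mpoly.mnm1E.
  by case: eqP => [<-|_]; rewrite ?subn0 // subnKC // lt0n mb.
by rewrite mpoly.mpolyXD -XE -!SconstM mulrCA.
Qed.

(** The part of [s] free of [X b] keeps its coefficients under multiplication by the other variable,
    whereas a multiple of [X b] has no such monomials. *)
Lemma S_regular1 b s t : X (~~ b) * s = X b * t -> exists s', s = X b * s'.
Proof.
move=> e; have [s' [r [es er]]] := S_divX b s.
exists s'; rewrite es [r](_ : _ = 0) ?addr0 //.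
apply/mpoly.mpolyP => m; rewrite mpoly.mcoeff0 er; case: eqP => // mb.
rewrite -(mcoeff_XM (~~ b)) e mcoeff_XM0 // mpoly.mnmDE mpoly.mnm1E mb.
by rewrite (inj_eq iv_inj); case: (b).
Qed.

Lemma X_neq0 b : X b != 0.
Proof.
apply/eqP => /(congr1 (mpoly.mcoeff (mpoly.mnm1 (iv b)))).
by rewrite XE mpoly.mcoeffX eqxx mpoly.mcoeff0 => /eqP; rewrite oner_eq0.
Qed.

Lemma S_regular b K K' s t :
  X (~~ b) ^+ K' * s = X b ^+ K * t -> exists s', s = X b ^+ K * s'.
Proof.
have reg1 c s1 t1 : X (~~ b) ^+ c * s1 = X b * t1 -> exists s', s1 = X b * s'.
  elim: c s1 t1 => [|c IH] s1 t1; first by rewrite mul1r => ->; exists t1.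
  by rewrite exprSr -mulrA => /IH[s'] /S_regular1.
elim: K s t => [|K IH] s t; first by exists s; rewrite mul1r.
rewrite exprS -mulrA => /[dup] /reg1 [s' ->].
rewrite mulrCA => /(S_mulfI (X_neq0 b)) /IH[s'' ->].
by exists s''; rewrite mulrA.
Qed.

(** Saturation of principal ideals: the two cofactors satisfy [x_2^K t1 = x_1^K t2], and regularity
    divides [t1] by [x_1^K]. *)
Lemma S_sat_dvd r f K : r != 0 ->
  (forall b, exists t, X b ^+ K * f = t * r) -> exists t, f = t * r.
Proof.
move=> r0 H; have [t1 e1] := H true; have [t2 e2] := H false.
have e : X false ^+ K * t1 = X true ^+ K * t2.
  apply: (S_mulfI r0); rewrite mulrCA [r * t1]mulrC -e1.
  by rewrite [RHS]mulrCA [r * t2]mulrC -e2 mulrCA.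
have [t et] := S_regular (b := true) e; exists t.
apply: (S_mulfI (S_expf_neq0 K (X_neq0 true))).
by rewrite e1 et mulrA.
Qed.

Definition coef0 s : k := mpoly.mcoeff (@mpoly.mnm0 2) s.

Lemma coef0M s t : coef0 (s * t) = coef0 s * coef0 t.
Proof. by rewrite /coef0 rmorphM. Qed.

Lemma coef0X b : coef0 (X b) = 0.
Proof. by rewrite /coef0 XE mpoly.mcoeffX mpoly.mnm1_eq0. Qed.

Lemma coef01 : coef0 1 = 1.
Proof. by rewrite /coef0 rmorph1. Qed.

Lemma coef0Xn b n : (0 < n)%N -> coef0 (X b ^+ n) = 0.
Proof. by case: n => // n _; rewrite exprS coef0M coef0X mul0r. Qed.

(** For forms this says that [f] and [g] have no common zero on the weighted projective line: their
    ideal contains powers of both variables, though it is in general a proper ideal. *)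
Definition comax f g := exists K, forall b, exists s t, X b ^+ K = s * f + t * g.

Lemma comaxC f g : comax f g -> comax g f.
Proof. by move=> [K H]; exists K => b; have [s [t ->]] := H b; exists t, s; rewrite addrC. Qed.

Lemma comaxM f g h : comax f g -> comax f h -> comax f (g * h).
Proof.
move=> [K H] [K' H']; exists (K + K')%N => b.
have [s [t e]] := H b; have [s' [t' e']] := H' b.
exists (s * X b ^+ K' + t * g * s'), (t * t'); rewrite exprD e.
have -> : (s * f + t * g) * X b ^+ K' = s * X b ^+ K' * f + t * g * X b ^+ K' by ring.
by rewrite {2}e'; ring.
Qed.

Lemma comax1 f : comax f 1.
Proof. by exists 0%N => b; exists 0, 1; rewrite mul0r mul1r add0r. Qed.

Lemma comaxXn f g n : comax f g -> comax f (g ^+ n).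
Proof.
by move=> H; elim: n => [|n IH]; [exact: comax1|rewrite exprS; exact: comaxM].
Qed.

End CoordinateRing.

(** * Degrees and the points of the line *)

Section Degrees.
Variables (k : closedFieldType) (p q : nat).
Hypotheses (hp : (0 < p)%N) (hq : (0 < q)%N).
Local Notation S := (Sring k).
Local Notation L := (Lgrp p q).
Implicit Types (s t f g h : S) (b : bool) (l : L) (m : mpoly.multinom 2).

Definition Lx b : L := if b then Lx1 p q else Lx2 p q.

Lemma pair_mulrz (u : int * int) (n : int) : u *~ n = (u.1 * n, u.2 * n).
Proof.
have e1 : (u *~ n).1 = u.1 *~ n by exact: (raddfMz fst).
have e2 : (u *~ n).2 = u.2 *~ n by exact: (raddfMz snd).
by rewrite [LHS]surjective_pairing e1 e2 !mulrzz.
Qed.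

Lemma LxE (i j : int) :
  Lx true *~ i + Lx false *~ j = \pi_L%qT (i, j).
Proof.
rewrite /= /Lx1 /Lx2 -!raddfMz -raddfD /= !pair_mulrz; congr (\pi_L%qT _).
by rewrite /= !mul0r !mul1r; congr pair; rewrite ?addr0 ?add0r.
Qed.

Lemma Lx_surj l : exists i j, l = Lx true *~ i + Lx false *~ j.
Proof.
by exists (repr l).1, (repr l).2; rewrite LxE -surjective_pairing reprK.
Qed.

Lemma Lx_eqP (i j i' j' : int) :
  Lx true *~ i + Lx false *~ j = Lx true *~ i' + Lx false *~ j' <->
  exists n : int, i - i' = p%:Z * n /\ j - j' = - q%:Z * n.
Proof.
rewrite !LxE; split=> [/eqP|[n [e1 e2]]].
  rewrite -Quotient.idealrBE => /asboolP[n]; rewrite pair_mulrz => -[e1 e2].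
  by exists n.
apply/eqP; rewrite -Quotient.idealrBE; apply/asboolP; exists n.
by rewrite pair_mulrz /= -e1 -e2.
Qed.

Lemma mon_degE m : mon_deg p q m = Lx true *~ (m ord0)%:Z + Lx false *~ (m ord_max)%:Z.
Proof. by rewrite -!pmulrn. Qed.

Lemma mon_degD m m' :
  mon_deg p q (mpoly.mnm_add m m') = mon_deg p q m + mon_deg p q m'.
Proof. by rewrite /mon_deg !mpoly.mnmDE !mulrnDr addrACA. Qed.

Lemma mon_deg1 b : mon_deg p q (mpoly.mnm1 (iv b)) = Lx b.
Proof. by case: b; rewrite /mon_deg !mpoly.mnm1E /= mulr0n mulr1n ?addr0 ?add0r. Qed.

Lemma mon_deg0 : mon_deg p q (@mpoly.mnm0 2) = 0.
Proof. by rewrite /mon_deg !mpoly.mnm0E !mulr0n addr0. Qed.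

Lemma Lrel00 : (0 : L) = Lx true *~ 0 + Lx false *~ 0.
Proof. by rewrite !mulr0z addr0. Qed.

(** The group may have torsion, but neither generator is a torsion element: a relation between
    multiples of one generator has coefficient zero on the other, hence is the trivial multiple of
    [p x_1 = q x_2]. *)
Lemma LxMn_inj b : injective (fun n => Lx b *+ n).
Proof.
move=> n n' /=; rewrite !pmulrn => e.
have : exists c : int, n%:Z - n'%:Z = 0 :> int.
  case: b e => e.
    have := (Lx_eqP n 0 n' 0).1; rewrite !mulr0z !addr0 => /(_ e) [c [e1]].
    rewrite ?subrr ?subr0 => /esym/eqP; rewrite mulf_eq0 oppr_eq0 => /orP[|/eqP c0].
      by move=> /eqP ?; lia.
    by exists 0; rewrite e1 c0 mulr0.
  have := (Lx_eqP 0 n 0 n').1; rewrite !mulr0z !add0r => /(_ e) [c [+ e1]].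
  rewrite ?subrr ?oppr0 => /esym/eqP; rewrite mulf_eq0 => /orP[|/eqP c0].
    by move=> /eqP ?; lia.
  by exists 0; rewrite e1 c0 mulr0.
by case=> _ ?; lia.
Qed.

(** The exponents would be [p n] and [- q n]; both are nonnegative, so [n] vanishes. *)
Lemma mon_deg_eq0 m : mon_deg p q m = 0 -> m = @mpoly.mnm0 2.
Proof.
rewrite mon_degE Lrel00 => /Lx_eqP[n [e1 e2]].
have n0 : n = 0.
  by case: (ltrgtP n 0) => // h; exfalso; nia.
apply: mnm_ext => b; rewrite mpoly.mnm0E.
by case: b => /=; rewrite n0 in e1 e2; lia.
Qed.

Lemma homog0 l : S_homog l (0 : S).
Proof. by move=> m; rewrite mpoly.mcoeff_msupp mpoly.mcoeff0 eqxx. Qed.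

Lemma homogP l s : S_homog l s <->
  forall m, mpoly.mcoeff m s != 0 -> mon_deg p q m = l.
Proof. by split=> H m; have := H m; rewrite mpoly.mcoeff_msupp. Qed.

Lemma homogB l s t : S_homog l s -> S_homog l t -> S_homog l (s - t).
Proof.
move=> /homogP hs /homogP ht; apply/homogP => m.
rewrite mpoly.mcoeffB; have [e|/hs//] := eqVneq (mpoly.mcoeff m s) 0.
by rewrite e sub0r oppr_eq0 => /ht.
Qed.

Lemma homogN l s : S_homog l s -> S_homog l (- s).
Proof. by move=> hs; rewrite -sub0r; apply: homogB => //; exact: homog0. Qed.

Lemma homogD l s t : S_homog l s -> S_homog l t -> S_homog l (s + t).
Proof. by move=> hs ht; rewrite -[t]opprK; apply: homogB => //; exact: homogN. Qed.

Lemma homogM l l' s t : S_homog l s -> S_homog l' t -> S_homog (l + l') (s * t).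
Proof.
move=> hs ht m /mpoly.msuppM_le /allpairsP[[m1 m2] /= [h1 h2 ->]].
by rewrite mon_degD (hs _ h1) (ht _ h2).
Qed.

Lemma homogC (a : k) : S_homog (0 : L) (Sconst a).
Proof.
move=> m; rewrite mpoly.msuppC; case: eqP => // _.
by rewrite inE => /eqP->; exact: mon_deg0.
Qed.

Lemma homog1 : S_homog (0 : L) (1 : S).
Proof. by rewrite -Sconst1; exact: homogC. Qed.

Lemma homogX b : S_homog (Lx b) (X k b).
Proof.
by move=> m; rewrite XE mpoly.msuppX inE => /eqP->; exact: mon_deg1.
Qed.

Lemma homogXn l s n : S_homog l s -> S_homog (l *+ n) (s ^+ n).
Proof.
move=> hs; elim: n => [|n IH]; first exact: homog1.
by rewrite exprS mulrS; exact: homogM.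
Qed.

Lemma homogCM l (a : k) s : S_homog l s -> S_homog l (Sconst a * s).
Proof. by move=> hs; rewrite -[l]add0r; apply: homogM => //; exact: homogC. Qed.

Lemma homog_divX l b t : S_homog l (X k b * t) -> S_homog (l - Lx b) t.
Proof.
move=> /homogP H; apply/homogP => m; rewrite -(mcoeff_XM b) => /H <-.
by rewrite mon_degD mon_deg1 addrC addKr.
Qed.

Lemma homog_neg b s : S_homog (- Lx b) s -> s = 0.
Proof.
move=> hs; apply/mpoly.mpolyP => m; rewrite mpoly.mcoeff0; apply/eqP/negP => /negP.
rewrite -mpoly.mcoeff_msupp => /hs e.
have /mon_deg_eq0/(congr1 (fun m : mpoly.multinom 2 => m (iv b))) :
  mon_deg p q (mpoly.mnm_add (mpoly.mnm1 (iv b)) m) = 0.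
  by rewrite mon_degD mon_deg1 e subrr.
by rewrite mpoly.mnmDE mpoly.mnm1E eqxx mpoly.mnm0E.
Qed.

Lemma msupp_neq0 s : s != 0 -> exists m, m \in mpoly.msupp s.
Proof.
move=> s0; case e : (mpoly.msupp s) => [|m r]; last by exists m; rewrite mem_head.
by move: s0; rewrite (mpoly.msuppnil0 e) eqxx.
Qed.

Lemma homog_opp l s t :
  s != 0 -> t != 0 -> S_homog l s -> S_homog (- l) t -> l = 0.
Proof.
move=> s0 t0 hs ht.
have [m ms] := msupp_neq0 s0; have [m' mt] := msupp_neq0 t0.
have : mon_deg p q (mpoly.mnm_add m m') = 0 by rewrite mon_degD (hs _ ms) (ht _ mt) subrr.
move=> /mon_deg_eq0 e; rewrite -(hs _ ms).
suff -> : m = @mpoly.mnm0 2 by exact: mon_deg0.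
apply: mnm_ext => b.
have := congr1 (fun m : mpoly.multinom 2 => m (iv b)) e.
by rewrite mpoly.mnmDE mpoly.mnm0E => /eqP; rewrite addn_eq0 => /andP[/eqP].
Qed.

(** Monomials free of [X b] are powers of the other variable, and these have distinct degrees, so at
    most one of them survives modulo [X b]. When [c] is zero the exponent carries no information,
    whence the guard on the last clause. *)
Lemma homog_mod b l s : S_homog l s ->
  exists (c : k) n t, [/\ s = Sconst c * X k (~~ b) ^+ n + X k b * t,
    S_homog (l - Lx b) t & c != 0 -> Lx (~~ b) *+ n = l].
Proof.
move=> hs; have [t [r [es er]]] := S_divX b s.
have [m [c [er' hm]]] : exists m c, r = Sconst c * mpoly.mpolyX k m /\
    (m (iv b) = 0%N /\ (c != 0 -> mon_deg p q m = l)).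
  have [r0|r0] := eqVneq r 0.
    exists (@mpoly.mnm0 2), 0; rewrite r0 Sconst0 mul0r mpoly.mnm0E.
    by split=> //; split=> // /eqP.
  have [m mr] := msupp_neq0 r0.
  have key m' : m' \in mpoly.msupp r -> m' (iv b) = 0%N /\ mon_deg p q m' = l.
    rewrite mpoly.mcoeff_msupp er; case: (m' (iv b) =P 0%N) => [m'0|_]; last by rewrite eqxx.
    by rewrite -mpoly.mcoeff_msupp => /hs.
  have [m0 ml] := key _ mr.
  exists m, (mpoly.mcoeff m r); split=> //; rewrite SconstM.
  rewrite [LHS]mpoly.mpolyE (bigD1_seq m) ?mpoly.msupp_uniq //= big_seq_cond big1 ?addr0 //.
  move=> m' /andP[m'r ne]; case/eqP: ne; have [m'0 m'l] := key _ m'r.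
  have ee : Lx (~~ b) *+ m' (iv (~~ b)) = Lx (~~ b) *+ m (iv (~~ b)).
    have em m1 : m1 (iv b) = 0%N -> Lx (~~ b) *+ m1 (iv (~~ b)) = mon_deg p q m1.
      by rewrite /mon_deg; case: (b) => /= ->; rewrite mulr0n ?addr0 ?add0r.
    by rewrite !em // ml.
  apply: mnm_ext => b'; have [->|nb] := eqVneq b' b; first by rewrite m0.
  have -> : b' = ~~ b by case: (b) (b') nb => [] [].
  exact: LxMn_inj ee.
exists c, (m (iv (~~ b))), t; case: hm => m0 mc.
have eX : mpoly.mpolyX k m = X k (~~ b) ^+ m (iv (~~ b)).
  by rewrite monomialE; case: (b) m0 => /= ->; rewrite expr0 ?mul1r ?mulr1.
split; first by rewrite es er' eX addrC.
  apply: homog_divX.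
  have -> : X k b * t = s - r by rewrite es addrK.
  apply: homogB => //; apply/homogP => m'; rewrite er.
  by case: (m' (iv b) =P 0%N) => _; [rewrite -mpoly.mcoeff_msupp => /hs|rewrite eqxx].
move=> /mc <-; rewrite /mon_deg; case: (b) m0 => /= ->; rewrite mulr0n ?addr0 ?add0r //.
Qed.

Definition pdeg (lam : option k) : L :=
  match lam with
  | None => Lx true
  | Some a => if a == 0 then Lx false else Lx false *+ q
  end.

Lemma Lx_rel : Lx true *+ p = Lx false *+ q.
Proof.
have /Lx_eqP : exists n : int, p%:Z - 0 = p%:Z * n /\ 0 - q%:Z = - q%:Z * n.
  by exists 1; rewrite !mulr1 subr0 sub0r.
by rewrite !mulr0z addr0 add0r -!pmulrn.
Qed.

Local Notation pt := (@point_prime k p q).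

Lemma homog_pt lam : S_homog (pdeg lam) (pt lam).
Proof.
case: lam => [a|] /=; last exact: (homogX (b := true)).
case: ifP => _; first exact: (homogX (b := false)).
apply: homogB; first exact: homogXn (homogX (b := false)).
by apply: homogCM; rewrite -Lx_rel; exact: homogXn (homogX (b := true)).
Qed.

Local Notation coef0 := (@coef0 k).

Lemma coef0_pt lam : coef0 (pt lam) = 0.
Proof.
case: lam => [a|] /=; last exact: (coef0X k true).
case: ifP => _; first exact: (coef0X k false).
have -> s t : coef0 (s - t) = coef0 s - coef0 t by exact: mpoly.mcoeffB.
by rewrite coef0M (coef0Xn k false) // (coef0Xn k true) // mulr0 subrr.
Qed.

Lemma pt_nonunit lam t : t * pt lam != 1.
Proof.
apply/eqP => /(congr1 coef0); rewrite coef0M coef0_pt mulr0 coef01 => /eqP.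
by rewrite eq_sym oner_eq0.
Qed.

Lemma Sconst_unit (c : k) : c != 0 -> Sconst c^-1 * Sconst c = 1.
Proof. by move=> c0; rewrite -SconstMM mulVf // Sconst1. Qed.

Lemma X_nonunit b t : t * X k b != 1.
Proof.
apply/eqP => /(congr1 coef0); rewrite coef0M coef0X mulr0 coef01 => /eqP.
by rewrite eq_sym oner_eq0.
Qed.

Lemma pt_neq0 lam : pt lam != 0.
Proof.
case: lam => [a|] /=; last exact: (X_neq0 k true).
case: ifP => a0; first exact: (X_neq0 k false).
apply/eqP => /eqP; rewrite subr_eq0 => /eqP e.
have [|t /eqP] := S_regular (k := k) (b := false) (K := q) (K' := p) (s := 1) (t := Sconst a^-1).
  rewrite mulr1 [LHS](_ : _ = Sconst a^-1 * (Sconst a * X k true ^+ p)).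
    by rewrite -[X k false ^+ q]/(Sx2 k ^+ q) e mulrC.
  by rewrite mulrA Sconst_unit ?a0 // mul1r.
by case: (q) hq => // n _; rewrite exprS -mulrA mulrC eq_sym (negPf (X_nonunit _ _)).
Qed.

Lemma comax_pt lam mu : lam != mu -> comax (pt lam) (pt mu).
Proof.
have x1_2 : comax (X k true) (X k false).
  by exists 1%N => -[]; [exists 1, 0|exists 0, 1]; rewrite mul0r mul1r ?addr0 ?add0r.
have x1_f a : comax (X k true) (X k false ^+ q - Sconst a * X k true ^+ p).
  (* The exponent is dictated by [x_2^q], which is the form plus a multiple of [x_1]. *)
  exists q => -[].
    exists (X k true ^+ q.-1), 0; rewrite mul0r addr0 -exprSr prednK //.
  exists (Sconst a * X k true ^+ p.-1), 1.
  by rewrite mul1r -mulrA -exprSr prednK // addrC subrK.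
have x2_f a : a != 0 -> comax (X k false) (X k false ^+ q - Sconst a * X k true ^+ p).
  move=> a0; exists p => -[]; last first.
    exists (X k false ^+ p.-1), 0; rewrite mul0r addr0 -exprSr prednK //.
  exists (Sconst a^-1 * X k false ^+ q.-1), (- Sconst a^-1).
  rewrite -mulrA -exprSr prednK // mulNr mulrBr opprB addrC subrK.
  by rewrite mulrA Sconst_unit // mul1r.
have f_f a c : a != c -> comax (X k false ^+ q - Sconst a * X k true ^+ p)
    (X k false ^+ q - Sconst c * X k true ^+ p).
  move=> ac; have ac0 : c - a != 0 by rewrite subr_eq0 eq_sym.
  (* The difference of the two forms is [(c - a) x_1^p], so first [x_1^p] and then [x_2^q] belong to
     the ideal; the exponent [p + q] covers both. *)
  have eA : X k true ^+ p = Sconst (c - a)^-1 * (X k false ^+ q - Sconst a * X k true ^+ p)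
     + (- Sconst (c - a)^-1) * (X k false ^+ q - Sconst c * X k true ^+ p).
    transitivity (Sconst (c - a)^-1 * Sconst (c - a) * X k true ^+ p).
      by rewrite Sconst_unit // mul1r.
    by rewrite [Sconst (c - a)]SconstD SconstN; ring.
  exists (p + q)%N => -[].
    exists (X k true ^+ q * Sconst (c - a)^-1), (X k true ^+ q * - Sconst (c - a)^-1).
    by rewrite addnC exprD {1}eA; ring.
  have eB : X k false ^+ q = (X k false ^+ q - Sconst a * X k true ^+ p)
      + Sconst a * (Sconst (c - a)^-1 * (X k false ^+ q - Sconst a * X k true ^+ p)
     + (- Sconst (c - a)^-1) * (X k false ^+ q - Sconst c * X k true ^+ p)).
    by rewrite -eA subrK.
  exists (X k false ^+ p + X k false ^+ p * Sconst a * Sconst (c - a)^-1),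
     (- X k false ^+ p * Sconst a * Sconst (c - a)^-1).
  by rewrite exprD {1}eB; ring.
case: lam mu => [a|] [c|] //= ne.
- have ac : a != c by apply: contraNneq ne => ->.
  case: eqP => [a0|/eqP a0]; case: eqP => [c0|/eqP c0].
  + by rewrite a0 c0 eqxx in ac.
  + exact: x2_f.
  + exact/comaxC/x2_f.
  + exact: f_f.
- by case: ifP => _; apply: comaxC; [exact: x1_2|exact: x1_f].
- by case: ifP => _; [exact: x1_2|exact: x1_f].
Qed.

Definition factored s := exists c (ls : seq (option k)),
  c != 0 /\ s = Sconst c * \prod_(lam <- ls) pt lam.

Lemma factoredM s t : factored s -> factored t -> factored (s * t).
Proof.
move=> [c [ls [c0 ->]]] [d [ms [d0 ->]]]; exists (c * d), (ls ++ ms).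
by rewrite mulf_neq0 // big_cat SconstMM /= mulrACA.
Qed.

Lemma factoredC (c : k) : c != 0 -> factored (Sconst c).
Proof. by move=> c0; exists c, [::]; rewrite big_nil mulr1. Qed.

Lemma factored1 : factored 1.
Proof. by rewrite -Sconst1; apply: factoredC; exact: oner_neq0. Qed.

Lemma factoredX s n : factored s -> factored (s ^+ n).
Proof.
by move=> hs; elim: n => [|n IH]; [exact: factored1|rewrite exprS; exact: factoredM].
Qed.

Lemma factored_pt lam : factored (pt lam).
Proof. by exists 1, [:: lam]; rewrite oner_neq0 big_seq1 Sconst1 mul1r. Qed.

Lemma factored_form (a : k) : factored (X k false ^+ q - Sconst a * X k true ^+ p).
Proof.
have [->|a0] := eqVneq a 0.
  rewrite Sconst0 mul0r subr0; apply: factoredX.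
  by have := factored_pt (Some 0); rewrite /= eqxx.
by have := factored_pt (Some a); rewrite /= (negPf a0).
Qed.

(** The form [x_1^(p n) P(x_2^q / x_1^p)]. The integer [n] may exceed the degree of [P]; the excess
    appears as a power of [x_1^p]. *)
Definition homogenize n (P : {poly k}) : S :=
  \sum_(i < n.+1) Sconst P`_i * (X k true ^+ p) ^+ (n - i) * (X k false ^+ q) ^+ i.

Lemma homogenizeD n P Q : homogenize n (P + Q) = homogenize n P + homogenize n Q.
Proof.
rewrite -big_split; apply: eq_bigr => i _.
by rewrite coefD SconstD !mulrDl.
Qed.

Lemma homogenizeZ n c P : homogenize n (c *: P) = Sconst c * homogenize n P.
Proof.
rewrite mulr_sumr; apply: eq_bigr => i _.
by rewrite coefZ SconstMM !mulrA.
Qed.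

Lemma homogenize0 n : homogenize n 0 = 0.
Proof. by rewrite -(scale0r 0) homogenizeZ Sconst0 mul0r. Qed.

Lemma homogenizeMX n P : homogenize n.+1 ('X * P) = X k false ^+ q * homogenize n P.
Proof.
rewrite /homogenize big_ord_recl coefXM eqxx Sconst0 !mul0r add0r mulr_sumr.
apply: eq_bigr => i _; rewrite coefXM /= /bump /= add1n subSS /= exprS; ring.
Qed.

Lemma homogenizeS n (P : {poly k}) : (size P <= n.+1)%N ->
  homogenize n.+1 P = X k true ^+ p * homogenize n P.
Proof.
move=> sP; rewrite /homogenize big_ord_recr /= nth_default // Sconst0 !mul0r addr0 mulr_sumr.
apply: eq_bigr => i _; rewrite subSn ?exprS; first ring.
by rewrite -ltnS ltn_ord.
Qed.

Lemma homogenizeXn n i : (i <= n)%N ->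
  homogenize n 'X^i = (X k true ^+ p) ^+ (n - i) * (X k false ^+ q) ^+ i.
Proof.
move=> le; have lt : (i < n.+1)%N by [].
rewrite /homogenize (bigD1 (Ordinal lt)) //= coefXn eqxx Sconst1 mul1r.
rewrite big1 ?addr0 // => j ne; rewrite coefXn.
by case: eqP => [e|_]; [case/eqP: ne; exact: val_inj|rewrite Sconst0 !mul0r].
Qed.

Lemma homogenize_prod n (rs : seq k) : (size rs <= n)%N ->
  homogenize n (\prod_(z <- rs) ('X - z%:P)) =
  (X k true ^+ p) ^+ (n - size rs) *
    \prod_(z <- rs) (X k false ^+ q - Sconst z * X k true ^+ p).
Proof.
have h1 (i : nat) : homogenize i 1 = (X k true ^+ p) ^+ i.
  by rewrite -(expr0 'X : 'X^0 = 1 :> {poly k}) homogenizeXn // subn0 mulr1.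
elim: rs n => [|z rs IH] n; first by rewrite !big_nil h1 subn0 mulr1.
case: n => // n; rewrite ltnS => le; rewrite !big_cons mulrBl mul_polyC -scaleNr homogenizeD homogenizeMX.
rewrite homogenizeZ homogenizeS ?size_prod_XsubC // IH // subSS SconstN; ring.
Qed.

(** Monomials of equal degree differ by a multiple of the relation, so their exponents agree modulo
    [p] and modulo [q]. A form is therefore a monomial times the homogenization of a polynomial in
    one variable, which splits over [k]. *)
Lemma homog_factored l s : S_homog l s -> s != 0 -> factored s.
Proof.
move=> hs s0; have [m0 hm0] := msupp_neq0 s0.
(* The common degree of all monomials of [s] in [x_1^p] and [x_2^q], once the residual exponents are
   removed. *)
pose n := (m0 ord0 %/ p + m0 ord_max %/ q)%N.
have key m : m \in mpoly.msupp s ->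
   [/\ m ord0 %% p = m0 ord0 %% p, m ord_max %% q = m0 ord_max %% q &
      m ord0 %/ p = n - m ord_max %/ q /\ m ord_max %/ q <= n]%N.
  move=> ms; have : mon_deg p q m = mon_deg p q m0 by rewrite (hs _ ms) (hs _ hm0).
  rewrite !mon_degE => /Lx_eqP [c [e1 e2]].
  have hz (a : nat) (d : nat) : a%:Z = (a %/ d)%N%:Z * d%:Z + (a %% d)%N%:Z.
    by rewrite {1}(divn_eq a d) PoszD PoszM.
  have uniq (a a' d : nat) (z : int) : (0 < d)%N -> a%:Z - a'%:Z = d%:Z * z ->
      (a %% d = a' %% d)%N /\ (a %/ d)%N%:Z = (a' %/ d)%N%:Z + z.
    move=> d0 e.
    have := hz a d; have := hz a' d; have := ltn_pmod a d0; have := ltn_pmod a' d0.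
    move: (a %/ d)%N (a %% d)%N (a' %/ d)%N (a' %% d)%N => u v u' v' h1 h2 h3 h4.
    have : (u%:Z - u'%:Z - z) = 0 by nia.
    by split; nia.
  have [r1 d1] := uniq _ _ _ _ hp e1.
  have e2' : (m ord_max)%:Z - (m0 ord_max)%:Z = q%:Z * - c by rewrite e2 mulrN mulNr.
  have [r2 d2] := uniq _ _ _ (- c) hq e2'.
  split=> //; rewrite /n; move: d1 d2.
  move: (_ %/ _)%N (_ %/ _)%N (_ %/ _)%N (_ %/ _)%N => u1 u2 u3 u4 d1 d2.
  by split; lia.
pose P : {poly k} := \sum_(m <- mpoly.msupp s) mpoly.mcoeff m s *: 'X^(m ord_max %/ q)%N.
have es : s = X k true ^+ (m0 ord0 %% p) * X k false ^+ (m0 ord_max %% q) * homogenize n P.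
  rewrite {1}(mpoly.mpolyE s) /P.
  rewrite (big_morph (homogenize n) (homogenizeD n) (homogenize0 n)) mulr_sumr !big_seq.
  apply: eq_bigr => m ms; have [r1 r2 [d1 d2]] := key _ ms.
  rewrite homogenizeZ homogenizeXn // -d1 -SconstM monomialE /=.
  rewrite {1}(divn_eq (m ord0) p) {1}(divn_eq (m ord_max) q) r1 r2.
  rewrite !exprD ![(_ %/ _ * _)%N]mulnC !exprM; ring.
have P0 : P != 0.
  by apply: contra_neq s0 => P0; rewrite es P0 homogenize0 mulr0.
have sP : (size P <= n.+1)%N.
  apply: (leq_trans (size_sum _ _ _)); apply/bigmax_leqP_seq => m ms _.
  rewrite (leq_trans (size_scale_leq _ _)) // size_polyXn ltnS.
  by have [_ _ []] := key _ ms.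
have [rs ePrs] := closed_field_poly_normal P.
have lc0 : lead_coef P != 0 by rewrite lead_coef_eq0.
have srs : (size rs <= n)%N.
  by move: sP; rewrite ePrs size_scale // size_prod_XsubC.
rewrite es ePrs homogenizeZ homogenize_prod //.
have fX b : factored (X k b).
  by case: b; [exact: (factored_pt None)|have := factored_pt (Some 0); rewrite /= eqxx].
apply: factoredM; first by apply: factoredM; apply: factoredX.
apply: factoredM; first exact: factoredC.
apply: factoredM; first by apply/factoredX/factoredX.
apply: (big_ind factored) => [||z _]; [exact: factored1|exact: factoredM|exact: factored_form].
Qed.

(** Either [lam] occurs in the factorization of [h], or it differs from every point occurring there
    and comaximality is multiplicative. *)
Lemma pt_coprime lam l h : S_homog l h -> h != 0 ->
  (exists t, h = t * pt lam) \/ comax (pt lam) h.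
Proof.
move=> hh h0; have [c [ls [c0 ->]]] := homog_factored hh h0.
have [lin|lnin] := boolP (lam \in ls).
  left; exists (Sconst c * \prod_(mu <- rem lam ls) pt mu).
  by rewrite (perm_big _ (perm_to_rem lin)) big_cons /=; ring.
right; apply: comaxM.
  exists 0%N => b; exists 0, (Sconst c^-1).
  by rewrite mul0r add0r Sconst_unit.
elim: ls lnin => [|mu ls IH]; first by rewrite big_nil => _; exact: comax1.
rewrite inE negb_or big_cons => /andP[ne /IH]; apply: comaxM.
exact: comax_pt.
Qed.

(* The second local cohomology of [S / f] vanishes, in Cech form. *)
Lemma local_cohomology2 l f K : S_homog l f -> f != 0 ->
  exists j c1 c2 c3, (X k true * X k false) ^+ j =
    X k true ^+ (K + j) * c1 + X k false ^+ (K + j) * c2 + f * c3.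
Proof.
move=> hf f0.
pose van f := forall K, exists j c1 c2 c3, (X k true * X k false) ^+ j =
    X k true ^+ (K + j) * c1 + X k false ^+ (K + j) * c2 + f * c3.
have vanM g h : van g -> van h -> van (g * h).
  move=> Hg Hh K0; have [j [a [b [c e]]]] := Hg K0; have [j' [a' [b' [c' e']]]] := Hh (K0 + j)%N.
  exists (j + j')%N, (X k false ^+ j' * a + g * c * a'), (X k true ^+ j' * b + g * c * b'), (c * c').
  rewrite exprD {1}e mulrDl {2}e' exprMn !addnA ![X k _ ^+ (_ + j')]exprD; ring.
have vanC a : a != 0 -> van (Sconst a).
  move=> a0 K0; exists 0%N, 0, 0, (Sconst a^-1).
  by rewrite !mulr0 !add0r [Sconst a * _]mulrC Sconst_unit.
have vanX b : van (X k b).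
  move=> K0; exists 1%N, 0, 0, (X k (~~ b)).
  by rewrite !mulr0 !add0r expr1; case: b => //=; rewrite mulrC.
have van_pt lam : van (pt lam).
  case: lam => [a|]; last exact: (vanX true).
  rewrite /=; case: ifP => _; first exact: (vanX false).
  (* Modulo the form, [x_2^(q K0)] is a scalar times [x_1^(p K0)], which is a multiple of [x_1^K0];
     hence this exponent. *)
  move=> K0; exists (q * K0)%N.
  set f1 := Sx2 k ^+ q - _.
  have [d ed] : exists d, (X k false ^+ q) ^+ K0 = (Sconst a * X k true ^+ p) ^+ K0 + f1 * d.
    eexists; apply/eqP; rewrite -subr_eq0 opprD addrA subr_eq0; apply/eqP.
    exact: subrXX.
  exists (Sconst a ^+ K0 * X k true ^+ (p * K0 - K0)), 0, (d * X k true ^+ (q * K0)).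
  have le : (K0 <= p * K0)%N by rewrite leq_pmull.
  rewrite exprMn [X k false ^+ (q * K0)]exprM ed exprMn -exprM mulr0 addr0.
  by rewrite -{1}(subnK le) !exprD; ring.
have [c [ls [c0 ->]]] := homog_factored hf f0.
apply: (vanM); first exact: (vanC).
have van1 : van 1 by rewrite -Sconst1; apply: (vanC); exact: oner_neq0.
by apply: (big_ind van van1 vanM) => lam _; exact: van_pt.
Qed.

End Degrees.

Arguments homogC {k} p q a.
Arguments homogX {k} p q b.
Arguments homog_pt {k p q} lam.

(** * Homogeneous components and graded submodules *)

Section FiniteSupportSums.
Variables (L : zmodType) (V : zmodType).

Lemma sum_extend (ls ls' : seq L) (f : L -> V) :
  uniq ls -> uniq ls' -> {subset ls <= ls'} ->
  \sum_(l <- ls') (if l \in ls then f l else 0) = \sum_(l <- ls) f l.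
Proof.
move=> u u' sub; rewrite -big_mkcond -big_filter; apply: perm_big.
apply: uniq_perm => //; first exact: filter_uniq.
move=> l; rewrite mem_filter; case: (boolP (l \in ls)) => //= /sub ->//.
Qed.

Definition hdec (D : L -> V -> Prop) (u : V) := exists (ls : seq L) (f : L -> V),
  [/\ uniq ls, forall l, D l (f l) & u = \sum_(l <- ls) f l].

Variable D : L -> V -> Prop.
Hypotheses (D0 : forall l, D l 0) (DD : forall l u v, D l u -> D l v -> D l (u + v)).

Lemma hdec0 : hdec D 0.
Proof. by exists [::], (fun=> 0); rewrite big_nil. Qed.

Lemma hdec_homog l u : D l u -> hdec D u.
Proof.
move=> Du; exists [:: l], (fun l' => if l' == l then u else 0).
by split=> // [l'|]; [case: eqP => [->|]|rewrite big_seq1 eqxx].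
Qed.

Lemma hdecD u v : hdec D u -> hdec D v -> hdec D (u + v).
Proof.
move=> [ls [f [uls hf ->]]] [ms [g [ums hg ->]]].
exists (undup (ls ++ ms)), (fun l => (if l \in ls then f l else 0) + (if l \in ms then g l else 0)).
split=> [|l|]; first exact: undup_uniq.
  by apply: DD; case: ifP.
rewrite big_split /= !sum_extend ?undup_uniq // => l; rewrite mem_undup mem_cat => ->//.
by rewrite orbT.
Qed.

End FiniteSupportSums.

Section Components.
Variables (k : closedFieldType) (p q : nat) (M : gmod k p q).
Local Notation S := (Sring k).
Local Notation L := (Lgrp p q).
Implicit Types (s t : S) (b : bool) (l : L) (u v : M).

Lemma degD l u v : deg M l u -> deg M l v -> deg M l (u + v).
Proof.
move=> hu hv; rewrite -[v]opprK; apply: degB => //.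
by rewrite -sub0r; apply: degB => //; exact: deg0.
Qed.

(** A decomposition is chosen separately for each element; [comp_unique] shows that the resulting
    components do not depend on the choice. *)
Definition supp u : seq L := sval (cid (deg_sum u)).
Definition fdec u : L -> M := sval (cid (svalP (cid (deg_sum u)))).
Definition comp l u : M := if l \in supp u then fdec u l else 0.

Lemma fdecP u : [/\ uniq (supp u), forall l, deg M l (fdec u l) &
  u = \sum_(l <- supp u) fdec u l].
Proof. exact: svalP (cid (svalP (cid (deg_sum u)))). Qed.

Lemma supp_uniq u : uniq (supp u).
Proof. by have [] := fdecP u. Qed.

Lemma deg_comp l u : deg M l (comp l u).
Proof.
by rewrite /comp; case: ifP => _; [have [] := fdecP u|exact: deg0].
Qed.

Lemma comp_sum u : u = \sum_(l <- supp u) comp l u.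
Proof.
have [_ _ {1}->] := fdecP u; rewrite !big_seq.
by apply: eq_bigr => l ls; rewrite /comp ls.
Qed.

Lemma comp_out l u : l \notin supp u -> comp l u = 0.
Proof. by rewrite /comp => /negPf->. Qed.

Lemma comp_sum_sub (ls : seq L) u : uniq ls -> {subset supp u <= ls} ->
  u = \sum_(l <- ls) comp l u.
Proof.
move=> uls sub; rewrite {1}[u]comp_sum -(sum_extend _ (supp_uniq u) uls sub).
by apply: eq_bigr => l _; case: ifP => // /negbT /comp_out.
Qed.

Lemma comp_unique (ls : seq L) (f : L -> M) u :
  uniq ls -> (forall l, deg M l (f l)) -> u = \sum_(l <- ls) f l ->
  forall l, comp l u = if l \in ls then f l else 0.
Proof.
move=> uls hf e l; pose ms := undup (ls ++ supp u).
have sub1 : {subset ls <= ms} by move=> x; rewrite mem_undup mem_cat => ->.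
have sub2 : {subset supp u <= ms} by move=> x; rewrite mem_undup mem_cat orbC => ->.
pose g l := (if l \in ls then f l else 0) - comp l u.
have hg l' : deg M l' (g l').
  by apply: degB; [case: ifP => // _; exact: deg0|exact: deg_comp].
have /(deg_direct (undup_uniq _) hg) H : \sum_(l <- ms) g l = 0.
  rewrite sumrB sum_extend ?undup_uniq // -(comp_sum_sub (undup_uniq _) sub2).
  by rewrite -e subrr.
have [/H|] := boolP (l \in ms); first by move/eqP; rewrite subr_eq0 eq_sym => /eqP.
rewrite mem_undup mem_cat negb_or => /andP[/negPf -> nl].
exact: comp_out.
Qed.

Lemma comp_homog l u l' : deg M l u -> comp l' u = if l' == l then u else 0.
Proof.
move=> hu; rewrite (@comp_unique [:: l] (fun x => if x == l then u else 0)) //.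
- by rewrite inE; case: eqP.
- by move=> x; case: eqP => [->//|_]; exact: deg0.
- by rewrite big_seq1 eqxx.
Qed.

Lemma comp_id l u : deg M l u -> comp l u = u.
Proof. by move=> /comp_homog ->; rewrite eqxx. Qed.

Lemma comp0 l : comp l 0 = 0.
Proof. by rewrite (comp_id (deg0 _ l)). Qed.

Lemma compD l u v : comp l (u + v) = comp l u + comp l v.
Proof.
pose ms := undup (supp u ++ supp v).
have sub1 : {subset supp u <= ms} by move=> x; rewrite mem_undup mem_cat => ->.
have sub2 : {subset supp v <= ms} by move=> x; rewrite mem_undup mem_cat orbC => ->.
rewrite (@comp_unique ms (fun l => comp l u + comp l v)) ?undup_uniq //.
- case: ifP => // /negbT nl.
  by rewrite !comp_out ?addr0 //; apply: contra nl; [exact: sub2|exact: sub1].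
- by move=> x; apply: degD; exact: deg_comp.
- by rewrite big_split -!comp_sum_sub ?undup_uniq.
Qed.

Lemma compB l u v : comp l (u - v) = comp l u - comp l v.
Proof. by apply: (addIr (comp l v)); rewrite -compD !subrK. Qed.

Lemma comp_bigsum (I : Type) (r : seq I) (P : pred I) (F : I -> M) l :
  comp l (\sum_(i <- r | P i) F i) = \sum_(i <- r | P i) comp l (F i).
Proof. exact: (big_morph (comp l) (compD l) (comp0 l)). Qed.

Lemma compZ a l s u : S_homog a s -> comp (a + l) (s *: u) = s *: comp l u.
Proof.
move=> hs; rewrite (@comp_unique [seq a + x | x <- supp u] (fun x => s *: comp (x - a) u)).
- rewrite addrAC subrr add0r; case: ifP => // /negP nl; rewrite comp_out ?scaler0 //.
  by apply/negP => ls; apply: nl; exact: map_f.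
- by rewrite map_inj_uniq ?supp_uniq //; exact: addrI.
- by move=> x; rewrite -[x in deg M x](subrKC a); apply: degZ => //; exact: deg_comp.
rewrite {1}[u]comp_sum scaler_sumr big_map; apply: eq_bigr => x _.
by rewrite addrAC subrr add0r.
Qed.

Lemma compZ' a l s u : S_homog a s -> comp l (s *: u) = s *: comp (l - a) u.
Proof. by move=> hs; rewrite -(compZ _ _ hs) subrKC. Qed.

Lemma compC l (c : k) u : comp l (Sconst c *: u) = Sconst c *: comp l u.
Proof. by rewrite (compZ' _ _ (homogC p q c)) subr0. Qed.

(** Graded submodules through closure under components; [graded_submodP] is the equivalence with the
    given definition. *)
Definition hsub (W : M -> Prop) :=
  is_submod W /\ forall l u, W u -> W (comp l u).

Lemma graded_submodP (W : M -> Prop) : graded_submod (deg M) W <-> hsub W.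
Proof.
split=> [[W0 WD Wc]|[hW Wc]].
  split=> [//|l u /Wc[ls [f [uls hf e]]]].
  rewrite (comp_unique uls _ e) => [|x]; last by case: (hf x).
  by case: ifP => // _; case: (hf l).
split=> [||u Wu]; [exact: submod0 hW|by case: hW|].
exists (supp u), (fun l => comp l u).
split; [exact: supp_uniq|move=> l; split; [exact: deg_comp|exact: Wc]|exact: comp_sum].
Qed.

Lemma hsub_ind (W P : M -> Prop) : hsub W -> is_submod P ->
  (forall l u, deg M l u -> W u -> P u) -> forall u, W u -> P u.
Proof.
move=> [hW Wc] hP H u Wu; rewrite [u]comp_sum.
by apply: submod_sum => // l _; apply: (H l); [exact: deg_comp|exact: Wc].
Qed.

End Components.

Section Relations.
Variables (k : closedFieldType) (p q : nat) (M N : gmod k p q).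
Local Notation S := (Sring k).

Definition hrel (G : M -> N -> Prop) := [/\ G 0 0,
  forall (s : S) m n m' n', G m n -> G m' n' -> G (s *: m + m') (s *: n + n') &
  forall l m n, G m n -> G (comp l m) (comp l n)].

(** Projecting a decomposition of a pair decomposes both entries, so the components of a pair are
    taken entrywise. *)
Lemma hrelP (G : M -> N -> Prop) :
  @graded_submod k p q (M * N)%type
    (fun l u => deg M l u.1 /\ deg N l u.2) (fun u => G u.1 u.2) <-> hrel G.
Proof.
split=> [[G0 GD Gc]|[G0 GD Gc]].
  split=> [//|s m n m' n' h h'|l m n h].
    exact: (GD s (m, n) (m', n')).
  have [ls [f [uls hf e]]] := Gc (m, n) h.
  have e1 : m = \sum_(l <- ls) (f l).1 by rewrite -[LHS]/((m, n).1) e raddf_sum.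
  have e2 : n = \sum_(l <- ls) (f l).2 by rewrite -[LHS]/((m, n).2) e raddf_sum.
  rewrite (comp_unique uls _ e1) => [|x]; last by case: (hf x) => [[]].
  rewrite (comp_unique uls _ e2) => [|x]; last by case: (hf x) => [[]].
  by case: ifP => // _; case: (hf l).
split=> [//|s [m n] [m' n'] /= h h'|[m n] /= h]; first exact: GD.
pose ms := undup (supp m ++ supp n).
have sub1 : {subset supp m <= ms} by move=> x; rewrite mem_undup mem_cat => ->.
have sub2 : {subset supp n <= ms} by move=> x; rewrite mem_undup mem_cat orbC => ->.
exists ms, (fun l => (comp l m, comp l n)).
split=> [|l|]; [exact: undup_uniq|by split; [split; exact: deg_comp|exact: Gc]|].
rewrite [LHS]surjective_pairing [RHS]surjective_pairing !raddf_sum /=.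
by congr pair; apply: comp_sum_sub; rewrite ?undup_uniq.
Qed.

End Relations.

(** * Finite dimension and saturation *)

Section Saturation.
Variables (k : closedFieldType) (V : lmodType (Sring k)).
Local Notation S := (Sring k).
Local Notation X := (X k).
Implicit Types (W : V -> Prop) (u v : V) (s t : S).

(* Elements that become members of [W] after multiplication by high powers of
   both variables, that is, members of [W] up to finite dimension. *)
Definition sat W u := exists K, forall b, W (X b ^+ K *: u).
Definition sat0 u := sat (fun v => v = 0) u.

Lemma sat_submod W : is_submod W -> is_submod (sat W).
Proof.
move=> hW; split=> [|s u v [K HK] [K' HK']].
  by exists 0%N => b; rewrite scaler0; exact: submod0 hW.
exists (K + K')%N => b.
rewrite scalerDr scalerA mulrC -scalerA exprD.
apply: (submodD hW).
  by apply: (submodZ _ hW); rewrite mulrC -scalerA; apply: (submodZ _ hW).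
by rewrite -scalerA; apply: (submodZ _ hW).
Qed.

Lemma sat_sub W u : W u -> sat W u.
Proof. by move=> Wu; exists 0%N => b; rewrite scale1r. Qed.

Lemma sat_mono W W' u : (forall v, W v -> W' v) -> sat W u -> sat W' u.
Proof. by move=> H [K HK]; exists K => b; apply: H. Qed.

Lemma sat_leq W u K K' : is_submod W -> (K <= K')%N ->
  (forall b, W (X b ^+ K *: u)) -> forall b, W (X b ^+ K' *: u).
Proof.
by move=> hW le H b; rewrite -(subnK le) exprD -scalerA; apply: (submodZ _ hW).
Qed.

Lemma satX W u K : is_submod W -> (forall b, sat W (X b ^+ K *: u)) -> sat W u.
Proof.
move=> hW H; have [K1 H1] := H true; have [K2 H2] := H false.
exists ((maxn K1 K2) + K)%N => b; rewrite exprD -scalerA.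
case: b.
  exact: (sat_leq hW (leq_maxl _ _) H1).
exact: (sat_leq hW (leq_maxr _ _) H2).
Qed.

Lemma sat_idem W u : is_submod W -> sat (sat W) u -> sat W u.
Proof. by move=> hW [K H]; exact: satX H. Qed.

Lemma sat_comax W f g u : is_submod W -> comax f g -> W (f *: u) -> W (g *: u) -> sat W u.
Proof.
move=> hW [K H] Wf Wg; exists K => b; have [s [t ->]] := H b.
by rewrite scalerDl -!scalerA; apply: (submodD hW); apply: (submodZ _ hW).
Qed.

Lemma submod_zero : is_submod (fun v : V => v = 0).
Proof. by split=> // a x y -> ->; rewrite scaler0 addr0. Qed.

Lemma sat0_submod : is_submod sat0. Proof. exact: (sat_submod submod_zero). Qed.

Lemma sat0_sat W u : is_submod W -> sat0 u -> sat W u.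
Proof. by move=> hW; apply: sat_mono => v ->; exact: submod0 hW. Qed.

Lemma submodI W W' : is_submod W -> is_submod W' -> is_submod (fun u => W u /\ W' u).
Proof.
move=> hW hW'; split=> [|a x y [? ?] [? ?]]; first by split; [exact: submod0 hW|exact: submod0 hW'].
by split; [case: hW => _; apply|case: hW' => _; apply].
Qed.

Lemma kcombB (vs : seq V) c d : kcomb vs (fun i => c i + d i) = kcomb vs c + kcomb vs d.
Proof. by rewrite /kcomb -big_split; apply: eq_bigr => i _; rewrite SconstD scalerDl. Qed.

Lemma kcombZ (vs : seq V) a c : kcomb vs (fun i => a * c i) = Sconst a *: kcomb vs c.
Proof. by rewrite /kcomb scaler_sumr; apply: eq_bigr => i _; rewrite SconstMM scalerA. Qed.

Lemma kcomb0 (vs : seq V) : kcomb vs (fun=> 0) = 0.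
Proof. by rewrite /kcomb big1 // => i _; rewrite Sconst0 scale0r. Qed.

Lemma kcomb_sum (vs : seq V) n (c : 'I_n -> nat -> k) :
  kcomb vs (fun j => \sum_(i < n) c i j) = \sum_(i < n) kcomb vs (c i).
Proof.
rewrite /kcomb exchange_big; apply: eq_bigr => j _.
by rewrite -scaler_suml /Sconst raddf_sum.
Qed.

Lemma kcomb_mem (vs : seq V) v : v \in vs -> exists c, v = kcomb vs c.
Proof.
move=> ys; exists (fun i => (i == index v vs)%:R); rewrite /kcomb.
rewrite -index_mem in ys; rewrite (bigD1 (Ordinal ys)) //= eqxx Sconst1 scale1r.
rewrite big1 ?addr0 => [|i /negP ne]; first by rewrite nth_index // -index_mem.
by case: eqP => [e|_]; [case: ne; apply/eqP/val_inj|rewrite Sconst0 scale0r].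
Qed.

Lemma kcomb_cat (vs ws : seq V) c d : exists e, kcomb vs c + kcomb ws d = kcomb (vs ++ ws) e.
Proof.
exists (fun i => if (i < size vs)%N then c i else d (i - size vs)%N).
rewrite /kcomb size_cat big_split_ord /=; congr (_ + _); apply: eq_bigr => i _.
  by rewrite nth_cat ltn_ord.
by rewrite nth_cat ltnNge leq_addr /= addKn.
Qed.

Definition findim_mod (Z W : V -> Prop) :=
  exists vs : seq V, forall u, Z u -> exists c, W (u - kcomb vs c).

Lemma findimE W : findim W <-> findim_mod W (fun v => v = 0).
Proof.
split=> -[vs H]; exists vs => u /H [c e]; exists c; first by rewrite -e subrr.
by apply/eqP; rewrite -subr_eq0 e.
Qed.

Lemma cofindimE W : cofindim W <-> findim_mod (fun _ => True) W.
Proof. by split=> -[vs H]; exists vs => u; [move=> _|]; exact: H. Qed.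

(** If [x_1^K g] and [x_2^K g] lie in [W], the monomials with both exponents below [K] span the
    multiples of [g] modulo [W]. *)
Lemma fg_sat_findim (Z W : V -> Prop) : is_submod Z -> is_submod W ->
  fg_submod Z -> (forall u, Z u -> sat W u) -> findim_mod Z W.
Proof.
move=> hZ hW [gs hgs hspan] ZW.
suff [vs Hvs] : exists vs, forall u, span gs u -> exists c, W (u - kcomb vs c).
  by exists vs => u /hspan /Hvs.
have {hspan} hgs' g : g \in gs -> sat W g by move=> /hgs /ZW.
elim: gs hgs' {hgs} => [|g gs IH] hgs.
  exists [::] => u hu; exists (fun=> 0); rewrite kcomb0 subr0.
  exact: (span_min hW _ hu).
have [vs Hvs] := IH (fun x h => hgs x (mem_behead (s := g :: gs) h)).
have [K HK] := hgs g (mem_head _ _).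
pose ws := [seq (X true ^+ i * X false ^+ j) *: g | i <- iota 0 K, j <- iota 0 K].
have Hws (s : S) : exists c, W (s *: g - kcomb ws c).
  rewrite (mpoly.mpolyE s).
  apply: (big_ind (fun s : S => exists c, W (s *: g - kcomb ws c))).
  - by exists (fun=> 0); rewrite scale0r kcomb0 subr0; exact: submod0 hW.
  - move=> x y [c Wc] [d Wd]; exists (fun i => c i + d i).
    by rewrite kcombB scalerDl opprD addrACA; apply: (submodD hW).
  move=> m _; rewrite -SconstM monomialE.
  move: (m (iv true)) (m (iv false)) => i j.
  have [/andP[iK jK]|] := boolP ((i < K)%N && (j < K)%N).
    have [|c e] := @kcomb_mem ws ((X true ^+ i * X false ^+ j) *: g).
      by apply/allpairsP; exists (i, j); rewrite !mem_iota.
    exists (fun l => mpoly.mcoeff m s * c l).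
    by rewrite kcombZ -e -scalerA subrr; exact: submod0 hW.
  move=> h; exists (fun=> 0); rewrite kcomb0 subr0 -scalerA.
  apply: (submodZ _ hW); move: h; rewrite negb_and -!leqNgt => /orP[] le.
    by rewrite mulrC -scalerA; apply: (submodZ _ hW); exact: (sat_leq hW le HK).
  by rewrite -scalerA; apply: (submodZ _ hW); exact: (sat_leq hW le HK).
exists (vs ++ ws) => u /span_cons[a /Hvs[c Wc]].
have [d Wd] := Hws a; have [e he] := kcomb_cat vs ws c d.
exists e; rewrite -he; have -> : u - (kcomb vs c + kcomb ws d) =
   (u - a *: g - kcomb vs c) + (a *: g - kcomb ws d).
  by rewrite opprD addrA [in RHS]addrA [X in _ = X - _]addrAC subrK.
exact: (submodD hW).
Qed.

End Saturation.

Section FiniteDimension.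
Variables (k : closedFieldType) (p q : nat).
Hypotheses (hp : (0 < p)%N) (hq : (0 < q)%N).
Variable M : gmod k p q.
Local Notation S := (Sring k).
Local Notation X := (X k).
Implicit Types (W Z : M -> Prop) (u v : M).

Lemma gmod_fg W : is_submod W -> fg_submod W.
Proof.
move=> hW; have [gs hgs] := fin_gen M.
apply: (noetherian_fg (@S_noetherian k) (s := gs) hW) => u _.
have [c ->] := hgs u; apply: submod_sum_ord; first exact: span_submod.
by move=> i; apply: (submodZ _ (span_submod _)); apply: mem_span; rewrite mem_nth.
Qed.

Lemma hsub_submod W : hsub W -> is_submod W. Proof. by case. Qed.

Lemma hsubT : hsub (fun _ : M => True). Proof. by []. Qed.

Lemma hsub_zero : hsub (fun u : M => u = 0).
Proof. by split=> [|l u ->]; [exact: submod_zero|rewrite comp0]. Qed.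

Lemma hsub_sat W : hsub W -> hsub (sat W).
Proof.
move=> [hW Wc]; split=> [|l u [K HK]]; first exact: sat_submod.
exists K => b; rewrite -(compZ _ _ (homogXn (n := K) (homogX p q b))).
exact: Wc.
Qed.

Lemma hsub_sat0 : hsub (@sat0 k M).
Proof. exact: (hsub_sat hsub_zero). Qed.

(* The powers [X b ^+ i *: u] of a homogeneous element lie in distinct degrees,
   so a nontrivial linear relation among them modulo a graded submodule [W]
   puts one of them in [W]. *)
Lemma findim_sat Z W : hsub Z -> hsub W -> findim_mod Z W ->
  forall u, Z u -> sat W u.
Proof.
move=> [hZ Zc] [hW Wc] [vs Hvs].
have [hS _] := hsub_sat (conj hW Wc).
apply: (hsub_ind (conj hZ Zc) hS) => l u hu Zu.
exists (size vs) => b; set n := size vs.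
have hex (i : 'I_n.+1) : exists c, W (X b ^+ i *: u - kcomb vs c).
  by apply/Hvs/(submodZ _ hZ).
have [c hc] := choice hex.
pose C : 'M[k]_(n.+1, n) := \matrix_(i, j) c i j.
have /rowV0Pn[v /sub_kermxP vC v0] : kermx C != 0.
  rewrite kermx_eq0 /row_free; apply/eqP => rC.
  by have := rank_leq_col C; rewrite rC ltnn.
have {vC} vC j : (j < n)%N -> \sum_(i < n.+1) v ord0 i * c i j = 0.
  move=> jn; transitivity ((v *m C) ord0 (Ordinal jn)); last by rewrite vC mxE.
  by rewrite mxE; apply: eq_bigr => i _; rewrite mxE.
have [i vi] : exists i, v ord0 i != 0.
  have [j] := rV0Pn _ v0; by exists j.
have : W (\sum_(i < n.+1) Sconst (v ord0 i) *: (X b ^+ i *: u)).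
  rewrite (eq_bigr (fun i => Sconst (v ord0 i) *: (X b ^+ i *: u - kcomb vs (c i)) +
     kcomb vs (fun j => v ord0 i * c i j))) => [|j _]; last by rewrite kcombZ scalerBr subrK.
  rewrite big_split /= -kcomb_sum [X in _ + X](_ : _ = 0) ?addr0.
    by apply: (submod_sum_ord hW) => j; apply: (submodZ _ hW).
  by rewrite /kcomb big1 // => j _; rewrite vC // Sconst0 scale0r.
move=> /(Wc (Lx p q b *+ i + l)).
have hX j : S_homog (Lx p q b *+ j) (X b ^+ j) by exact: (homogXn (homogX p q b)).
rewrite comp_bigsum (bigD1 i) //= big1 => [|j ji]; last first.
  rewrite compC (comp_homog (l := Lx p q b *+ j + l)); last exact: degZ.
  case: eqP => [/addIr /(LxMn_inj hp hq) e|_]; rewrite ?scaler0 //.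
  by case/eqP: ji; exact: val_inj.
rewrite addr0 compC comp_id; last exact: degZ.
move=> /(submodZ (Sconst (v ord0 i)^-1) hW); rewrite 2!scalerA mulrA Sconst_unit // mul1r.
have -> : X b ^+ n = X b ^+ (n - i) * X b ^+ i by rewrite -exprD subnK // -ltnS.
by rewrite -scalerA; exact: submodZ.
Qed.

Lemma findim_satP W : hsub W -> findim W <-> forall u, W u -> sat0 u.
Proof.
move=> hW; rewrite findimE; split; first exact: findim_sat hsub_zero.
move=> H; apply: fg_sat_findim => //; [exact: hsub_submod hW|exact: submod_zero|].
exact/gmod_fg/(hsub_submod hW).
Qed.

Lemma cofindim_satP W : hsub W -> cofindim W <-> forall u, sat W u.
Proof.
move=> hW; rewrite cofindimE; split=> [H u|H].
  exact: (findim_sat hsubT hW H).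
by apply: fg_sat_findim => //; [exact: hsub_submod hW|apply: gmod_fg].
Qed.

End FiniteDimension.

(** * Morphisms and isomorphisms of the quotient category as correspondences *)

Section Morphisms.
Variables (k : closedFieldType) (p q : nat).
Hypotheses (hp : (0 < p)%N) (hq : (0 < q)%N).
Local Notation S := (Sring k).
Local Notation X := (X k).
Implicit Types (M N P : gmod k p q).

Section Rel.
Variables (M N : gmod k p q) (G : M -> N -> Prop).
Hypothesis hG : hrel G.

Lemma hrelZ s m n : G m n -> G (s *: m) (s *: n).
Proof. by case: hG => G0 GD _ h; have := GD s _ _ _ _ h G0; rewrite !addr0. Qed.

Lemma hrelD m n m' n' : G m n -> G m' n' -> G (m + m') (n + n').
Proof. by case: hG => G0 GD _ h h'; have := GD 1 _ _ _ _ h h'; rewrite !scale1r. Qed.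

Lemma hrelB m n m' n' : G m n -> G m' n' -> G (m - m') (n - n').
Proof. by move=> h /(hrelZ (-1)); rewrite !scaleN1r; exact: hrelD. Qed.

Definition rdom (m : M) := exists n, G m n.
Definition rrng (n : N) := exists m, G m n.
Definition rker (m : M) := G m 0.
Definition rfib (n : N) := G 0 n.

Lemma hsub_rdom : hsub rdom.
Proof.
case: (hG) => G0 GD Gc; split=> [|l m [n h]]; last by exists (comp l n); exact: Gc.
split=> [|s m m' [n h] [n' h']]; first by exists 0.
by exists (s *: n + n'); exact: GD.
Qed.

Lemma hsub_rrng : hsub rrng.
Proof.
case: (hG) => G0 GD Gc; split=> [|l n [m h]]; last by exists (comp l m); exact: Gc.
split=> [|s n n' [m h] [m' h']]; first by exists 0.
by exists (s *: m + m'); exact: GD.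
Qed.

Lemma hsub_rker : hsub rker.
Proof.
case: (hG) => G0 GD Gc; split=> [|l m /(Gc l)]; last by rewrite comp0.
by split=> // s m m' h h'; have := GD s _ _ _ _ h h'; rewrite scaler0 addr0.
Qed.

Lemma hsub_rfib : hsub rfib.
Proof.
case: (hG) => G0 GD Gc; split=> [|l m /(Gc l)]; last by rewrite comp0.
by split=> // s m m' h h'; have := GD s _ _ _ _ h h'; rewrite scaler0 addr0.
Qed.

End Rel.

Lemma is_morP M N (G : mor_rel M N) : is_mor G <->
  [/\ hrel G, forall m, sat (rdom G) m & forall n, G 0 n -> sat0 n].
Proof.
split=> [[/hrelP hG]|[hG]].
  by move=> /(cofindim_satP hp hq (hsub_rdom hG)) ? /(findim_satP hp hq (hsub_rfib hG)) ?.
move=> H1 H2; split; first exact/hrelP.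
  exact/(cofindim_satP hp hq (hsub_rdom hG)).
exact/(findim_satP hp hq (hsub_rfib hG)).
Qed.

(** The pair [M''], [N''] has a universal choice: the common domain, and the largest negligible
    submodule [sat0]. *)
Lemma mor_eqP M N (G H : mor_rel M N) : is_mor G -> is_mor H ->
  mor_eq G H <-> forall m n n', G m n -> H m n' -> sat0 (n - n').
Proof.
move=> /is_morP[hG Gd Gf] /is_morP[hH Hd Hf]; split.
  move=> [M'' [N'' [[/graded_submodP hM cM] [/graded_submodP hN fN] _ E]]] m n n' Gmn Hmn.
  have [K HK] := (cofindim_satP hp hq hM).1 cM m.
  apply: (satX (submod_zero _) (K := K)) => b.
  apply: ((findim_satP hp hq hN).1 fN); rewrite scalerBr.
  by apply: E (HK b) _ _; exact: hrelZ.
move=> E; exists (fun m => rdom G m /\ rdom H m), (@sat0 k N).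
have hM : hsub (fun m => rdom G m /\ rdom H m).
  have [h1 c1] := hsub_rdom hG; have [h2 c2] := hsub_rdom hH.
  by split=> [|l u [? ?]]; [exact: submodI|split; [exact: c1|exact: c2]].
split.
- split; first exact/graded_submodP.
  apply/(cofindim_satP hp hq hM) => m.
  have [K1 H1] := Gd m; have [K2 H2] := Hd m.
  exists (maxn K1 K2) => b; split.
    exact: (sat_leq (hsub_submod (hsub_rdom hG)) (leq_maxl _ _) H1).
  exact: (sat_leq (hsub_submod (hsub_rdom hH)) (leq_maxr _ _) H2).
- split; first exact/graded_submodP/hsub_sat0.
  exact/(findim_satP hp hq (hsub_sat0 N)).
- by [].
- by move=> m n n' _; exact: E.
Qed.

(* A correspondence inducing an isomorphism: up to finite dimension, [G] is
   everywhere defined, surjective, injective and single-valued. *)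
Definition qiso M N (G : M -> N -> Prop) :=
  [/\ hrel G, forall m, sat (rdom G) m, forall n, sat (rrng G) n,
      forall m, G m 0 -> sat0 m & forall n, G 0 n -> sat0 n].

Lemma hrel_flip M N (G : M -> N -> Prop) : hrel G -> hrel (fun n m => G m n).
Proof. by move=> [G0 GD Gc]; split=> [//|s n m n' m'|l n m]; [exact: GD|exact: Gc]. Qed.

Lemma hrel_comp M N P (G : M -> N -> Prop) (H : N -> P -> Prop) :
  hrel G -> hrel H -> hrel (mor_comp G H).
Proof.
move=> [G0 GD Gc] [H0 HD Hc]; split=> [|s m n m' n' [u h1 h2] [u' h1' h2']|l m n [u h1 h2]].
- by exists 0.
- by exists (s *: u + u'); [exact: GD|exact: HD].
- by exists (comp l u); [exact: Gc|exact: Hc].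
Qed.

Lemma is_mor_id M : is_mor (@mor_id k p q M).
Proof.
apply/is_morP; split=> [|m|n <-]; last exact: sat_sub.
  by split=> [//|s m n m' n' -> ->|l m n ->].
by apply: sat_sub; exists m.
Qed.

Lemma zero_mor M N : is_mor (fun (m : M) (n : N) => n = 0).
Proof.
apply/is_morP; split=> [|m|n ->]; last exact: sat_sub.
  split=> [//|s m n m' n' -> ->|l m n ->]; rewrite ?comp0 //.
  by rewrite scaler0 addr0.
by apply: sat_sub; exists 0.
Qed.

Lemma is_mor_comp M N P (G : mor_rel M N) (H : mor_rel N P) :
  is_mor G -> is_mor H -> is_mor (mor_comp G H).
Proof.
move=> /is_morP[hG Gd Gf] /is_morP[hH Hd Hf]; have hGH := hrel_comp hG hH.
apply/is_morP; split=> // [m|u [n /Gf [K HK] Hnu]].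
  have hd := hsub_submod (hsub_rdom hGH).
  apply: (sat_idem hd); apply: (sat_mono _ (Gd m)) => v [n Gvn].
  have [K HK] := Hd n; exists K => b; have [u Hu] := HK b.
  by exists u, (X b ^+ K *: n) => //; exact: hrelZ.
apply: (satX (submod_zero _) (K := K)) => b; apply: Hf.
by rewrite -(HK b); exact: hrelZ.
Qed.

Lemma qiso_mor M N (G : M -> N -> Prop) : qiso G -> is_mor G.
Proof. by move=> [? ? _ _ ?]; apply/is_morP. Qed.

Lemma qiso_flip M N (G : M -> N -> Prop) : qiso G -> qiso (fun n m => G m n).
Proof. by move=> [h1 h2 h3 h4 h5]; split=> //; exact: hrel_flip. Qed.

(** The converse relation serves as inverse. In the other direction, [H] followed by [G] yields
    surjectivity up to powers, and [G] followed by [H] yields injectivity. *)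
Lemma is_isoP M N (G : mor_rel M N) : is_iso G <-> qiso G.
Proof.
split=> [[mG [H [mH]]]|qG]; last first.
  have mG := qiso_mor qG; have mF := qiso_mor (qiso_flip qG).
  split=> //; exists (fun n m => G m n); case: (qG) => hG _ _ Gk Gf.
  split=> //; apply/mor_eqP.
  - exact: is_mor_comp.
  - exact: is_mor_id.
  - move=> m n n' [u h1 h2] <-; apply: Gk.
    by have := hrelB hG h2 h1; rewrite subrr.
  - exact: is_mor_comp.
  - exact: is_mor_id.
  - move=> m n n' [u h1 h2] <-; apply: Gf.
    by have := hrelB hG h2 h1; rewrite subrr.
move=> /(mor_eqP (is_mor_comp mG mH) (is_mor_id M)) E1.
move=> /(mor_eqP (is_mor_comp mH mG) (is_mor_id N)) E2.
have /is_morP[hG Gd Gf] := mG; have /is_morP[hH Hd Hf] := mH.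
split=> // [n|m Gm0].
  have hr := hsub_submod (hsub_rrng hG).
  apply: (sat_idem hr); have [K HK] := Hd n; apply: (satX (sat_submod hr) (K := K)) => b.
  have [m Hm] := HK b; have [K' HK'] := Gd m; exists K' => c.
  have [n' Gn'] := HK' c.
  have s0 : sat0 (n' - X c ^+ K' *: (X b ^+ K *: n)).
    apply: (E2 (X c ^+ K' *: (X b ^+ K *: n))) => //.
    by exists (X c ^+ K' *: m) => //; exact: hrelZ.
  rewrite -[X c ^+ K' *: _](subKr n'); apply: (submodB (sat_submod hr)).
    by apply: sat_sub; exists (X c ^+ K' *: m).
  exact: (sat0_sat hr).
have [H0 _ _] := hH; have : sat0 (0 - m) by apply: (E1 m) => //; exists 0.
by move=> /(submodN (sat0_submod _)); rewrite sub0r opprK.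
Qed.

Lemma coh_isoP M N : coh_iso M N <-> exists G : M -> N -> Prop, qiso G.
Proof. by split=> -[G h]; exists G; exact/is_isoP. Qed.

Lemma coh_iso_refl M : coh_iso M M.
Proof.
apply/coh_isoP; exists (@mor_id k p q M); have /is_morP[h1 h2 h3] := is_mor_id M.
split=> // [n|m ->]; last exact: sat_sub.
by apply: sat_sub; exists n.
Qed.

Lemma coh_iso_sym M N : coh_iso M N -> coh_iso N M.
Proof. by move=> /coh_isoP[G /qiso_flip h]; apply/coh_isoP; exists (fun n m => G m n). Qed.

Lemma coh_iso_trans N M P : coh_iso M N -> coh_iso N P -> coh_iso M P.
Proof.
move=> /coh_isoP[G qG] /coh_isoP[H qH]; apply/coh_isoP; exists (mor_comp G H).
have /is_morP[h1 h2 h3] := is_mor_comp (qiso_mor qG) (qiso_mor qH).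
have /is_morP[_ h5 h6] := is_mor_comp (qiso_mor (qiso_flip qH)) (qiso_mor (qiso_flip qG)).
split=> // [u|m [n Gmn Hn0]].
  by apply: (sat_mono _ (h5 u)) => v [m [n Hvn Gnm]]; exists m; exists n.
by apply: h6; exists n.
Qed.

Lemma coh_zeroP M : coh_zero M <-> forall u : M, sat0 u.
Proof.
split=> [H u|H N].
  have mz := zero_mor M M.
  have [_ /(_ _ _ (is_mor_id M) mz)] := H M.
  move=> /(mor_eqP (is_mor_id M) mz) /(_ u u 0 erefl erefl).
  by rewrite subr0.
split=> u v mu mv; apply/mor_eqP => // m n n' hn hn'.
  have /is_morP[hu _ uf] := mu; have /is_morP[hv _ vf] := mv.
  have [K HK] := H m.
  apply: (satX (submod_zero _) (K := K)) => b; rewrite scalerBr.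
  apply: (submodB (sat0_submod _)); [apply: uf|apply: vf]; rewrite -(HK b); exact: hrelZ.
Qed.

End Morphisms.

(** * Constructions of graded modules *)

Section SubCarrier.
Variables (R : comNzRingType) (V : lmodType R) (W : V -> Prop).

Definition submod_pred (hW : is_submod W) : {pred V} := fun u => `[< W u >].

Variable hW : is_submod W.

Fact submod_pred_closed : submod_closed (submod_pred hW).
Proof.
split=> [|a u v /asboolP hu /asboolP hv]; first exact/asboolP/(submod0 hW).
by apply/asboolP; case: hW => _; apply.
Qed.

HB.instance Definition _ :=
  GRing.isSubmodClosed.Build R V (submod_pred hW) submod_pred_closed.

Record sub_carrier := SubCarrier { sub_val : V; _ : sub_val \in submod_pred hW }.
HB.instance Definition _ := [isSub for sub_val].
HB.instance Definition _ := [Choice of sub_carrier by <:].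
HB.instance Definition _ := [SubChoice_isSubLmodule of sub_carrier by <:].

Lemma sub_valP (u : sub_carrier) : W (sub_val u).
Proof. by case: u => u /= /asboolP. Qed.

Definition sub_mk u (hu : W u) : sub_carrier := SubCarrier (introT (asboolP (W u)) hu).

Lemma sub_valZ a u : sub_val (a *: u) = a *: sub_val u.
Proof. by []. Qed.
Lemma sub_valD u v : sub_val (u + v) = sub_val u + sub_val v.
Proof. by []. Qed.
Lemma sub_valB u v : sub_val (u - v) = sub_val u - sub_val v.
Proof. by []. Qed.
Lemma sub_val0 : sub_val 0 = 0.
Proof. by []. Qed.
Lemma sub_val_sum (I : Type) (r : seq I) (P : pred I) (F : I -> sub_carrier) :
  sub_val (\sum_(i <- r | P i) F i) = \sum_(i <- r | P i) sub_val (F i).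
Proof. exact: (big_morph sub_val sub_valD sub_val0). Qed.
Lemma sub_val_inj : injective sub_val.
Proof. exact: val_inj. Qed.

End SubCarrier.

Section QuotCarrier.
Variables (R : comNzRingType) (V : lmodType R) (W : V -> Prop) (hW : is_submod W).

Definition quot_carrier := Quotient.quot (submod_pred hW).
HB.instance Definition _ := GRing.Zmodule.on quot_carrier.

Definition qproj (u : V) : quot_carrier := \pi_(Quotient.quot (submod_pred hW))%qT u.

Lemma qproj_eq u v : qproj u = qproj v <-> W (u - v).
Proof.
split=> [/eqP|h]; first by rewrite /qproj -Quotient.idealrBE => /asboolP.
by apply/eqP; rewrite /qproj -Quotient.idealrBE; apply/asboolP.
Qed.

Lemma qproj_surj x : exists u, x = qproj u.
Proof. by exists (repr x); rewrite /qproj reprK. Qed.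

Lemma qprojD u v : qproj (u + v) = qproj u + qproj v.
Proof. exact: (raddfD (\pi_(Quotient.quot (submod_pred hW))%qT)). Qed.

Definition qscale (a : R) (x : quot_carrier) : quot_carrier :=
  qproj (a *: repr (x : Quotient.quot (submod_pred hW))).

Lemma qscaleE a u : qscale a (qproj u) = qproj (a *: u).
Proof.
apply/qproj_eq; rewrite -scalerBr; apply: (submodZ _ hW).
by apply/qproj_eq; rewrite /qproj reprK.
Qed.

Fact qscaleA a b x : qscale a (qscale b x) = qscale (a * b) x.
Proof. by have [u ->] := qproj_surj x; rewrite !qscaleE scalerA. Qed.
Fact qscale1 : left_id 1 qscale.
Proof. by move=> x; have [u ->] := qproj_surj x; rewrite qscaleE scale1r. Qed.
Fact qscaleDr : right_distributive qscale +%R.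
Proof.
move=> a x y; have [u ->] := qproj_surj x; have [v ->] := qproj_surj y.
by rewrite -qprojD !qscaleE scalerDr qprojD.
Qed.
Fact qscaleDl x : {morph qscale^~ x : a b / a + b}.
Proof.
by move=> a b; have [u ->] := qproj_surj x; rewrite !qscaleE scalerDl qprojD.
Qed.

HB.instance Definition _ := GRing.Zmodule_isLmodule.Build R quot_carrier
  qscaleA qscale1 qscaleDr qscaleDl.

Lemma qprojZ a u : qproj (a *: u) = a *: qproj u.
Proof. by rewrite -qscaleE. Qed.

Lemma qproj0 : qproj 0 = 0.
Proof. by rewrite -(scale0r 0) qprojZ scale0r. Qed.

Lemma qprojB u v : qproj (u - v) = qproj u - qproj v.
Proof. by rewrite -scaleN1r qprojD qprojZ scaleN1r. Qed.

Lemma qproj_sum (I : Type) (r : seq I) (P : pred I) (F : I -> V) :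
  qproj (\sum_(i <- r | P i) F i) = \sum_(i <- r | P i) qproj (F i).
Proof. exact: (big_morph qproj qprojD qproj0). Qed.

Lemma qproj_eq0 u : qproj u = 0 <-> W u.
Proof. by rewrite -qproj0 qproj_eq subr0. Qed.

End QuotCarrier.

Section Constructions.
Variables (k : closedFieldType) (p q : nat).
Local Notation S := (Sring k).
Local Notation L := (Lgrp p q).

Section SubGmod.
Variables (M : gmod k p q) (W : M -> Prop) (hW : hsub W).
Let hW' : is_submod W := hsub_submod hW.
Let V : lmodType S := sub_carrier hW'.
Let dV (l : L) (u : V) := deg M l (sub_val u).

Fact sub_deg0 l : dV l 0. Proof. by rewrite /dV sub_val0; exact: deg0. Qed.
Fact sub_degB l u v : dV l u -> dV l v -> dV l (u - v).
Proof. by rewrite /dV sub_valB; exact: degB. Qed.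
Fact sub_degZ a l s u : S_homog a s -> dV l u -> dV (a + l) (s *: u).
Proof. by rewrite /dV sub_valZ; exact: degZ. Qed.
Fact sub_deg_sum u : exists (ls : seq L) (f : L -> V),
  [/\ uniq ls, forall l, dV l (f l) & u = \sum_(l <- ls) f l].
Proof.
exists (supp (sub_val u)), (fun l => sub_mk hW' (hW.2 l _ (sub_valP u))).
split=> [|l|]; [exact: supp_uniq|exact: deg_comp|].
by apply: sub_val_inj; rewrite sub_val_sum /=; exact: comp_sum.
Qed.
Fact sub_deg_direct (ls : seq L) (f : L -> V) : uniq ls ->
  (forall l, dV l (f l)) -> \sum_(l <- ls) f l = 0 -> forall l, l \in ls -> f l = 0.
Proof.
move=> uls hf e l lls; apply: sub_val_inj; rewrite sub_val0.
apply: (deg_direct (f := fun l => sub_val (f l)) uls hf _ lls).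
by rewrite -sub_val_sum e sub_val0.
Qed.
Fact sub_fin_gen : exists gs : seq V, forall u, exists c : nat -> S,
  u = \sum_(i < size gs) c i *: gs`_i.
Proof.
have [gs hgs hspan] := gmod_fg hW'.
(* The generators of [W], transported to the subtype; the classical test succeeds on each of
   them. *)
pose ws : seq V := pmap (fun g => match pselect (W g) with
  | left h => Some (sub_mk hW' h) | right _ => None end) gs.
exists ws => u; apply: span_comb.
have : span gs (sub_val u) by apply: hspan; exact: sub_valP.
move=> /(_ (fun x => W x /\ exists2 y : V, sub_val y = x & span ws y)) [||_ [y /sub_val_inj->]//].
  split=> [|a x y [Wx [x' ex sx]] [Wy [y' ey sy]]].
    split; first exact: submod0 hW'.
    by exists 0; [rewrite sub_val0|exact: submod0 (span_submod _)].
  split; first exact: submodD hW' (submodZ a hW' Wx) Wy.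
  exists (a *: x' + y'); first by rewrite sub_valD sub_valZ ex ey.
  by case: (span_submod ws) => _; apply.
move=> g ggs; have Wg := hgs g ggs; split=> //.
exists (sub_mk hW' Wg) => //; apply: mem_span; rewrite mem_pmap; apply/mapP.
exists g => //; case: pselect => // h; congr Some; exact: sub_val_inj.
Qed.

Definition sub_gmod : gmod k p q :=
  @GMod k p q V dV sub_deg0 sub_degB sub_degZ sub_deg_sum sub_deg_direct sub_fin_gen.

Definition sub_incl : mor_rel sub_gmod M := fun a m => m = sub_val (a : V).

Lemma sub_val_comp l (a : sub_gmod) : sub_val (comp l a : V) = comp l (sub_val (a : V)).
Proof.
have e' : sub_val (a : V) = \sum_(l <- supp a) sub_val (comp l a : V).
  by rewrite -sub_val_sum; exact: (congr1 (@sub_val _ _ _ hW') (comp_sum a)).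
rewrite (@comp_unique _ _ _ M (supp a) (fun l => sub_val (comp l a : V)) _ (supp_uniq a)) //; last first.
  by move=> x; exact: (deg_comp x a).
by case: ifP => // /negbT /comp_out ->; rewrite sub_val0.
Qed.

Lemma hrel_sub_incl : hrel sub_incl.
Proof.
split=> [|s a m a' m' -> ->|l a m ->].
- by rewrite /sub_incl sub_val0.
- by rewrite /sub_incl sub_valD sub_valZ.
- by rewrite /sub_incl sub_val_comp.
Qed.

End SubGmod.

Section QuotGmod.
Variables (M : gmod k p q) (W : M -> Prop) (hW : hsub W).
Let hW' : is_submod W := hsub_submod hW.
Let V : lmodType S := quot_carrier hW'.
Let dV (l : L) (u : V) := exists2 m, deg M l m & u = qproj hW' m.

Fact quot_deg0 l : dV l 0.
Proof. by exists 0; [exact: deg0|rewrite qproj0]. Qed.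
Fact quot_degB l u v : dV l u -> dV l v -> dV l (u - v).
Proof.
move=> [m hm ->] [n hn ->]; exists (m - n); first exact: degB.
by rewrite qprojB.
Qed.
Fact quot_degZ a l s u : S_homog a s -> dV l u -> dV (a + l) (s *: u).
Proof.
move=> hs [m hm ->]; exists (s *: m); first exact: degZ.
by rewrite qprojZ.
Qed.
Fact quot_deg_sum u : exists (ls : seq L) (f : L -> V),
  [/\ uniq ls, forall l, dV l (f l) & u = \sum_(l <- ls) f l].
Proof.
have [m ->] := qproj_surj u.
exists (supp m), (fun l => qproj hW' (comp l m)).
split=> [|l|]; [exact: supp_uniq|by exists (comp l m) => //; exact: deg_comp|].
by rewrite -qproj_sum -comp_sum.
Qed.
Fact quot_deg_direct (ls : seq L) (f : L -> V) : uniq ls ->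
  (forall l, dV l (f l)) -> \sum_(l <- ls) f l = 0 -> forall l, l \in ls -> f l = 0.
Proof.
move=> uls hf e l lls.
have [g hg] : exists g : L -> M, forall l, deg M l (g l) /\ f l = qproj hW' (g l).
  have /choice[g hg] : forall l, exists m, deg M l m /\ f l = qproj hW' m.
    by move=> x; have [m] := hf x; exists m.
  by exists g.
have : W (\sum_(l <- ls) g l).
  apply/(qproj_eq0 hW'); rewrite qproj_sum -[RHS]e.
  by apply: eq_bigr => x _; case: (hg x).
move=> /(hW.2 l); rewrite (comp_unique uls (fun x => (hg x).1) erefl) lls => Wg.
by rewrite (hg l).2; apply/qproj_eq0.
Qed.
Fact quot_fin_gen : exists gs : seq V, forall u, exists c : nat -> S,
  u = \sum_(i < size gs) c i *: gs`_i.
Proof.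
have [gs hgs] := fin_gen M; exists (map (qproj hW') gs) => u.
have [m ->] := qproj_surj u; have [c ->] := hgs m; exists c.
rewrite qproj_sum size_map; apply: eq_bigr => i _.
by rewrite qprojZ (nth_map 0).
Qed.

Definition quot_gmod : gmod k p q :=
  @GMod k p q V dV quot_deg0 quot_degB quot_degZ quot_deg_sum quot_deg_direct quot_fin_gen.

End QuotGmod.

Section FreeGmod.
Variable l0 : L.
Let V : lmodType S := S^o.
(** The twist [S(l0)]: its generator [1] sits in degree [- l0]. *)
Let dV (l : L) (s : V) := S_homog (l + l0) (s : S).

Fact free_deg0 l : dV l 0. Proof. exact: homog0. Qed.
Fact free_degB l u v : dV l u -> dV l v -> dV l (u - v).
Proof. exact: homogB. Qed.
Fact free_degZ a l s u : S_homog a s -> dV l u -> dV (a + l) (s *: u).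
Proof. by rewrite /dV -addrA; exact: homogM. Qed.
Fact free_deg_sum u : exists (ls : seq L) (f : L -> V),
  [/\ uniq ls, forall l, dV l (f l) & u = \sum_(l <- ls) f l].
Proof.
have DD l (x y : V) : dV l x -> dV l y -> dV l (x + y) by exact: homogD.
rewrite -/(hdec dV u) (mpoly.mpolyE (u : S)).
apply: (big_ind (hdec dV)); first exact: hdec0 free_deg0.
  exact: (hdecD free_deg0 DD).
move=> m _; apply: (hdec_homog free_deg0 (l := mon_deg p q m - l0)).
rewrite /dV subrK -SconstM; apply: homogCM => m'.
by rewrite mpoly.msuppX inE => /eqP->.
Qed.
Fact free_deg_direct (ls : seq L) (f : L -> V) : uniq ls ->
  (forall l, dV l (f l)) -> \sum_(l <- ls) f l = 0 -> forall l, l \in ls -> f l = 0.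
Proof.
move=> uls hf e l lls; apply/mpoly.mpolyP => m; rewrite mpoly.mcoeff0.
apply: contrapT => /eqP hm.
have := congr1 (mpoly.mcoeff m) e; rewrite mpoly.mcoeff0 raddf_sum (bigD1_seq l) //= big1.
  by rewrite addr0 => /eqP; rewrite (negPf hm).
move=> l' ne; apply: contraNeq ne => hm'; apply/eqP.
have /homogP/(_ m hm) e1 := hf l; have /homogP/(_ m hm') e2 := hf l'.
by apply: (addIr l0); rewrite -e1 -e2.
Qed.
Fact free_fin_gen : exists gs : seq V, forall u, exists c : nat -> S,
  u = \sum_(i < size gs) c i *: gs`_i.
Proof.
by exists [:: 1 : S] => u; exists (fun=> u); rewrite big_ord1 /= [RHS]mulr1.
Qed.

Definition free_gmod : gmod k p q :=
  @GMod k p q V dV free_deg0 free_degB free_degZ free_deg_sum free_deg_direct free_fin_gen.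

End FreeGmod.

Section ShiftGmod.
Variables (M : gmod k p q) (l0 : L).
Let dV (l : L) (u : M) := deg M (l + l0) u.

Fact shift_deg0 l : dV l 0. Proof. exact: deg0. Qed.
Fact shift_degB l u v : dV l u -> dV l v -> dV l (u - v).
Proof. exact: degB. Qed.
Fact shift_degZ a l s u : S_homog a s -> dV l u -> dV (a + l) (s *: u).
Proof. by rewrite /dV -addrA; exact: degZ. Qed.
Fact shift_deg_sum u : exists (ls : seq L) (f : L -> M),
  [/\ uniq ls, forall l, dV l (f l) & u = \sum_(l <- ls) f l].
Proof.
exists [seq l - l0 | l <- supp u], (fun l => comp (l + l0) u).
split=> [|l|]; last 1 first.
- by rewrite {1}[u]comp_sum big_map; apply: eq_bigr => l _; rewrite subrK.
- by rewrite map_inj_uniq ?supp_uniq //; exact: addIr.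
- exact: deg_comp.
Qed.
Fact shift_deg_direct (ls : seq L) (f : L -> M) : uniq ls ->
  (forall l, dV l (f l)) -> \sum_(l <- ls) f l = 0 -> forall l, l \in ls -> f l = 0.
Proof.
move=> uls hf e l lls.
have := @deg_direct _ _ _ M [seq l + l0 | l <- ls] (fun l => f (l - l0)).
rewrite map_inj_uniq; last exact: addIr.
move=> /(_ uls) H; have /= := H _ _ (l + l0); rewrite addrK; apply.
- by move=> x; have := hf (x - l0); rewrite /dV subrK.
- by rewrite big_map -[RHS]e; apply: eq_bigr => x _; rewrite addrK.
- exact: map_f.
Qed.

(** The carrier is unchanged, so multiplication by a form of degree [d] is a graded map from the
    twist by [- d] to [M]. *)
Definition shift_gmod : gmod k p q :=
  @GMod k p q M dV shift_deg0 shift_degB shift_degZ shift_deg_sum shift_deg_direct (fin_gen M).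

Lemma shift_comp l (u : M) : comp l (u : shift_gmod) = comp (l + l0) u.
Proof.
rewrite (@comp_unique _ _ _ shift_gmod [seq l - l0 | l <- supp u] (fun l => comp (l + l0) u)).
- case: ifP => // /negP nl; rewrite comp_out //; apply/negP => h; apply: nl.
  by apply/mapP; exists (l + l0); rewrite ?addrK.
- by rewrite map_inj_uniq ?supp_uniq //; exact: addIr.
- by move=> x; exact: (deg_comp (x + l0) u).
- by rewrite {1}[u]comp_sum big_map; apply: eq_bigr => x _; rewrite subrK.
Qed.

End ShiftGmod.
End Constructions.

(** * Cyclic modules and indecomposability *)

Section CyclicModules.
Variables (k : closedFieldType) (p q : nat).
Hypotheses (hp : (0 < p)%N) (hq : (0 < q)%N).
Local Notation S := (Sring k).
Local Notation L := (Lgrp p q).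
Local Notation X := (X k).
Local Notation pt := (@point_prime k p q).
Implicit Types (M N A : gmod k p q) (s t f : S).

(** Components of a polynomial, borrowed from [S] regarded as a graded module over itself. *)
Definition scomp (a : L) s : S := comp (M := free_gmod k (0 : L)) a s.

Lemma homog_scomp a s : S_homog a (scomp a s).
Proof. by have := deg_comp a (s : free_gmod k (0 : L)); rewrite /deg /= addr0. Qed.

Lemma scomp_sum s : exists ls : seq L, s = \sum_(a <- ls) scomp a s.
Proof. by exists (supp (s : free_gmod k (0 : L))); exact: (comp_sum (s : free_gmod k (0 : L))). Qed.

Lemma scomp_homog a s : S_homog a s -> scomp a s = s.
Proof.
by move=> hs; apply: (comp_id (M := free_gmod k (0 : L))); rewrite /deg /= addr0.
Qed.

Lemma scomp_eq0 s : (forall a, scomp a s = 0) -> s = 0.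
Proof. by move=> H; have [ls ->] := scomp_sum s; rewrite big1. Qed.

Lemma comp_scale M d (u : M) l s : deg M d u -> comp l (s *: u) = scomp (l - d) s *: u.
Proof.
move=> hu; pose N := free_gmod k (0 : L).
have e : s *: u = \sum_(l <- [seq a + d | a <- supp (s : N)]) scomp (l - d) s *: u.
  rewrite big_map {1}(comp_sum (s : N)) scaler_suml.
  by apply: eq_bigr => a _; rewrite addrK.
rewrite (comp_unique _ _ e) => [||x].
- case: ifP => // /negP hl; rewrite /scomp comp_out ?scale0r //.
  by apply/negP => h; apply: hl; apply/mapP; exists (l - d); rewrite ?subrK.
- by rewrite map_inj_uniq ?supp_uniq //; exact: addIr.
- by rewrite -[x in deg M x](subrK d); apply: degZ => //; exact: homog_scomp.
Qed.

Definition cyclic M (rho : S) (l : L) (g : M) :=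
  [/\ deg M (- l) g, forall u : M, exists s : S, u = s *: g &
      forall s : S, s *: g = 0 <-> exists t, s = t * rho].

Section CyclicTheory.
Variables (M : gmod k p q) (rho : S) (l : L) (g : M).
Hypothesis cg : cyclic rho l g.

Lemma cyclic_homog d (u : M) : deg M d u -> exists2 s, S_homog (d + l) s & u = s *: g.
Proof.
case: cg => hg gen _ hu; have [s e] := gen u.
exists (scomp (d + l) s); first exact: homog_scomp.
by rewrite -(comp_id hu) e (comp_scale _ _ hg) opprK.
Qed.

Lemma cyclic_ann s : s *: g = 0 <-> exists t, s = t * rho.
Proof. by case: cg. Qed.

Lemma cyclic_rho t : (t * rho) *: g = 0.
Proof. by apply/cyclic_ann; exists t. Qed.

(** For [rho] nonzero this is the saturation of a principal ideal; for [rho] zero it is integrality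
    of [S]. *)
Lemma cyclic_sat0 (u : M) : sat0 u -> u = 0.
Proof.
case: cg => _ gen _; have [s ->] := gen u => -[K HK].
have H b : exists t, X b ^+ K * s = t * rho.
  by apply/cyclic_ann; rewrite -scalerA; exact: HK.
apply/cyclic_ann; have [r0|r0] := eqVneq rho 0; last exact: S_sat_dvd H.
exists 0; rewrite r0 mulr0; have [t] := H true; rewrite r0 mulr0 => /S_mulf_eq0[] // e.
by have := S_expf_neq0 K (X_neq0 k true); rewrite e eqxx.
Qed.

(** The left-hand condition is invariant under isomorphism of sheaves, so [rho] can be compared, up
    to divisibility, between isomorphic cyclic sheaves. *)
Lemma cyclic_kill f : (forall u : M, sat0 (f *: u)) <-> exists t, f = t * rho.
Proof.
split=> [H|[t ->] u]; first exact/cyclic_ann/cyclic_sat0/H.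
case: cg => _ gen _; have [s ->] := gen u.
rewrite scalerA mulrC mulrA cyclic_rho; exact: sat_sub.
Qed.

Lemma cyclic_neq0 : (forall t, t * rho != 1) -> ~ coh_zero M.
Proof.
move=> H /(coh_zeroP hp hq) /(_ g) /cyclic_sat0; rewrite -[g]scale1r.
by move=> /cyclic_ann[t e]; have := H t; rewrite -e eqxx.
Qed.

End CyclicTheory.

Definition uniform M := forall d d' (u v : M), deg M d u -> deg M d' v ->
  u <> 0 -> v <> 0 -> exists s t, s *: u = t *: v /\ s *: u <> 0.

Lemma cyclic0_uniform M l (g : M) : cyclic 0 l g -> uniform M.
Proof.
move=> cg d d' u v _ _; case: (cg) => _ gen ann.
have [s ->] := gen u; have [t ->] := gen v => u0 v0.
exists t, s; rewrite !scalerA mulrC; split=> // /ann[r]; rewrite mulr0.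
by move=> /S_mulf_eq0[] e; [apply: u0|apply: v0]; rewrite e scale0r.
Qed.

Lemma pt_valuation lam n s : s != 0 ->
  (exists t, s = t * pt lam ^+ n) \/
  (exists a h, [/\ (a < n)%N, s = h * pt lam ^+ a & forall t, h != t * pt lam]).
Proof.
move=> s0; elim: n => [|n [[t e]|[a [h [an e H]]]]].
- by left; exists s; rewrite expr0 mulr1.
- have [[t' et]|H] := pselect (exists t', t = t' * pt lam).
    by left; exists t'; rewrite e et exprS mulrA.
  right; exists n, t; split=> // t'; apply/eqP => et; apply: H; by exists t'.
- by right; exists a, h; split=> //; exact: leqW.
Qed.

Lemma homog_divr (a b : L) s t : t != 0 -> S_homog a t -> S_homog b (s * t) -> S_homog (b - a) s.
Proof.
move=> t0 ht hst; suff -> : s = scomp (b - a) s by exact: homog_scomp.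
apply: (S_mulfI t0); rewrite mulrC -[LHS](scomp_homog hst) [s * t]mulrC.
have := compZ' (M := free_gmod k (0 : L)) b (s : S^o) ht.
by rewrite /scomp => ->.
Qed.

Lemma pt_homog_pow lam a (d : L) h : S_homog d (h * pt lam ^+ a) ->
  S_homog (d - pdeg p q lam *+ a) h.
Proof.
move=> hh; apply: homog_divr hh; first exact/S_expf_neq0/pt_neq0.
exact/homogXn/homog_pt.
Qed.

(** Comaximality of [pt lam] and [h] makes [h'] divisible after multiplication by powers of the
    variables, and saturation removes these powers. *)
Lemma pt_prime lam (a : L) h h' : S_homog a h -> h != 0 -> (forall t, h != t * pt lam) ->
  (exists t, h * h' = t * pt lam) -> exists t, h' = t * pt lam.
Proof.
move=> hh h0 nd [t et]; have [[r er]|[K HK]] := pt_coprime hp hq lam hh h0.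
  by have := nd r; rewrite er eqxx.
apply: (S_sat_dvd (K := K)); first exact: pt_neq0.
move=> b; have [s [r ->]] := HK b; exists (s * h' + r * t).
by rewrite mulrDl mulrDl -[r * h * h']mulrA et; ring.
Qed.

Lemma cyclic_pt_homog M lam n l (g : M) d (u : M) : cyclic (pt lam ^+ n) l g ->
  deg M d u -> u <> 0 -> exists a h (e : L), [/\ (a < n)%N, u = (h * pt lam ^+ a) *: g,
    S_homog e h, h != 0 & forall t, h != t * pt lam].
Proof.
move=> cg hu u0; have [s hs es] := cyclic_homog cg hu.
have s0 : s != 0 by apply/eqP => e; apply: u0; rewrite es e scale0r.
have [[t et]|[a [h [an e H]]]] := pt_valuation lam n s0.
  by case: u0; rewrite es et (cyclic_rho cg).
exists a, h, (d + l - pdeg p q lam *+ a); split=> //.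
- by rewrite es e.
- by apply: pt_homog_pow; rewrite -e.
- by apply: contraNneq s0 => h0; rewrite e h0 mul0r.
Qed.

(** Nonzero homogeneous elements can be pushed into the last layer, generated by [pt^(n-1) g]. Their
    cofactors [h] and [h'] are prime to the point, so the common multiple [h h' pt^(n-1) g] is
    nonzero. *)
Lemma cyclic_pt_uniform M lam n l (g : M) : cyclic (pt lam ^+ n) l g -> uniform M.
Proof.
move=> cg d d' u v hu hv u0 v0.
have [a [h [e [an -> hh h0 nd]]]] := cyclic_pt_homog cg hu u0.
have [a' [h' [e' [an' -> hh' h0' nd']]]] := cyclic_pt_homog cg hv v0.
exists (h' * pt lam ^+ (n.-1 - a)), (h * pt lam ^+ (n.-1 - a')).
have ee b c i : (i < n)%N -> (b * pt lam ^+ (n.-1 - i)) *: ((c * pt lam ^+ i) *: g)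
   = (b * c * pt lam ^+ n.-1) *: g.
  move=> lt; have le : (i <= n.-1)%N by case: (n) lt.
  by rewrite scalerA mulrACA -exprD subnK.
rewrite !ee // [h * h']mulrC; split=> // /(cyclic_ann cg)[t].
have n0 : (0 < n)%N by case: (n) an.
rewrite -[in RHS](prednK n0) exprS mulrA ![_ * pt lam ^+ n.-1]mulrC.
have pn0 : pt lam ^+ n.-1 != 0 by exact/S_expf_neq0/pt_neq0.
move=> /(S_mulfI pn0); rewrite mulrC => et.
have [r er] := pt_prime hh h0 nd (ex_intro _ t et).
by have := nd' r; rewrite er eqxx.
Qed.

(** Two nonzero summands would each contribute a nonzero homogeneous element of [M]; a common
    nonzero multiple would come from both summands, hence be negligible, hence zero. *)
Lemma uniform_indecomposable M : (forall u : M, sat0 u -> u = 0) -> uniform M ->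
  ~ coh_zero M -> indecomposable M.
Proof.
move=> ns0 unif nz; split=> // A B i j [mi mj univ].
apply: contrapT => /not_orP[nA nB].
(* A homogeneous element may lie outside the domain of [G], but multiplying by a power of a suitable
   variable brings it inside without making it negligible. *)
have homex N (G : mor_rel N M) : is_mor G -> ~ coh_zero N ->
    exists d (a : N) (m : M), [/\ deg N d a, ~ sat0 a, deg M d m & G a m].
  move=> /is_morP -/(_ hp hq)[hG Gd Gf] nN.
  have : exists d (a : N), deg N d a /\ ~ sat0 a.
    apply: contrapT => H; apply: nN; apply/coh_zeroP => // u.
    rewrite [u]comp_sum; apply: (submod_sum (sat0_submod _)) => d _.
    apply: contrapT => H'; apply: H; exists d, (comp d u); split=> //; exact: deg_comp.
  move=> [d [a [ha na]]]; have [K HK] := Gd a.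
  have [b hb] : exists b, ~ sat0 (X b ^+ K *: a).
    apply: contrapT => H; apply: na; apply: (satX (submod_zero _) (K := K)) => b.
    by apply: contrapT => H'; apply: H; exists b.
  have [m Gm] := HK b; pose e := Lx p q b *+ K + d.
  have he : deg N e (X b ^+ K *: a) by apply: degZ => //; exact/homogXn/homogX.
  exists e, (X b ^+ K *: a), (comp e m); split=> //; first exact: deg_comp.
  by case: hG => _ _ /(_ e _ _ Gm); rewrite (comp_id he).
(* A retraction of [i] killing [j] makes an element of both images negligible. *)
have [w [mw w1 w2 _]] := univ A _ _ (is_mor_id hp hq A) (zero_mor hp hq B A).
have {w1} /(mor_eqP hp hq (is_mor_comp hp hq mi mw) (is_mor_id hp hq A)) w1 := w1.
have {w2} /(mor_eqP hp hq (is_mor_comp hp hq mj mw) (zero_mor hp hq B A)) w2 := w2.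
have inter a b' m : i a m -> j b' m -> sat0 a.
  move=> ia jb; have /is_morP -/(_ hp hq)[hw wd _] := mw.
  have /is_morP -/(_ hp hq)[hi _ _] := mi; have /is_morP -/(_ hp hq)[hj _ _] := mj.
  have [K HK] := wd m; apply: (satX (submod_zero _) (K := K)) => b.
  have [z wz] := HK b.
  have s1 : sat0 (z - X b ^+ K *: a).
    apply: (w1 (X b ^+ K *: a)) => //; exists (X b ^+ K *: m) => //; exact: hrelZ.
  have s2 : sat0 (z - 0).
    apply: (w2 (X b ^+ K *: b')) => //; exists (X b ^+ K *: m) => //; exact: hrelZ.
  have := submodB (sat0_submod _) s2 s1; rewrite subr0 opprB addrCA subrr addr0 //.
have [w' [mw' w1' w2' _]] := univ B _ _ (zero_mor hp hq A B) (is_mor_id hp hq B).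
have {w2'} /(mor_eqP hp hq (is_mor_comp hp hq mj mw') (is_mor_id hp hq B)) w2' := w2'.
have [d [a [m [ha na hm iam]]]] := homex _ _ mi nA.
have [d' [b' [m' [hb nb hm' jbm]]]] := homex _ _ mj nB.
have inj N (G : mor_rel N M) (w0 : mor_rel M N) : is_mor G -> is_mor w0 ->
   (forall u n n', mor_comp G w0 u n -> mor_id u n' -> sat0 (n - n')) ->
   forall u, G u 0 -> sat0 u.
  move=> mG mw0 H u Gu0; have := H u 0 u; rewrite sub0r => H'.
  rewrite -[u]opprK; apply: (submodN (sat0_submod _)); apply: H' => //.
  by exists 0 => //; have /is_morP -/(_ hp hq)[[]] := mw0.
have m0 : m <> 0 by move=> e; apply: na; rewrite e in iam; exact: (inj _ _ _ mi mw w1).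
have m0' : m' <> 0 by move=> e; apply: nb; rewrite e in jbm; exact: (inj _ _ _ mj mw' w2').
have [s [t [est ne]]] := unif _ _ _ _ hm hm' m0 m0'.
have /is_morP -/(_ hp hq)[hi _ fi] := mi; have /is_morP -/(_ hp hq)[hj _ _] := mj.
have [K HK] : sat0 (s *: a).
  by apply: (inter _ (t *: b') (s *: m)); [exact: hrelZ|rewrite est; exact: hrelZ].
apply: ne; apply: ns0; apply: (satX (submod_zero _) (K := K)) => b.
by apply: fi; rewrite -(HK b); do 2!apply: hrelZ => //.
Qed.

End CyclicModules.

(** * Subobjects, length and vector bundles *)

Section Subobjects.
Variables (k : closedFieldType) (p q : nat).
Hypotheses (hp : (0 < p)%N) (hq : (0 < q)%N).
Local Notation S := (Sring k).
Local Notation L := (Lgrp p q).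
Local Notation X := (X k).
Local Notation pt := (@point_prime k p q).
Implicit Types (M N A B : gmod k p q) (s t f : S).

Lemma sub_incl_mor M (W : M -> Prop) (hW : hsub W) : is_mor (sub_incl (hW := hW)).
Proof.
apply/is_morP => //; split=> [|m|n ->]; first exact: hrel_sub_incl.
  by apply: sat_sub; eexists.
by apply: sat_sub; rewrite sub_val0.
Qed.

(** A monomorphism is tested on the inclusion of its kernel against the zero morphism. *)
Lemma is_monoP M N (G : mor_rel M N) :
  is_mono G <-> is_mor G /\ forall m, G m 0 -> sat0 m.
Proof.
split=> [[mG H]|[mG H]]; have /is_morP -/(_ hp hq)[hG Gd Gf] := mG; split=> //.
  move=> m Gm0; pose hK := hsub_rker hG.
  pose Z := sub_gmod hK; pose u : mor_rel Z M := sub_incl (hW := hK).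
  have mu : is_mor u by exact: sub_incl_mor.
  have mv := zero_mor hp hq Z M.
  have := H Z u _ mu mv; rewrite (mor_eqP hp hq mu mv).
  rewrite (mor_eqP hp hq (is_mor_comp hp hq mu mG) (is_mor_comp hp hq mv mG)).
  move=> /(_ _ (sub_mk (hsub_submod hK) Gm0 : Z) m 0) H'; rewrite -[m]subr0; apply: H' => //.
  move=> z n n' [x -> Gn] [y -> Gn']; apply: (submodB (sat0_submod _)); apply: Gf => //.
  have := hrelB hG Gn (sub_valP (z : sub_carrier (hsub_submod hK))); by rewrite subrr subr0.
move=> Z u v mu mv; rewrite (mor_eqP hp hq mu mv).
rewrite (mor_eqP hp hq (is_mor_comp hp hq mu mG) (is_mor_comp hp hq mv mG)) => E z m m' um vm'.
have /is_morP -/(_ hp hq)[hu _ _] := mu; have /is_morP -/(_ hp hq)[hv _ _] := mv.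
have hd := hsub_submod (hsub_rdom hG).
have [K1 H1] := Gd m; have [K2 H2] := Gd m'.
pose K := maxn K1 K2; apply: (satX (submod_zero _) (K := K)) => b.
have [n Gn] := sat_leq hd (leq_maxl K1 K2) H1 b.
have [n' Gn'] := sat_leq hd (leq_maxr K1 K2) H2 b.
have s0 : sat0 (n - n').
  apply: (E (X b ^+ K *: z)); [exists (X b ^+ K *: m)|exists (X b ^+ K *: m')] => //; exact: hrelZ.
have [K' HK'] := s0; apply: (satX (submod_zero _) (K := K')) => c; apply: H.
by rewrite -(HK' c); apply: hrelZ => //; rewrite scalerBr; exact: hrelB.
Qed.

Lemma cyclic_pt_ann M lam n l (g : M) b s : cyclic (pt lam ^+ n) l g ->
  pt lam ^+ b *: (s *: g) = 0 -> exists r, s = r * pt lam ^+ (n - b).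
Proof.
move=> cg; rewrite scalerA => /(cyclic_ann cg)[t].
have [le|lt] := leqP n b; first by exists s; rewrite (eqP le) mulr1.
rewrite -[in RHS](subnK (ltnW lt)) exprD mulrA [RHS]mulrC => e; exists t.
exact: (S_mulfI (S_expf_neq0 b (pt_neq0 p hq lam))) e.
Qed.

(* The subobjects of S/pt^n(l) are, up to isomorphism, the images of the
   powers of [pt lam]; [b] bounds the length of the subobject [rrng G]. *)
Lemma cyclic_pt_chain M lam n l (g : M) : cyclic (pt lam ^+ n) l g ->
  forall b A (G : mor_rel A M), is_mor G -> (forall m, G m 0 -> sat0 m) ->
    (forall c, rrng G c -> pt lam ^+ b *: c = 0) -> ~ has_chain b.+1 A.
Proof.
move=> cg; elim=> [|b IH] A G mG Gk Gr [A' [G' [/is_monoP[mG' G'k] niso ch]]];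
  have /is_morP -/(_ hp hq)[hG Gd Gf] := mG; have /is_morP -/(_ hp hq)[hG' G'd G'f] := mG'.
  apply: niso; apply/is_isoP => //; split=> // a.
  apply: (sat0_sat (hsub_submod (hsub_rrng hG'))).
  have [K HK] := Gd a; apply: (satX (submod_zero _) (K := K)) => c; apply: Gk.
  have [m Gm] := HK c; have := Gr m; rewrite scale1r => e.
  by rewrite -{1}e //; exists (X c ^+ K *: a).
pose H := mor_comp G' G; have mH : is_mor H by exact: is_mor_comp.
have Hk m : H m 0 -> sat0 m.
  move=> [a h1 h2]; have [K HK] := Gk _ h2.
  by apply: (satX (submod_zero _) (K := K)) => c; apply: G'k; rewrite -(HK c); exact: hrelZ.
have /is_morP -/(_ hp hq)[hH Hd _] := mH.
(* If [pt^b] kills the image of [A'], induction applies to [A']. Otherwise some [c] in that image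
   has exact order [b.+1]; it generates the image of [A] up to powers of the variables, so [G'] is
   an isomorphism. *)
have [[d [c [hc Rc nc]]]|no] := pselect (exists d (c : M),
    [/\ deg M d c, rrng H c & pt lam ^+ b *: c <> 0]); last first.
  apply: (IH A' H mH Hk) ch => c Rc; rewrite [c]comp_sum scaler_sumr big1 // => d _.
  apply: contrapT => nc; apply: no; exists d, (comp d c); split=> //; first exact: deg_comp.
  by case: (hsub_rrng hH) => _; apply.
have RG c' : rrng H c' -> rrng G c' by move=> [a' [a h1 h2]]; exists a.
have cK : pt lam ^+ b.+1 *: c = 0 by apply/Gr/RG.
have [c0 cgen cann] := cg.
have c'0 : c <> 0 by move=> e; apply: nc; rewrite e scaler0.
have [a [h [e [an ec hh h0 nd]]]] := cyclic_pt_homog hq cg hc c'0.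
have ab : (a + b < n)%N.
  rewrite ltnNge; apply/negP => le; apply: nc; rewrite ec scalerA; apply/cann.
  exists (h * pt lam ^+ (a + b - n)).
  by rewrite mulrCA -exprD -mulrA -exprD subnK // [(b + a)%N]addnC.
have ea : a = (n - b.+1)%N.
  have [r er] : exists r, h * pt lam ^+ a = r * pt lam ^+ (n - b.+1).
    by apply: (cyclic_pt_ann cg); rewrite -ec.
  apply/eqP; rewrite eqn_leq; apply/andP; split; first by lia.
  rewrite leqNgt; apply/negP => lt.
  have := nd (r * pt lam ^+ (n - b.+1 - a).-1); rewrite -mulrA -exprSr prednK ?subn_gt0 //.
  move=> /eqP; apply; apply: (S_mulfI (S_expf_neq0 a (pt_neq0 p hq lam))).
  by rewrite mulrC er mulrCA -exprD subnKC // ltnW.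
have hR := hsub_submod (hsub_rrng hH).
(* [pt^(b+1)] kills [c'], and [h c'] is a multiple of [c]; as [h] is prime to the point, [c'] is in
   the saturation. *)
have key c' : rrng G c' -> sat (rrng H) c'.
  move=> /Gr; have [s ->] := cgen c' => hs0; have [r er] := cyclic_pt_ann cg hs0.
  have [[t et]|cm] := pt_coprime hp hq lam hh h0; first by have := nd t; rewrite et eqxx.
  apply: (sat_comax hR (comaxC (comaxXn b.+1 (comaxC cm)))); last first.
    rewrite scalerA er -ea mulrCA -scalerA -ec; exact: submodZ.
  by rewrite hs0; exact: (submod0 hR).
have hR' := hsub_submod (hsub_rrng hG').
apply: niso; apply/is_isoP => //; split=> // x.
have [K HK] := Gd x; apply: (satX hR' (K := K)) => y.
have [m Gm] := HK y; have [K' HK'] : sat (rrng H) m by apply: key; exists (X y ^+ K *: x).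
apply: (satX hR' (K := K')) => z; have [a' [x' h1 h2]] := HK' z.
have := hrelB hG (hrelZ hG (X z ^+ K') Gm) h2; rewrite subrr => /Gk.
move=> /(sat0_sat hR') hd.
rewrite -[X in sat _ X](subrK x'); apply: (submodD (sat_submod hR')) => //.
by apply: sat_sub; exists a'.
Qed.

Lemma cyclic_pt_finite_length M lam n l (g : M) :
  cyclic (pt lam ^+ n) l g -> finite_length M.
Proof.
move=> cg; exists n.+1; have mi := is_mor_id hp hq M.
apply: (cyclic_pt_chain cg mi); first by move=> m ->; exact: sat_sub.
move=> c _; case: (cg) => _ gen _; have [s ->] := gen c.
by rewrite scalerA mulrC (cyclic_rho cg).
Qed.

(** What the proof of infinite length asks of a line bundle: integrality, regularity of the two
    variables in power form, and separation for powers of [x_1]. *)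
Definition torsion_free M :=
  [/\ forall s (u : M), s *: u = 0 -> s = 0 \/ u = 0,
      forall j n (u v : M), X false ^+ j *: u = X true ^+ n *: v ->
        exists w, u = X true ^+ n *: w &
      forall u : M, (forall n, exists w, u = X true ^+ n *: w) -> u = 0].

Lemma cyclic0_torsion_free M l (g : M) : cyclic 0 l g -> torsion_free M.
Proof.
move=> cg; have [_ gen ann] := cg.
have ann0 s : s *: g = 0 -> s = 0 by move=> /ann[t]; rewrite mulr0.
have inj s t : s *: g = t *: g -> s = t.
  by move=> /eqP; rewrite -subr_eq0 -scalerBl => /eqP/ann0/eqP; rewrite subr_eq0 => /eqP.
split=> [s u|j n u v|u H].
- by have [t ->] := gen u; rewrite scalerA => /ann0 /S_mulf_eq0[->|->]; [left|right; rewrite scale0r].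
- have [s ->] := gen u; have [t ->] := gen v; rewrite !scalerA => /inj.
  by move=> /(S_regular (b := true))[s' ->]; exists (s' *: g); rewrite scalerA.
have [s es] := gen u; suff s0 : s = 0 by rewrite es s0 scale0r.
have dv n : exists t, s = X true ^+ n * t.
  have [w ew] := H n; have [t et] := gen w; exists t.
  by apply: inj; rewrite -es ew et scalerA.
apply/eqP; apply: contrapT => /negP s0; have [m ms] := msupp_neq0 s0.
(* [x_1] cannot divide [s] more often than it occurs in a given monomial of [s]. *)
have [t et] := dv (m (iv true)).+1.
have : forall n (t : S), (m (iv true) < n)%N -> mpoly.mcoeff m (X true ^+ n * t) = 0.
  move: m {ms et} => m n; elim: n m => // n IH m t'; rewrite ltnS => le.
  rewrite exprS -mulrA; have [m0|mpos] := posnP (m (iv true)); first exact: mcoeff_XM0.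
  have -> : m = mpoly.mnm_add (mpoly.mnm1 (iv true)) (mpoly.mnm_sub m (mpoly.mnm1 (iv true))).
    apply/mpoly.mnmP => i; rewrite mpoly.mnmDE mpoly.mnmBE mpoly.mnm1E.
    by case: eqP => [<-|_]; rewrite ?subn0 // subnKC.
  rewrite mcoeff_XM; apply: IH; rewrite mpoly.mnmBE mpoly.mnm1E eqxx; lia.
move=> /(_ _ t (leqnn _)); rewrite -et => e.
by move: ms; rewrite mpoly.mcoeff_msupp e eqxx.
Qed.

Lemma torsion_free_sat0 M (u : M) : torsion_free M -> sat0 u -> u = 0.
Proof.
move=> [tf _ _] [K /(_ true)] /tf[e|//].
by have := S_expf_neq0 K (X_neq0 k true); rewrite e eqxx.
Qed.

(** Multiplication by [x_1] embeds the twist [A(- x_1)] into [A]. Were it an isomorphism, the image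
    of [A] in [M] would be divisible by all powers of [x_1], against separation. As twists keep
    carriers, the same [G] feeds the induction. *)
Lemma torsion_free_chain n M A (G : mor_rel A M) : torsion_free M -> is_mor G ->
  (forall m, G m 0 -> sat0 m) -> ~ coh_zero A -> has_chain n A.
Proof.
elim: n M A G => // n IH M A G tf mG Gk nz.
have /is_morP -/(_ hp hq)[hG Gd Gf] := mG.
have [tf1 tf2 tf3] := tf.
pose A' := shift_gmod A (- Lx p q true); pose M' := shift_gmod M (- Lx p q true).
pose G1 : mor_rel A' A := fun a b => b = X true *: (a : A).
have mG1 : is_mor G1.
  apply/is_morP => //; split=> [|a|b ->].
  - split=> [|s m n' m' n'' -> ->|l m n' ->]; rewrite /G1 ?scaler0 //.
      by rewrite scalerDr !scalerA mulrC.
    by rewrite shift_comp (compZ' _ _ (homogX p q true)).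
  - by apply: sat_sub; eexists.
  - by rewrite scaler0; exact: sat_sub.
exists A', G1; split.
- apply/is_monoP; split=> // a /esym e.
  have [K HK] := Gd a; apply: (satX (submod_zero _) (K := K)) => b; apply: Gk.
  have [m Gm] := HK b.
  have := hrelZ hG (X true) Gm; rewrite scalerA mulrC -scalerA e scaler0.
  move=> /Gf /(torsion_free_sat0 tf) /tf1[e'|m0]; last by rewrite -m0.
  by have := X_neq0 k true; rewrite e' eqxx.
- move=> /(is_isoP hp hq)[_ _ Gr _ _]; apply: nz; apply/coh_zeroP => // a.
  (* Surjectivity of [G1] gives an equation between [x_2^(K'+K) m] and [x_1 m']; regularity strips
     the power of [x_2], here and again after dividing [m'] by [x_1^j]. *)
  have dv j m : rrng G m -> exists w, m = X true ^+ j *: w.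
    elim: j m => [|j IHj] m [a0 Gm]; first by exists m; rewrite scale1r.
    have [K HK] := Gr a0; have [a1 ea1] := HK false.
    have [K' HK'] := Gd a1; have [m' Gm'] := HK' false.
    have e1 := hrelZ hG (X true) Gm'; have e2 := hrelZ hG (X false ^+ (K' + K)) Gm.
    have ez : X false ^+ (K' + K) *: a0 = X true *: (X false ^+ K' *: (a1 : A)).
      by rewrite exprD -scalerA (ea1 : _ = _) !scalerA mulrC.
    have e3 := hrelB hG e2 e1; rewrite ez subrr in e3.
    have e4 : X false ^+ (K' + K) *: m - X true *: m' = 0.
      apply: (torsion_free_sat0 tf); exact: Gf.
    have e5 : X false ^+ (K' + K) *: m = X true *: m' by apply/eqP; rewrite -subr_eq0 e4.
    have [w ew] := tf2 _ 1%N _ _ e5.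
    have e6 : X false ^+ (K' + K) *: w = m'.
      have /tf1[e'|/eqP] : X true *: (X false ^+ (K' + K) *: w - m') = 0.
      - by rewrite scalerBr scalerA mulrC -scalerA -[X true *: w]/(X true ^+ 1 *: w) -ew e4.
      - by have := X_neq0 k true; rewrite e' eqxx.
      - by rewrite subr_eq0 => /eqP.
    have [w' ew'] : exists w', m' = X true ^+ j *: w' by apply: IHj; exists (X false ^+ K' *: a1).
    rewrite ew' in e6; have [w'' ew''] := tf2 _ _ _ _ e6.
    by exists w''; rewrite ew ew'' scalerA -exprS.
  have [K HK] := Gd a; apply: (satX (submod_zero _) (K := K)) => b; apply: Gk.
  have [m Gm] := HK b; have m0 : m = 0 by apply: tf3 => j; apply: dv; exists (X b ^+ K *: a).
  by rewrite -m0.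
have mG' : is_mor (G : mor_rel A' M').
  apply/is_morP => //; split=> //; case: hG => G0 GD Gc; split=> // l m m' Gm.
  by rewrite !shift_comp; exact: Gc.
apply: (IH M' A' _ tf mG' Gk) => /coh_zeroP -/(_ hp hq) H.
by apply: nz; apply/coh_zeroP.
Qed.

Lemma cyclic0_vector_bundle M l (g : M) : cyclic 0 l g -> vector_bundle M.
Proof.
move=> cg A G /is_monoP[mG Gk] [n nch]; apply: contrapT => nz; apply: nch.
exact: torsion_free_chain (cyclic0_torsion_free cg) mG Gk nz.
Qed.

End Subobjects.

(** * Isomorphisms of cyclic sheaves *)

Section CyclicIsomorphisms.
Variables (k : closedFieldType) (p q : nat).
Hypotheses (hp : (0 < p)%N) (hq : (0 < q)%N).
Local Notation S := (Sring k).
Local Notation L := (Lgrp p q).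
Local Notation X := (X k).
Local Notation pt := (@point_prime k p q).
Implicit Types (M N A B : gmod k p q) (s t f : S) (l d : L).

Lemma coh_iso_kill M N f : coh_iso M N ->
  (forall m : M, sat0 (f *: m)) -> forall n : N, sat0 (f *: n).
Proof.
move=> /(coh_isoP hp hq)[G [hG Gd Gr Gk Gf]] H n.
have [K HK] := Gr n; apply: (satX (submod_zero _) (K := K)) => b.
have [m Gm] := HK b; have [K' HK'] := H m.
apply: (satX (submod_zero _) (K := K')) => c; apply: Gf.
rewrite -(HK' c); apply: hrelZ => //.
by rewrite scalerA mulrC -scalerA; exact: hrelZ.
Qed.

Lemma scompM (a : L) d s t : S_homog d t -> scomp (a + d) (s * t) = scomp a s * t.
Proof.
move=> ht; rewrite mulrC [RHS]mulrC.
have := compZ' (M := free_gmod k (0 : L)) (a + d) (s : S^o) ht.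
by rewrite /scomp => ->; rewrite addrK.
Qed.

(** Multiplication by a form prime to [rho] is invertible on [S / rho] up to powers of the
    variables, so twisting by its degree leaves the sheaf unchanged. *)
Lemma cyclic_shift M N rho l d (g : M) (g' : N) (y : S) :
  cyclic rho l g -> cyclic rho (l + d) g' -> S_homog d y -> comax y rho -> coh_iso M N.
Proof.
move=> cg cg' hy [K HK]; apply/(coh_isoP hp hq).
have [hg gen ann] := cg; have [hg' gen' ann'] := cg'.
pose G (u : M) (v : N) := exists2 s, u = s *: g & v = (s * y) *: g'.
have hG : hrel G.
  split=> [|s m n m' n' [t -> ->] [t' -> ->]|e m n [s -> ->]].
  - by exists 0; rewrite ?mul0r scale0r.
  - by exists (s * t + t'); rewrite ?mulrDl scalerDl -?mulrA scalerA.
  - exists (scomp (e + l) s); first by rewrite (comp_scale _ _ hg) opprK.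
    by rewrite (comp_scale _ _ hg') opprK addrA scompM.
exists G; split=> // [m|n|m [s -> e]|n [s e ->]].
- by have [s ->] := gen m; apply: sat_sub; exists ((s * y) *: g'); exists s.
- have [s ->] := gen' n; exists K => b; have [s1 [t1 ->]] := HK b.
  exists ((s * s1) *: g); exists (s * s1) => //.
  rewrite scalerA mulrDl scalerDl [t1 * rho * s]mulrAC (cyclic_rho cg') addr0.
  by congr (_ *: _); ring.
- exists K => b; have [s1 [t1 ->]] := HK b.
  have [t et] := (ann' _).1 (esym e).
  rewrite scalerA mulrDl scalerDl.
  have -> : s1 * y * s = s1 * t * rho by rewrite -mulrA [y * s]mulrC et mulrA.
  by rewrite (cyclic_rho cg) add0r [t1 * rho * s]mulrAC (cyclic_rho cg).
- apply: sat_sub; have [t et] := (ann _).1 (esym e).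
  by rewrite et mulrAC (cyclic_rho cg').
Qed.

Lemma cyclic_iso M N rho l (g : M) (g' : N) : cyclic rho l g -> cyclic rho l g' -> coh_iso M N.
Proof.
move=> cg cg'; have cg0 : cyclic rho (l + 0) g' by rewrite addr0.
apply: (cyclic_shift (y := 1) cg cg0); first exact: homog1.
exact/comaxC/comax1.
Qed.

Lemma cyclic_shiftMz M N rho l d (g : M) (g' : N) (y : S) (z : int) :
  cyclic rho l g -> cyclic rho (l + d *~ z) g' -> S_homog d y -> comax y rho -> coh_iso M N.
Proof.
move=> cg cg' hy cy; have cyn n : comax (y ^+ n) rho by exact/comaxC/comaxXn/comaxC.
case: z cg' => n cg'.
  exact: (cyclic_shift cg cg' (homogXn (n := n) hy)).
have cg0 : cyclic rho (l + d *~ Negz n + d *+ n.+1) g by rewrite NegzE mulrNz subrK.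
apply/(coh_iso_sym hp hq); exact: (cyclic_shift cg' cg0 (homogXn (n := n.+1) hy)).
Qed.

(** The isomorphism relates [x_b^K g] to some [t_b g']. Single-valuedness forces
    [x_2^K t_1 = x_1^K t_2], and regularity gives [t_1 = x_1^K c] with [c] the form sought. *)
Lemma cyclic0_iso_le M N l l' (g : M) (g' : N) : cyclic 0 l g -> cyclic 0 l' g' ->
  coh_iso M N -> exists2 c : S, c != 0 & S_homog (l' - l) c.
Proof.
move=> cg cg' /(coh_isoP hp hq)[G [hG Gd Gr Gk Gf]].
have [hg gen ann] := cg; have [hg' gen' ann'] := cg'.
have [K HK] := Gd g.
have H b : exists2 t, S_homog (Lx p q b *+ K - l + l') t & G (X b ^+ K *: g) (t *: g').
  have [n Gn] := HK b; have [_ _ /(_ (Lx p q b *+ K - l) _ _ Gn)] := hG.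
  rewrite (comp_id (l := Lx p q b *+ K - l)); last exact: degZ (homogXn (homogX p q b)) hg.
  move=> Gc; have [s hs es] := cyclic_homog cg' (deg_comp (Lx p q b *+ K - l) n).
  by exists s => //; rewrite -es.
have [t1 h1 G1] := H true; have [t2 h2 G2] := H false.
have := hrelB hG (hrelZ hG (X false ^+ K) G1) (hrelZ hG (X true ^+ K) G2).
rewrite !scalerA mulrC subrr => /Gf /(cyclic_sat0 cg') /eqP.
rewrite -scalerBl => /eqP/ann'[r]; rewrite mulr0 => /eqP; rewrite subr_eq0 => /eqP e.
have [c ec] := S_regular (b := true) e.
have X0 : X true ^+ K != 0 by exact/S_expf_neq0/X_neq0.
exists c.
  apply/eqP => c0; rewrite ec c0 mulr0 scale0r in G1.
  move: (Gk _ G1) => /(cyclic_sat0 cg) /ann[r']; rewrite mulr0 => e0.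
  by rewrite e0 eqxx in X0.
have -> : l' - l = Lx p q true *+ K - l + l' - Lx p q true *+ K.
  by rewrite -(addrA _ (- l)) [RHS]addrC addKr [RHS]addrC.
apply: (homog_divr X0); first exact/homogXn/homogX.
by rewrite mulrC -ec.
Qed.

Lemma cyclic0_iso_inj M N l l' (g : M) (g' : N) : cyclic 0 l g -> cyclic 0 l' g' ->
  coh_iso M N -> l = l'.
Proof.
move=> cg cg' iso; have [c c0 hc] := cyclic0_iso_le cg cg' iso.
have [c' c0' hc'] := cyclic0_iso_le cg' cg (coh_iso_sym hp hq iso).
have hc'' : S_homog (- (l' - l)) c' by rewrite opprB.
by have /eqP := homog_opp hp hq c0 c0' hc hc''; rewrite subr_eq0 => /eqP.
Qed.

(** The generator times a power of the other variable has an image which, modulo [x_b], is a scalar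
    times a power of that variable; comparing degrees determines [l] up to multiples of the degree
    of that variable. *)
Lemma cyclicX_iso_inj M N b n l l' (g : M) (g' : N) : (0 < n)%N ->
  cyclic (X b ^+ n) l g -> cyclic (X b ^+ n) l' g' ->
  coh_iso M N -> exists z : int, l = l' + Lx p q (~~ b) *~ z.
Proof.
move=> n0 cg cg' /(coh_isoP hp hq)[G [hG Gd Gr Gk Gf]].
have [hg gen ann] := cg; have [hg' gen' ann'] := cg'.
have [K HK] := Gd g; have [v Gv] := HK (~~ b).
pose e := Lx p q (~~ b) *+ K - l.
have [_ _ /(_ e _ _ Gv)] := hG.
rewrite (comp_id (l := e)); last exact: degZ (homogXn (homogX p q _)) hg.
have [t ht ->] := cyclic_homog cg' (deg_comp e v) => Gt.
have [c [m [t' [et _ hc]]]] := homog_mod hp hq b ht.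
have [c0|/hc em] := eqVneq c 0; last first.
  exists (K%:Z - m%:Z); rewrite mulrzBr -!pmulrn em /e; set a := _ *+ K.
  by rewrite opprD opprB [l - a]addrC !addrA addrK [RHS]addrC addKr.
(* With a zero scalar, [x_b^(n-1)] would annihilate the image and therefore the element itself,
   whose exact order is [n]. *)
rewrite c0 Sconst0 mul0r add0r in et.
have := hrelZ hG (X b ^+ n.-1) Gt.
rewrite et !scalerA mulrA -exprSr prednK // [_ * t']mulrC (cyclic_rho cg') => /Gk.
move=> /(cyclic_sat0 cg) /ann[r]; rewrite -{2}(prednK n0) exprSr mulrC => er.
have X0 : X b ^+ n.-1 != 0 by exact/S_expf_neq0/X_neq0.
have e1 : X (~~ b) ^+ K * 1 = X b ^+ 1 * r.
  apply: (S_mulfI X0); rewrite mulr1 mulrC er expr1; ring.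
have [u eu] := S_regular e1.
by have := X_nonunit b u; rewrite mulrC -[X b]expr1 -eu eqxx.
Qed.

(** Decompositions of sheaves are only ever produced through this criterion: submodules that meet in
    negligible elements and span up to powers of the variables form a coproduct of the quotient
    category. *)
Lemma indecomposable_split M (U V : M -> Prop) : indecomposable M -> hsub U -> hsub V ->
  (forall u, U u -> V u -> sat0 u) ->
  (forall u, sat (fun w => exists a b, [/\ U a, V b & w = a + b]) u) ->
  (forall u, U u -> sat0 u) \/ (forall u, V u -> sat0 u).
Proof.
move=> [_ indec] hU hV inter gen.
pose hU' := hsub_submod hU; pose hV' := hsub_submod hV.
pose A := sub_gmod hU; pose B := sub_gmod hV.
pose va (a : A) : M := sub_val (a : sub_carrier hU').
pose vb (b : B) : M := sub_val (b : sub_carrier hV').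
pose i : mor_rel A M := sub_incl (hW := hU); pose j : mor_rel B M := sub_incl (hW := hV).
have mi : is_mor i by exact: sub_incl_mor.
have mj : is_mor j by exact: sub_incl_mor.
have vaZ s a : va (s *: a) = s *: va a by exact: sub_valZ.
have vaD a a' : va (a + a') = va a + va a' by exact: sub_valD.
have vbZ s a : vb (s *: a) = s *: vb a by exact: sub_valZ.
have vbD a a' : vb (a + a') = vb a + vb a' by exact: sub_valD.
have va0 : va 0 = 0 by exact: sub_val0.
have vb0 : vb 0 = 0 by exact: sub_val0.
have vaI : injective va by exact: sub_val_inj.
have vbI : injective vb by exact: sub_val_inj.
have vac l a : va (comp l a) = comp l (va a) by exact: sub_val_comp.
have vbc l a : vb (comp l a) = comp l (vb a) by exact: sub_val_comp.
have vaP a : U (va a) by exact: (sub_valP (a : sub_carrier hU')).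
have vbP a : V (vb a) by exact: (sub_valP (a : sub_carrier hV')).
have sa a : sat0 (va a) -> sat0 a.
  by move=> [K HK]; exists K => b; apply: vaI; rewrite vaZ va0.
have sb a : sat0 (vb a) -> sat0 a.
  by move=> [K HK]; exists K => b; apply: vbI; rewrite vbZ vb0.
have gen' u : exists K, forall c, exists a b, X c ^+ K *: u = va a + vb b.
  have [K HK] := gen u; exists K => c; have [x [y [Ux Vy ->]]] := HK c.
  by exists (sub_mk hU' Ux), (sub_mk hV' Vy).
have inter' a b : va a + vb b = 0 -> sat0 a /\ sat0 b.
  move=> e; have ea : va a = - vb b by apply/eqP; rewrite -addr_eq0 e.
  have s1 : sat0 (va a).
    by apply: inter => //; rewrite ea; exact: submodN.
  split; first exact: sa.
  by apply: sb; rewrite -[vb b]opprK -ea; exact: (submodN (sat0_submod _)).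
suff : is_coprod i j.
  move=> /indec[] /(coh_zeroP hp hq) H; [left|right] => u Hu.
    by have [K HK] := H (sub_mk hU' Hu : A); exists K => b; have := congr1 va (HK b); rewrite vaZ va0.
  by have [K HK] := H (sub_mk hV' Hu : B); exists K => b; have := congr1 vb (HK b); rewrite vbZ vb0.
split=> // Z u v mu mv.
have /is_morP -/(_ hp hq)[hu ud uf] := mu; have /is_morP -/(_ hp hq)[hv vd vf] := mv.
have fu a z : sat0 a -> u a z -> sat0 z.
  move=> [K HK] ua; apply: (satX (submod_zero _) (K := K)) => b; apply: uf.
  by rewrite -(HK b); exact: hrelZ.
have fv a z : sat0 a -> v a z -> sat0 z.
  move=> [K HK] ua; apply: (satX (submod_zero _) (K := K)) => b; apply: vf.
  by rewrite -(HK b); exact: hrelZ.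
(* The mediating morphism, defined on sums. It is single-valued up to [sat0] because [U] and [V]
   meet negligibly. *)
pose w (m : M) (z : Z) := exists a b za zb,
  [/\ m = va a + vb b, z = za + zb, u a za & v b zb].
have hw : hrel w.
  split=> [|s m n m' n' [a [b [za [zb [-> -> h1 h2]]]]] [a' [b' [za' [zb' [-> -> h1' h2']]]]]|].
  - by exists 0, 0, 0, 0; rewrite va0 vb0 !addr0; case: hu; case: hv.
  - exists (s *: a + a'), (s *: b + b'), (s *: za + za'), (s *: zb + zb').
    rewrite vaD vbD vaZ vbZ !scalerDr; split; try by rewrite addrACA.
      by case: hu => _ + _; apply.
    by case: hv => _ + _; apply.
  - move=> l m n [a [b [za [zb [-> -> h1 h2]]]]].
    exists (comp l a), (comp l b), (comp l za), (comp l zb).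
    by rewrite vac vbc !compD; split=> //; [case: hu => _ _; apply|case: hv => _ _; apply].
have mw : is_mor w.
  apply/is_morP => //; split=> // [m|z [a [b [za [zb [/esym/inter'[s1 s2] -> h1 h2]]]]]].
    have hd := hsub_submod (hsub_rdom hw).
    have [K HK] := gen' m; apply: (satX hd (K := K)) => c; have [a [b ->]] := HK c.
    apply: (submodD (sat_submod hd)).
      have [K' HK'] := ud a; exists K' => e; have [z uz] := HK' e; exists z.
      exists (X e ^+ K' *: a), 0, z, 0; rewrite vb0 !addr0 vaZ; split=> //; by case: hv.
    have [K' HK'] := vd b; exists K' => e; have [z uz] := HK' e; exists z.
    exists 0, (X e ^+ K' *: b), 0, z; rewrite va0 !add0r vbZ; split=> //; by case: hu.
  by apply: (submodD (sat0_submod _)); [exact: fu s1 h1|exact: fv s2 h2].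
exists w; split=> //.
- apply/(mor_eqP hp hq (is_mor_comp hp hq mi mw) mu) => a z z'.
  move=> [m -> [a' [b [za [zb [e -> h1 h2]]]]]] h3.
  have [s1 s2] : sat0 (a' - a) /\ sat0 b.
    apply: inter'; rewrite -scaleN1r vaD vaZ scaleN1r addrAC -e; exact: subrr.
  rewrite addrAC; apply: (submodD (sat0_submod _)); last exact: fv s2 h2.
  by apply: fu s1 _; exact: hrelB.
- apply/(mor_eqP hp hq (is_mor_comp hp hq mj mw) mv) => b z z'.
  move=> [m -> [a [b' [za [zb [e -> h1 h2]]]]]] h3.
  have [s1 s2] : sat0 a /\ sat0 (b' - b).
    apply: inter'; rewrite -[b' - b]addrC -scaleN1r vbD vbZ scaleN1r addrCA -e addrC; exact: subrr.
  rewrite -addrA; apply: (submodD (sat0_submod _)); first exact: fu s1 h1.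
  by apply: fv s2 _; exact: hrelB.
move=> w' mw'.
move=> /(mor_eqP hp hq (is_mor_comp hp hq mi mw') mu) E1.
move=> /(mor_eqP hp hq (is_mor_comp hp hq mj mw') mv) E2.
apply/(mor_eqP hp hq mw' mw) => m n n' wm [a [b [za [zb [em -> h1 h2]]]]].
have /is_morP -/(_ hp hq)[hw' wd wf] := mw'.
have hd := hsub_submod (hsub_rdom hw').
have [K1 H1] := wd (va a); have [K2 H2] := wd (vb b).
pose K := maxn K1 K2; apply: (satX (submod_zero _) (K := K)) => c.
have [n1 Gn1] := sat_leq hd (leq_maxl K1 K2) H1 c.
have [n2 Gn2] := sat_leq hd (leq_maxr K1 K2) H2 c.
have s1 : sat0 (n1 - X c ^+ K *: za).
  apply: (E1 (X c ^+ K *: a)); last exact: hrelZ.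
  by exists (X c ^+ K *: va a) => //; exact/esym/vaZ.
have s2 : sat0 (n2 - X c ^+ K *: zb).
  apply: (E2 (X c ^+ K *: b)); last exact: hrelZ.
  by exists (X c ^+ K *: vb b) => //; exact/esym/vbZ.
have s3 : sat0 (X c ^+ K *: n - (n1 + n2)).
  apply: wf; have := hrelB hw' (hrelZ hw' (X c ^+ K) wm) (hrelD hw' Gn1 Gn2).
  by rewrite em scalerDr subrr.
have -> : X c ^+ K *: (n - (za + zb)) = (X c ^+ K *: n - (n1 + n2)) +
   ((n1 - X c ^+ K *: za) + (n2 - X c ^+ K *: zb)).
  by rewrite scalerBr scalerDr [n1 - _ + _]addrACA -opprD [RHS]addrA subrK.
by do 2!apply: (submodD (sat0_submod _)) => //.
Qed.

End CyclicIsomorphisms.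

(** * The twisted modules [S / rho] *)

Section StandardCyclic.
Variables (k : closedFieldType) (p q : nat).
Local Notation S := (Sring k).
Local Notation L := (Lgrp p q).

Definition principal (l : L) (rho : S) (s : free_gmod k l) := exists t : S, (s : S) = t * rho.

Lemma hsub_principal l rho (a : L) : S_homog a rho -> hsub (@principal l rho).
Proof.
move=> hr; split.
  split=> [|s u v [t et] [t' et']]; first by exists 0; rewrite mul0r.
  by exists (s * t + t'); rewrite mulrDl -mulrA -et -et'.
move=> e u [t et]; exists (comp (M := free_gmod k l) (e - a) t : S).
have -> : u = rho *: (t : free_gmod k l) by rewrite et; exact: mulrC.
by rewrite (compZ' _ _ hr) mulrC.
Qed.

Definition cyc (rho : S) (a : L) (hr : S_homog a rho) (l : L) : gmod k p q :=
  quot_gmod (hsub_principal l hr).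

Lemma cyc_cyclic rho a (hr : S_homog a rho) l : exists g : cyc hr l, cyclic rho l g.
Proof.
pose hW := hsub_submod (hsub_principal l hr).
exists (qproj hW (1 : S)); split.
- by exists (1 : S) => //; rewrite /deg /= addNr; exact: homog1.
- move=> u; have [s ->] := qproj_surj (u : quot_carrier hW); exists (s : S).
  by rewrite -[RHS](qprojZ hW); congr qproj; rewrite [RHS]mulr1.
- move=> s; rewrite -[X in X = 0](qprojZ hW).
  have -> : (s *: (1 : S^o)) = s by exact: mulr1.
  by split=> [/(qproj_eq0 hW)|H]; [|apply/(qproj_eq0 hW)].
Qed.

End StandardCyclic.

(** * Torsion-free sheaves *)

Section Families.
Variables (k : closedFieldType) (p q : nat).
Hypotheses (hp : (0 < p)%N) (hq : (0 < q)%N).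
Local Notation S := (Sring k).
Local Notation L := (Lgrp p q).
Local Notation X := (X k).
Variable M : gmod k p q.
Implicit Types (s t f : S) (l d : L) (u v : M).

Definition fspan n (w : 'I_n -> M) u := exists c : 'I_n -> S, u = \sum_i c i *: w i.
Definition indep n (w : 'I_n -> M) := forall c : 'I_n -> S,
  \sum_i c i *: w i = 0 -> forall i, c i = 0.

Lemma fspan_submod n (w : 'I_n -> M) : is_submod (fspan w).
Proof.
split=> [|s u v [c ->] [d ->]].
  by exists (fun=> 0); rewrite big1 // => i _; rewrite scale0r.
exists (fun i => s * c i + d i); rewrite scaler_sumr -big_split.
by apply: eq_bigr => i _; rewrite scalerDl scalerA.
Qed.

Lemma fspan_mem n (w : 'I_n -> M) i : fspan w (w i).
Proof.
exists (fun j => (j == i)%:R); rewrite (bigD1 i) //= eqxx scale1r big1 ?addr0 //.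
by move=> j /negPf->; rewrite scale0r.
Qed.

Lemma comp_fsum n (w : 'I_n -> M) (a : 'I_n -> L) (c : 'I_n -> S) l :
  (forall i, deg M (a i) (w i)) ->
  comp l (\sum_i c i *: w i) = \sum_i scomp (l - a i) (c i) *: w i.
Proof.
by move=> hw; rewrite comp_bigsum; apply: eq_bigr => i _; exact: comp_scale.
Qed.

Lemma hsub_fspan n (w : 'I_n -> M) (a : 'I_n -> L) :
  (forall i, deg M (a i) (w i)) -> hsub (fspan w).
Proof.
move=> hw; split=> [|l u [c ->]]; first exact: fspan_submod.
by exists (fun i => scomp (l - a i) (c i)); exact: comp_fsum.
Qed.

Lemma fspan_homog n (w : 'I_n -> M) (a : 'I_n -> L) l u :
  (forall i, deg M (a i) (w i)) -> deg M l u -> fspan w u ->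
  exists2 c : 'I_n -> S, forall i, S_homog (l - a i) (c i) & u = \sum_i c i *: w i.
Proof.
move=> hw hu [c e]; exists (fun i => scomp (l - a i) (c i)); first by move=> i; exact: homog_scomp.
by rewrite -(comp_fsum _ _ hw) -e comp_id.
Qed.

Lemma homog_generators (W : M -> Prop) : hsub W ->
  exists n (w : 'I_n -> M) (a : 'I_n -> L), [/\ forall i, deg M (a i) (w i),
    forall i, W (w i) & forall u, W u -> fspan w u].
Proof.
move=> [hW Wc]; have [gs hgs hspan] := gmod_fg hW.
pose hs := flatten [seq [seq (l, comp l g) | l <- supp g] | g <- gs].
pose x0 : L * M := (0, 0).
exists (size hs), (fun i => (nth x0 hs i).2), (fun i => (nth x0 hs i).1).
have hsP x : x \in hs -> exists g, g \in gs /\ x = (x.1, comp x.1 g).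
  by move=> /flattenP[_ /mapP[g ggs ->] /mapP[l _ ->]]; exists g.
split=> [i|i|u /hspan].
- by have [g [_ ->]] := hsP _ (mem_nth x0 (ltn_ord i)); exact: deg_comp.
- by have [g [/hgs Wg ->]] := hsP _ (mem_nth x0 (ltn_ord i)); exact: Wc.
apply; first exact: fspan_submod.
move=> g ggs; rewrite [g]comp_sum; apply: (submod_sum (fspan_submod _)) => l lg.
have hx : (l, comp l g) \in hs.
  by apply/flattenP; exists [seq (l, comp l g) | l <- supp g]; apply: map_f.
rewrite -index_mem in hx.
have := fspan_mem (fun i : 'I_(size hs) => (nth x0 hs i).2) (Ordinal hx).
by rewrite /= nth_index // -index_mem.
Qed.

Lemma big_fcons n (h : M) (v : 'I_n -> M) (c : 'I_n.+1 -> S) :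
  \sum_i c i *: (if unlift ord0 i is Some j then v j else h) =
  c ord0 *: h + \sum_j c (lift ord0 j) *: v j.
Proof.
rewrite big_ord_recl unlift_none; congr (_ + _); apply: eq_bigr => j _.
by rewrite liftK.
Qed.

(** A maximal independent subfamily together with one form [f] that clears the denominators of the
    rest; [f] is a product of homogeneous components of coefficients occurring in dependence
    relations. *)
Lemma max_indep (hs : seq (L * M)) : (forall x, x \in hs -> deg M x.1 x.2) ->
  exists r (v : 'I_r -> M) (a : 'I_r -> L) (e : L) (f : S),
    [/\ forall i, deg M (a i) (v i), indep v, S_homog e f, f != 0 &
      forall x, x \in hs -> fspan v (f *: x.2)].
Proof.
elim: hs => [|h hs IH] hhs.
  exists 0%N, (fun=> 0), (fun=> 0), 0, 1.
  by split; [case|move=> c _ []|exact: homog1|exact: oner_neq0|].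
have [|r [v [a [e [f [hv iv hf f0 Hf]]]]]] := IH.
  by move=> x xs; apply: hhs; rewrite inE xs orbT.
have hh := hhs h (mem_head _ _).
pose v' i := if unlift ord0 i is Some j then v j else h.2 : M.
pose a' i := if unlift ord0 i is Some j then a j else h.1.
have hv' i : deg M (a' i) (v' i) by rewrite /a' /v'; case: unliftP.
have [iv'|niv'] := pselect (indep v').
  exists r.+1, v', a', e, f; split=> // x; rewrite inE => /predU1P[->|/Hf[c ec]].
    apply: (submodZ _ (fspan_submod _)); have := fspan_mem v' ord0.
    by rewrite /v' unlift_none.
  exists (fun i => if unlift ord0 i is Some j then c j else 0).
  rewrite big_fcons unlift_none scale0r add0r ec.
  by apply: eq_bigr => j _; rewrite liftK.
have [c [ec [i0 ci0]]] : exists c : 'I_r.+1 -> S, \sum_i c i *: v' i = 0 /\ exists i, c i <> 0.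
  apply: contrapT => H; apply: niv' => c ec i; apply: contrapT => ci.
  by apply: H; exists c; split=> //; exists i.
(* A relation not involving the new vector would be a relation among the old, independent ones. *)
have [c0|c0] := eqVneq (c ord0) 0.
  case: ci0; move: ec; rewrite big_fcons c0 scale0r add0r => /iv H.
  by case: (unliftP ord0 i0) => [j ->|->].
have [l0 hl0] : exists l0 : L, scomp l0 (c ord0) <> 0.
  apply: contrapT => H; move/eqP: c0; apply; apply: (@scomp_eq0 k p q) => l.
  by apply: contrapT => H'; apply: H; exists l.
exists r, v, a, (l0 + e), (scomp l0 (c ord0) * f); split=> //.
- by apply: homogM => //; exact: homog_scomp.
- by apply: S_mulf_neq0 => //; exact/eqP.
move=> x; rewrite inE => /predU1P[->|/Hf]; last first.
  by rewrite -scalerA; apply: submodZ (fspan_submod _).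
rewrite mulrC -scalerA; apply: (submodZ _ (fspan_submod _)).
have := congr1 (comp (l0 + h.1)) ec; rewrite comp0 (comp_fsum _ _ hv') big_fcons.
rewrite /a' unlift_none addrK => /eqP; rewrite addr_eq0 => /eqP ->.
apply: (submodN (fspan_submod _)); apply: (submod_sum_ord (fspan_submod _)) => j.
exact/(submodZ _ (fspan_submod _))/fspan_mem.
Qed.

End Families.

(** * Freeness in depth two, and splitting off a line bundle *)

Section TorsionFreeSummand.
Variables (k : closedFieldType) (p q : nat).
Hypotheses (hp : (0 < p)%N) (hq : (0 < q)%N).
Local Notation S := (Sring k).
Local Notation L := (Lgrp p q).
Local Notation X := (X k).
Variable M : gmod k p q.
Implicit Types (s t f : S) (l d : L) (u v : M).

Lemma hsub_image (e : L) f : S_homog e f -> hsub (fun u : M => exists w, u = f *: w).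
Proof.
move=> hf; split=> [|l u [w ->]]; last by exists (comp (l - e) w); exact: compZ'.
split=> [|s u v [w ->] [w' ->]]; first by exists 0; rewrite scaler0.
by exists (s *: w + w'); rewrite scalerDr !scalerA mulrC.
Qed.

Definition depth2 (W : M -> Prop) :=
  [/\ forall s u, W u -> s *: u = 0 -> s = 0 \/ u = 0 &
      forall j u v, W u -> W v -> X false ^+ j *: u = X true *: v ->
        exists2 w, W w & u = X true *: w].

Lemma S_separated s : (forall n, exists t, s = X true ^+ n * t) -> s = 0.
Proof.
have h0 : S_homog (0 : L) (0 : S) by exact: homog0.
move=> H; have [g cg] := cyc_cyclic h0 (0 : L).
have [_ _ sep] := cyclic0_torsion_free hp hq cg; have [_ _ ann] := cg.
have : s *: g = 0.
  by apply: sep => n; have [t ->] := H n; exists (t *: g); rewrite scalerA.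
by move=> /ann[t]; rewrite mulr0.
Qed.

Lemma sum_lift n (i0 : 'I_n.+1) (F : 'I_n.+1 -> M) :
  \sum_(i | i != i0) F i = \sum_j F (lift i0 j).
Proof.
rewrite big_mkcond (bigD1_ord i0) //= eqxx add0r; apply: eq_bigr => j _.
by rewrite eq_sym neq_lift.
Qed.

(* Modulo [x_1] a homogeneous relation among minimal generators is a relation
   over [k[x_2]], which the regularity of [x_1, x_2] would turn into an expression
   of one generator by the others; so [x_1] divides all its coefficients. *)
Lemma depth2_free (W : M -> Prop) : hsub W -> depth2 W ->
  exists n (w : 'I_n -> M) (a : 'I_n -> L), [/\ forall i, deg M (a i) (w i),
    forall i, W (w i), forall u, W u -> fspan w u & indep w].
Proof.
move=> hW [Wtf Wreg]; have hW' := hsub_submod hW.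
pose gen n := `[< exists (w : 'I_n -> M) (a : 'I_n -> L), [/\ forall i, deg M (a i) (w i),
    forall i, W (w i) & forall u, W u -> fspan w u] >].
have exgen : exists n, gen n.
  by have [n [w [a H]]] := homog_generators hW; exists n; apply/asboolP; exists w, a.
case: (ex_minnP exgen) => n /asboolP[w [a [hw Ww sp]]] nmin.
exists n, w, a; split=> //.
have drop i0 (e : 'I_n -> S) : w i0 = \sum_(i | i != i0) e i *: w i -> False.
  case: n w a hw Ww sp nmin i0 e => [|n] w a hw Ww sp nmin i0 e; first by case: i0.
  move=> ew; suff /nmin : gen n by rewrite ltnn.
  apply/asboolP; exists (fun j => w (lift i0 j)), (fun j => a (lift i0 j)).
  split=> // u /sp[c ->]; rewrite (bigD1 i0) //= ew scaler_sumr -big_split /=.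
  exists (fun j => c i0 * e (lift i0 j) + c (lift i0 j)).
  by rewrite sum_lift; apply: eq_bigr => j _; rewrite scalerDl scalerA.
pose hrelation d (c : 'I_n -> S) :=
  (forall i, S_homog (d - a i) (c i)) /\ \sum_i c i *: w i = 0.
have key d c : hrelation d c -> forall i, exists t, c i = X true * t.
  move=> [hc ec].
  have /choice[z hz] : forall i, exists z : k * nat * S,
      [/\ c i = Sconst z.1.1 * X false ^+ z.1.2 + X true * z.2 &
       z.1.1 != 0 -> Lx p q false *+ z.1.2 = d - a i].
    by move=> i; have [x [m [t [e1 _ e2]]]] := homog_mod hp hq true (hc i); exists (x, m, t).
  pose x i := (z i).1.1; pose m i := (z i).1.2; pose t i := (z i).2.
  have [all0|] := pselect (forall i, x i = 0).
    move=> i; exists (t i); have [-> _] := hz i; rewrite -/(x i) all0 Sconst0 mul0r add0r //.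
  move=> /existsNP[i1 /eqP xi1]; exfalso.
  (* The least exponent of [x_2] can be factored out of the whole relation modulo [x_1], leaving a
     scalar in front of [w i0]. *)
  case: (@arg_minnP _ i1 (fun i => x i != 0) m xi1) => i0 xi0 i0min.
  pose y := \sum_i (Sconst (x i) * X false ^+ (m i - m i0)) *: w i.
  have Wy : W y by apply: (submod_sum_ord hW') => i; exact: submodZ.
  have ey : X false ^+ m i0 *: y = X true *: (\sum_i (- t i) *: w i).
    apply/eqP; rewrite -subr_eq0 -[X in _ == X]ec; apply/eqP.
    rewrite !scaler_sumr -sumrB; apply: eq_bigr => i _.
    have [-> _] := hz i; rewrite -/(x i) -/(m i) -/(t i).
    rewrite !scalerA -scalerBl mulrN opprK; congr ((_ + _) *: _).
    have [->|xi] := eqVneq (x i) 0; first by rewrite Sconst0 !(mul0r, mulr0).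
    by rewrite mulrCA -exprD subnKC // i0min.
  have [z0 Wz ez] := Wreg _ _ _ Wy (submod_sum_ord hW' (fun i => submodZ (- t i) hW' (Ww i))) ey.
  have hy : deg M (a i0) y.
    apply: (big_ind (deg M (a i0))) => [|u v|i _]; [exact: deg0|exact: degD|].
    have [xi0'|xi] := eqVneq (x i) 0; first by rewrite xi0' Sconst0 mul0r scale0r; exact: deg0.
    have [_ /(_ xi) ei] := hz i; have [_ /(_ xi0) ei0] := hz i0.
    have -> : a i0 = Lx p q false *+ (m i - m i0) + a i.
      by rewrite mulrnBr ?i0min // ei ei0 opprB [RHS]addrC addrA [a i + _]addrC subrK [RHS]addrC subrK.
    by apply: degZ => //; apply: homogCM; exact/homogXn/homogX.
  pose z' := comp (a i0 - Lx p q true) z0.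
  have ez' : y = X true *: z'.
    by rewrite -(comp_id hy) ez (compZ' _ _ (homogX p q true)).
  have Wz' : W z' by case: hW => _; apply.
  have [e he ee] := fspan_homog hw (deg_comp _ _) (sp _ Wz').
  (* Its degree is [- x_1], in which there is no nonzero form; [w i0] is thus absent from the
     expression of [z'] and can be eliminated from the generators. *)
  have e0 : e i0 = 0.
    apply: (homog_neg hp hq (b := true)).
    by have := he i0; rewrite addrAC subrr add0r.
  apply: (drop i0 (fun i => Sconst (x i0)^-1 * (X true * e i - Sconst (x i) * X false ^+ (m i - m i0)))).
  have ey' : Sconst (x i0) *: w i0 = \sum_(i | i != i0)
      (X true * e i - Sconst (x i) * X false ^+ (m i - m i0)) *: w i.
    move: ez'; rewrite (ee : z' = _) /y (bigD1 i0) //= subnn mulr1.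
    rewrite [X in _ = _ *: X](bigD1 i0) //= e0 scale0r add0r => /eqP.
    rewrite -subr_eq0 -addrA addr_eq0 opprB => /eqP->.
    rewrite scaler_sumr -sumrB; apply: eq_bigr => i _.
    by rewrite scalerBl scalerA.
  rewrite (eq_bigr (fun i => Sconst (x i0)^-1 *: ((X true * e i -
     Sconst (x i) * X false ^+ (m i - m i0)) *: w i))) => [|i _]; last by rewrite scalerA.
  by rewrite -scaler_sumr -ey' scalerA Sconst_unit // scale1r.
(* Dividing a relation by [x_1] yields another relation, so every coefficient is divisible by all
   powers of [x_1]. *)
have key2 m d c : hrelation d c -> forall i, exists t, c i = X true ^+ m * t.
  elim: m d c => [|m IH] d c hc i; first by exists (c i); rewrite mul1r.
  have /choice[t ht] := key d c hc.
  have [|t' et'] := IH (d - Lx p q true) t _ i; last first.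
    by exists t'; rewrite ht et' exprS mulrA.
  case: hc => hc ec; split=> [j|].
    have := hc j; rewrite ht => /homog_divX; by rewrite addrAC.
  have Wt : W (\sum_j t j *: w j) by apply: (submod_sum_ord hW') => j; exact: submodZ.
  have /(Wtf (X true) _ Wt)[e|//] : X true *: (\sum_j t j *: w j) = 0.
    by rewrite scaler_sumr -[RHS]ec; apply: eq_bigr => j _; rewrite scalerA ht.
  by have := X_neq0 k true; rewrite e eqxx.
move=> c ec i; apply: (@scomp_eq0 k p q) => l.
apply: S_separated => m.
have H : hrelation (l + a i) (fun j => scomp (l + a i - a j) (c j)).
  split=> [j|]; first exact: homog_scomp.
  by rewrite -(comp_fsum _ _ hw) ec comp0.
by have := key2 m _ _ H i; rewrite addrK.
Qed.

Lemma torsion_free_classification : indecomposable M ->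
  (exists l, forall (N : gmod k p q) (g : N), cyclic 0 l g -> coh_iso N M) \/
  (exists (e : L) f, [/\ S_homog e f, f != 0 & forall u : M, f *: u = 0]).
Proof.
move=> indecM.
have [n0 [w0 [a0 [hw0 _ sp0]]]] := homog_generators (hsubT M).
pose hs := [seq (a0 i, w0 i) | i <- enum 'I_n0].
have [|r [v [a [e [f [hv iv hf f0 Hf]]]]]] := max_indep (hs := hs).
  by move=> x /mapP[i _ ->]; exact: hw0.
have fsp (u : M) : fspan v (f *: u).
  have [c ->] := sp0 u I; rewrite scaler_sumr.
  apply: (submod_sum_ord (fspan_submod _)) => i.
  rewrite scalerA mulrC -scalerA; apply: (submodZ _ (fspan_submod _)).
  by apply: (Hf (a0 i, w0 i)); apply/mapP; exists i; rewrite ?mem_enum.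
have htf s u : fspan v u -> s *: u = 0 -> s = 0 \/ u = 0.
  move=> [c ->]; rewrite scaler_sumr => e0.
  have [s0|s0] := eqVneq s 0; [by left|right].
  rewrite big1 // => i _; have : s * c i = 0.
    by apply: (iv (fun i => s * c i)); rewrite -[RHS]e0; apply: eq_bigr => j _; rewrite scalerA.
  by move=> /S_mulf_eq0[e1|->]; [rewrite e1 eqxx in s0|rewrite scale0r].
pose fM (u : M) := exists w, u = f *: w.
have hfM : hsub fM by exact: hsub_image hf.
have hfM' := hsub_submod hfM.
(* Saturating [f M] inside the free module provides the depth two that [f M] itself may lack. *)
pose W u := fspan v u /\ sat fM u.
have hW : hsub W.
  have [h1 h2] := hsub_fspan hv; have [h3 h4] := hsub_sat hfM.
  by split=> [|l u [? ?]]; [exact: submodI|split; [exact: h2|exact: h4]].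
have dW : depth2 W.
  split=> [s u [Wu _]|j u u' [[c ec] su] [[c' ec'] su'] euu']; first exact: htf.
  have /choice[c'' hc''] i : exists t, c i = X true * t.
    have ei : X false ^+ j * c i = X true ^+ 1 * c' i.
      apply/eqP; rewrite -subr_eq0; apply/eqP.
      apply: (iv (fun i => X false ^+ j * c i - X true * c' i)).
      rewrite (eq_bigr (fun i => X false ^+ j *: (c i *: v i) - X true *: (c' i *: v i))) => [|i' _].
        by rewrite sumrB -!scaler_sumr -ec -ec' euu' subrr.
      by rewrite scalerBl !scalerA.
    by have [t et] := S_regular (b := true) ei; exists t.
  pose w := \sum_i c'' i *: v i.
  have fw : fspan v w by exists c''.
  have ew : u = X true *: w.
    by rewrite ec scaler_sumr; apply: eq_bigr => i _; rewrite hc'' scalerA.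
  exists w => //; split=> //.
  have ew' : X false ^+ j *: w = u'.
    have : X true *: (X false ^+ j *: w - u') = 0.
      by rewrite scalerBr scalerA mulrC -scalerA -ew euu' subrr.
    move=> /htf[|e0|/eqP]; last by rewrite subr_eq0 => /eqP.
      apply: (submodB (fspan_submod _)); first exact: (submodZ _ (fspan_submod _)).
      by exists c'.
    by have := X_neq0 k true; rewrite e0 eqxx.
  have hS := sat_submod hfM'.
  apply: (satX hfM' (K := j.+1)) => -[].
    by rewrite exprSr -scalerA -ew; exact: (submodZ _ hS).
  by rewrite exprS -scalerA ew'; exact: (submodZ _ hS).
have [n [w [b [hw Ww sp iw]]]] := depth2_free hW dW.
have WfM u : W (f *: u) by split=> //; apply: sat_sub; exists u.
(* Rank zero means that [f] annihilates [M], the torsion alternative of the conclusion. *)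
case: n w b hw Ww sp iw => [|n] w b hw Ww sp iw.
  right; exists e, f; split=> // u; have [c ->] := sp _ (WfM u).
  by rewrite big_ord0.
left; pose w1 := w ord0.
have w1tf s : s *: w1 = 0 -> s = 0.
  move=> e0; have := iw (fun i => if i == ord0 then s else 0) _ ord0.
  rewrite eqxx; apply; rewrite (bigD1 ord0) //= e0 add0r big1 // => i /negPf->.
  by rewrite scale0r.
have tfs s u : fspan w u -> s *: u = 0 -> s = 0 \/ u = 0.
  move=> [c ->]; apply: htf; apply: (submod_sum_ord (fspan_submod _)) => i.
  by apply: (submodZ _ (fspan_submod _)); case: (Ww i).
(* Lifts of [x_b ^ K *: w1] along multiplication by [f], made compatible by the
   vanishing of the second local cohomology of the torsion submodule. *)
have [K [u [eu rel]]] : exists K (u : bool -> M),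
    (forall c, f *: u c = X c ^+ K *: w1) /\ X false ^+ K *: u true = X true ^+ K *: u false.
  have [_ [K HK]] := Ww ord0; have /choice[u hu] := HK.
  have [j [c1 [c2 [c3 ej]]]] := local_cohomology2 hp hq K hf f0.
  pose t := X false ^+ K *: u true - X true ^+ K *: u false.
  have ft : f *: t = 0.
    by rewrite scalerBr !scalerA ![f * _]mulrC -!scalerA -!hu !scalerA mulrC subrr.
  (* The defect [t] is killed by [f], so [(x_1 x_2)^j t] equals [x_1^(K+j) c1 t + x_2^(K+j) c2 t];
     absorbing the two terms into the two lifts makes them compatible without changing their
     products with [f]. *)
  exists (K + j)%N, (fun c => if c then X true ^+ j *: u true - c2 *: t
                               else X false ^+ j *: u false + c1 *: t).
  split=> [[]|].
  - rewrite scalerBr !scalerA ![f * _]mulrC -!scalerA ft scaler0 subr0 -hu scalerA -exprD.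
    by rewrite addnC.
  - rewrite scalerDr !scalerA ![f * _]mulrC -!scalerA ft scaler0 addr0 -hu scalerA -exprD.
    by rewrite addnC.
  have : (X true * X false) ^+ j *: t = (X true ^+ (K + j) * c1 + X false ^+ (K + j) * c2) *: t.
    by rewrite ej scalerDl [f * _]mulrC -[in X in _ + X]scalerA ft scaler0 addr0.
  rewrite scalerDl => e1.
  have e2 : (X true * X false) ^+ j *: t = (X false ^+ (K + j) * X true ^+ j) *: u true
      - (X true ^+ (K + j) * X false ^+ j) *: u false.
    by rewrite /t scalerBr !scalerA; congr (_ *: _ - _ *: _); rewrite exprMn exprD; ring.
  have /eqP := etrans (esym e2) e1; rewrite subr_eq => /eqP eA.
  move: t {e1 e2} ft eA => t _ eA.
  by rewrite scalerBr scalerDr !scalerA eA [Y in Y - _]addrAC addrK addrC.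
have {eu rel} [u' [eu rel hu]] : exists u : bool -> M, [/\ forall c, f *: u c = X c ^+ K *: w1,
    X false ^+ K *: u true = X true ^+ K *: u false &
    forall c, deg M (Lx p q c *+ K + (b ord0 - e)) (u c)].
  exists (fun c => comp (Lx p q c *+ K + (b ord0 - e)) (u c)).
  have hX c : S_homog (Lx p q c *+ K) (X c ^+ K) by exact/homogXn/homogX.
  split=> [c||c]; last exact: deg_comp.
    rewrite -(compZ _ _ hf) eu.
    have -> : e + (Lx p q c *+ K + (b ord0 - e)) = Lx p q c *+ K + b ord0.
      by rewrite addrA [e + _]addrC -addrA subrKC.
    by rewrite comp_id //; apply: degZ.
  by rewrite -(compZ _ _ (hX false)) -(compZ _ _ (hX true)) rel addrCA.
clear u; rename u' into u.
(* [U] stands for the line bundle generated by the quotient of [w1] by [f], of which only the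
   multiples by [x_1^K] and [x_2^K] are available in [M]; [V] is the preimage of the span of the
   other basis elements. *)
pose U (x : M) := exists s t, x = s *: u true + t *: u false.
pose V (x : M) := fspan (fun i => w (lift ord0 i)) (f *: x).
have fU s t : f *: (s *: u true + t *: u false) = (s * X true ^+ K + t * X false ^+ K) *: w1.
  by rewrite scalerDr !scalerA ![f * _]mulrC -!scalerA !eu !scalerA -scalerDl.
have relU s t : s * X true ^+ K + t * X false ^+ K = 0 -> s *: u true + t *: u false = 0.
  move=> est; have [|s' es] := S_regular (k := k) (b := false) (K := K) (K' := K) (s := s) (t := - t).
    by apply/eqP; rewrite -subr_eq0 mulrN opprK mulrC [X in _ + X]mulrC est.
  have et : t = - (X true ^+ K * s').
    apply: (S_mulfI (S_expf_neq0 K (X_neq0 k false))); apply/eqP.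
    by rewrite -subr_eq0 mulrN opprK -est es; apply/eqP; ring.
  by rewrite es et scaleNr ![X _ ^+ K * s']mulrC -!scalerA rel subrr.
have hU : hsub U.
  split=> [|l x [s [t ->]]]; last first.
    rewrite compD !(comp_scale _ _ (hu _)); by do 2!eexists.
  split=> [|s x y [s1 [t1 ->]] [s2 [t2 ->]]]; first by exists 0, 0; rewrite !scale0r addr0.
  exists (s * s1 + s2), (s * t1 + t2).
  by rewrite scalerDr !scalerDl !scalerA addrACA.
have hV : hsub V.
  have [h1 h2] := hsub_fspan (fun i => hw (lift ord0 i)).
  split=> [|l x Vx]; last by rewrite /V -(compZ _ _ hf); exact: h2.
  split=> [|s x y Vx Vy]; first by rewrite /V scaler0; exact: submod0 h1.
  by rewrite /V scalerDr scalerA mulrC -scalerA; case: h1 => _; apply.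
have inter x : U x -> V x -> sat0 x.
  move=> [s [t ->]] [c]; rewrite fU => ec; apply: sat_sub; apply: relU.
  have := iw (fun i => if unlift ord0 i is Some j then - c j else s * X true ^+ K + t * X false ^+ K) _ ord0.
  rewrite unlift_none; apply; rewrite big_ord_recl unlift_none -/w1 ec -big_split big1 //= => i _.
  by rewrite liftK scaleNr subrr.
have gen x : sat (fun y => exists a b, [/\ U a, V b & y = a + b]) x.
  have [c ec] := sp _ (WfM x); rewrite big_ord_recl in ec.
  exists K => d; exists (c ord0 *: u d), (X d ^+ K *: x - c ord0 *: u d); split.
  - by case: d; [exists (c ord0), 0|exists 0, (c ord0)]; rewrite scale0r ?addr0 ?add0r.
  - exists (fun i => X d ^+ K * c (lift ord0 i)).
    rewrite scalerBr !scalerA ![f * _]mulrC -!scalerA ec eu scalerDr addrAC.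
    rewrite !scalerA mulrC subrr add0r scaler_sumr; apply: eq_bigr => i _.
    by rewrite scalerA.
  - by rewrite addrC subrK.
have [H|H] := indecomposable_split hp hq indecM hU hV inter gen.
  have [K' HK'] : sat0 (u true) by apply: H; exists 1, 0; rewrite scale1r scale0r addr0.
  have := congr1 (fun x => f *: x) (HK' true); rewrite scaler0 scalerA mulrC -scalerA eu scalerA -exprD.
  by move=> /w1tf e1; have := S_expf_neq0 (K' + K) (X_neq0 k true); rewrite e1 eqxx.
(* The quotient of [w1] by [f] has degree [b ord0 - e], and a generator of [O(l)] sits in degree
   [- l]. *)
exists (e - b ord0) => N g cg; apply/(coh_isoP hp hq).
have [hg gg ann] := cg; have ann0 s : s *: g = 0 -> s = 0 by move=> /ann[t]; rewrite mulr0.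
pose G (x : N) (y : M) := exists s t,
  x = (s * X true ^+ K + t * X false ^+ K) *: g /\ y = s *: u true + t *: u false.
have hG : hrel G.
  split=> [|s m x m' x' [s1 [t1 [-> ->]]] [s2 [t2 [-> ->]]]|l m x [s [t [-> ->]]]].
  - by exists 0, 0; rewrite !mul0r addr0 !scale0r addr0.
  - exists (s * s1 + s2), (s * t1 + t2).
    split; last by rewrite scalerDr !scalerDl !scalerA addrACA.
    by rewrite scalerA -scalerDl; congr (_ *: _); ring.
  exists (scomp (l - (Lx p q true *+ K + (b ord0 - e))) s),
     (scomp (l - (Lx p q false *+ K + (b ord0 - e))) t).
  split; last by rewrite compD !(comp_scale _ _ (hu _)).
  have hX c : S_homog (Lx p q c *+ K) (X c ^+ K) by exact/homogXn/homogX.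
  have ee c : l - - (e - b ord0) = l - (Lx p q c *+ K + (b ord0 - e)) + Lx p q c *+ K.
    by rewrite opprK opprD opprB [- (_ *+ _) + _]addrC -[RHS]addrA subrK.
  have scompD d s1 s2 : scomp d (s1 + s2) = scomp d s1 + scomp d s2.
    exact: (compD (M := free_gmod k (0 : L))).
  rewrite (comp_scale _ _ hg) scompD -!(scompM _ _ (hX _)).
  by rewrite -(ee true) -(ee false).
exists G; split=> // [m|x|m [s [t [-> est]]]|x [s [t [est ->]]]].
- have [s ->] := gg m; exists K => -[].
    by exists (s *: u true), s, 0; rewrite mul0r scale0r !addr0 scalerA mulrC.
  by exists (s *: u false), 0, s; rewrite mul0r scale0r !add0r scalerA mulrC.
- have hR := hsub_submod (hsub_rrng hG).
  have UR y : U y -> rrng G y by move=> [s [t ->]]; eexists; exists s, t; split.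
  have [K' HK'] := gen x; apply: (satX hR (K := K')) => d.
  have [y [z [Uy Vz ->]]] := HK' d; apply: (submodD (sat_submod hR)).
    exact/sat_sub/UR.
  exact/(sat0_sat hR)/H.
- apply: sat_sub; have : f *: (s *: u true + t *: u false) = 0 by rewrite -est scaler0.
  by rewrite fU => /w1tf ->; rewrite scale0r.
- by apply: sat_sub; apply: relU; apply: ann0.
Qed.

End TorsionFreeSummand.

(** * Torsion sheaves *)

Section TorsionSummand.
Variables (k : closedFieldType) (p q : nat).
Hypotheses (hp : (0 < p)%N) (hq : (0 < q)%N).
Local Notation S := (Sring k).
Local Notation L := (Lgrp p q).
Local Notation X := (X k).
Local Notation pt := (@point_prime k p q).
Variable M : gmod k p q.
Implicit Types (s t f g h : S) (l d : L) (u v : M).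

Lemma max_disjoint (Z : M -> Prop) : exists V : M -> Prop,
  [/\ hsub V, forall u, V u -> Z u -> sat0 u &
    forall V' : M -> Prop, hsub V' -> (forall u, V u -> V' u) ->
      (forall u, V' u -> Z u -> sat0 u) -> forall u, V' u -> V u].
Proof.
(* The union of an empty chain is empty, hence not a submodule; asking the property of nonempty sets
   only makes Zorn's lemma applicable. *)
pose P (V : set M) := (exists x, V x) -> hsub V /\ forall u, V u -> Z u -> sat0 u.
have [|V [PV Vmax]] := @Zorn_bigcup M P.
  move=> F FP tot [x [A FA Ax]].
  have hF B : F B -> forall y, B y -> hsub B /\ forall u, B u -> Z u -> sat0 u.
    by move=> FB y By; apply: (FP _ FB); exists y.
  split; last by move=> u [B FB Bu]; case: (hF B FB _ Bu) => _; apply.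
  split; last by move=> l u [B FB Bu]; exists B => //; case: (hF B FB _ Bu) => -[_ h] _; exact: h.
  split=> [|s u v [B FB Bu] [C FC Cv]].
    by exists A => //; case: (hF A FA _ Ax) => -[h _] _; exact: submod0 h.
  have [[hB _] _] := hF B FB _ Bu; have [[hC _] _] := hF C FC _ Cv.
  have [sub|sub] := tot _ _ FB FC.
    by exists C => //; case: hC => _; apply => //; exact: sub.
  by exists B => //; case: hB => _; apply => //; exact: sub.
have [x Vx] : exists x, V x.
  apply: contrapT => /forallNP nV; apply: (Vmax (fun u : M => u = 0)).
    by split=> [u Vu|H]; [case: (nV _ Vu)|apply: (nV 0); exact: H].
  by move=> _; split=> [|u -> _]; [exact: hsub_zero|exact: sat_sub].
have [hV dV] := PV (ex_intro _ x Vx).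
exists V; split=> // V' hV' sub dV' u V'u; apply: contrapT => nVu.
by apply: (Vmax V') => //; split=> // H; apply: nVu; exact: H.
Qed.

Hypothesis indecM : indecomposable M.

Definition kills f := forall u, sat0 (f *: u).

Lemma nonzero : ~ (forall u, sat0 u).
Proof. by move=> H; case: indecM => nz _; apply: nz; exact/coh_zeroP. Qed.

(** Elements common to [g M] and [h M] are killed by both forms up to powers, and comaximality makes
    the sum of the two submodules everything; so one of them is negligible. *)
Lemma kills_comax (a b : L) g h : S_homog a g -> S_homog b h -> comax g h ->
  kills (g * h) -> kills g \/ kills h.
Proof.
move=> hg hh cgh kgh.
have s0 : is_submod (@sat0 k M) := sat0_submod M.
have := indecomposable_split hp hq indecM (hsub_image M hg) (hsub_image M hh).
case=> [u [w ew] [w' ew']|u|H|H].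
- apply: (sat_idem (submod_zero M)); apply: (sat_comax s0 cgh).
    by rewrite ew' scalerA.
  by rewrite ew scalerA mulrC.
- have [K HK] := cgh; exists K => c; have [s [t ->]] := HK c.
  exists (g *: (s *: u)), (h *: (t *: u)); split; [by eexists|by eexists|].
  by rewrite scalerDl !scalerA [g * s]mulrC [h * t]mulrC.
- by left=> u; apply: H; exists u.
- by right=> u; apply: H; exists u.
Qed.

(** Separating the copies of one point from the other points gives two comaximal factors, one of
    which already kills [M]: either a pure power or a shorter product. *)
Lemma kills_pt (ls : seq (option k)) : kills (\prod_(lam <- ls) pt lam) ->
  exists lam n, kills (pt lam ^+ n).
Proof.
have [n] := ubnP (size ls); elim: n ls => // n IH [|lam ls] /= sls.
  by rewrite big_nil => H; case: nonzero => u; have := H u; rewrite scale1r.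
have e : \prod_(mu <- lam :: ls) pt mu =
    pt lam ^+ (count_mem lam (lam :: ls)) * \prod_(mu <- [seq mu <- ls | mu != lam]) pt mu.
  rewrite (bigID (pred1 lam)) /=; congr (_ * _); last first.
    by rewrite -big_filter /= eqxx.
  rewrite (eq_bigr (fun=> pt lam)) => [|mu /eqP->//].
  by rewrite big_const_seq -Monoid.iteropE.
have homog_prod (ms : seq (option k)) : exists a : L, S_homog a (\prod_(mu <- ms) pt mu).
  apply: (big_ind (fun s => exists a : L, S_homog a s)).
  - by exists 0; exact: homog1.
  - by move=> x y [a ha] [b hb]; exists (a + b); exact: homogM.
  - by move=> mu _; exists (pdeg p q mu); exact: homog_pt.
have [a ha] := homog_prod [seq mu <- ls | mu != lam].
rewrite e => /(kills_comax (homogXn (homog_pt lam)) ha)[|H|/IH].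
- apply/comaxC/comaxXn/comaxC.
  rewrite big_seq; apply: big_ind => [|x y|mu]; [exact: comax1|exact: comaxM|].
  by rewrite mem_filter eq_sym => /andP[/(comax_pt hp hq)].
- by exists lam, (count_mem lam (lam :: ls)).
by apply; rewrite size_filter; exact: leq_ltn_trans (count_size _ _) sls.
Qed.

Lemma hsub_cyclic d (m : M) : deg M d m -> hsub (fun u => exists s, u = s *: m).
Proof.
move=> hm; split=> [|l u [s ->]]; last by exists (scomp (l - d) s); exact: comp_scale.
split=> [|s u v [t ->] [t' ->]]; first by exists 0; rewrite scale0r.
by exists (s * t + t'); rewrite scalerDl scalerA.
Qed.

Lemma hsubD (U V : M -> Prop) : hsub U -> hsub V ->
  hsub (fun u => exists a b, [/\ U a, V b & u = a + b]).
Proof.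
move=> [hU Uc] [hV Vc]; split=> [|l u [a [b [Ua Vb ->]]]].
  split=> [|s u v [a [b [Ua Vb ->]]] [a' [b' [Ua' Vb' ->]]]].
    by exists 0, 0; split; [exact: submod0 hU|exact: submod0 hV|rewrite addr0].
  exists (s *: a + a'), (s *: b + b'); split; [by case: hU => _; apply|by case: hV => _; apply|].
  by rewrite scalerDr addrACA.
by exists (comp l a), (comp l b); split; [exact: Uc|exact: Vc|rewrite compD].
Qed.

Lemma torsion_classification (e : L) f : S_homog e f -> f != 0 -> kills f ->
  exists lam n l, (0 < n)%N /\ forall (N : gmod k p q) (g : N),
    cyclic (pt lam ^+ n) l g -> coh_iso N M.
Proof.
move=> hf f0 kf.
have [lam exn] : exists lam, exists n, `[< kills (pt lam ^+ n) >].
  have [c [ls [c0 ef]]] := homog_factored hp hq hf f0.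
  have [|lam [n H]] := @kills_pt ls; last by exists lam, n; exact/asboolP.
  move=> u; have := submodZ (Sconst c^-1) (sat0_submod M) (kf u).
  by rewrite ef scalerA mulrA Sconst_unit // mul1r.
case: (ex_minnP exn) => n /asboolP kn nmin.
(* From here on the minimal exponent is [n.+1], so some homogeneous element survives [P ^+ n]. *)
case: n kn nmin => [|n] kn nmin; first by case: nonzero => u; have := kn u; rewrite scale1r.
pose Z0 := @sat0 k M; have hZ0 : hsub Z0 := hsub_sat0 M; have hZ0' := hsub_submod hZ0.
have sat_Z0 u : sat Z0 u -> Z0 u by exact: (sat_idem (submod_zero M)).
set P := pt lam in exn kn nmin.
have [d [m [hm nm]]] : exists d (m : M), deg M d m /\ ~ Z0 (P ^+ n *: m).
  apply: contrapT => H; have /nmin : `[< kills (P ^+ n) >]; last by rewrite ltnn.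
  apply/asboolP => u; rewrite [u]comp_sum scaler_sumr.
  apply: (submod_sum hZ0') => l _; apply: contrapT => H'.
  by apply: H; exists l, (comp l u); split=> //; exact: deg_comp.
(* A form prime to the point that kills [P^n m] would, together with [P], make [P^n m]
   negligible. *)
have F3 (a : L) s : S_homog a s -> Z0 (s *: (P ^+ n *: m)) -> exists t, s = t * P.
  move=> hs sm; have [->|s0] := eqVneq s 0; first by exists 0; rewrite mul0r.
  have [//|cps] := pt_coprime hp hq lam hs s0; case: nm; apply: sat_Z0.
  apply: (sat_comax hZ0' cps) => //; rewrite scalerA -exprS; exact: kn.
pose C (u : M) := exists s, u = s *: m.
have hC : hsub C := hsub_cyclic hm.
have [V [hV VC Vmax]] := max_disjoint C.
have hV' := hsub_submod hV.
pose VC' (u : M) := exists a b, [/\ C a, V b & u = a + b].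
have hVC : hsub VC' := hsubD hC hV; have hVC' := hsub_submod hVC.
have hsVC := hsub_sat hVC; have hsVC' := hsub_submod hsVC.
have VVC u : V u -> VC' u by move=> Vu; exists 0, u; split=> //; [exact: submod0 (hsub_submod hC)|rewrite add0r].
have CVC u : C u -> VC' u by move=> Cu; exists u, 0; split=> //; [exact: submod0 hV'|rewrite addr0].
(* Otherwise some homogeneous [u2] is outside the saturation of [C + V] although [P u2] is in
   [C + V]; [V] can then be enlarged. *)
have gen : forall u, sat VC' u.
  apply: contrapT => /existsNP[u nu].
  have [d1 [u1 [hu1 nu1]]] : exists d u, deg M d u /\ ~ sat VC' u.
    apply: contrapT => H; apply: nu; rewrite [u]comp_sum; apply: (submod_sum hsVC') => l _.
    by apply: contrapT => H'; apply: H; exists l, (comp l u); split=> //; exact: deg_comp.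
  have [j nj sj] : exists2 j, ~ sat VC' (P ^+ j *: u1) & sat VC' (P ^+ j.+1 *: u1).
    have exj : exists j, `[< sat VC' (P ^+ j *: u1) >].
      by exists n.+1; apply/asboolP; exact: (sat0_sat hVC').
    case: (ex_minnP exj) => j /asboolP sj jmin.
    case: j sj jmin => [|j] sj jmin; first by rewrite scale1r in sj.
    exists j => // H; by have := jmin j (asboolT H); rewrite ltnn.
  have [K HK] := sj.
  have [b nb] : exists b, ~ sat VC' (X b ^+ K *: (P ^+ j *: u1)).
    apply: contrapT => H; apply: nj; apply: (satX hVC' (K := K)) => b.
    by apply: contrapT => H'; apply: H; exists b.
  pose u2 := X b ^+ K *: (P ^+ j *: u1).
  have [d2 hu2] : exists d2, deg M d2 u2.
    exists (Lx p q b *+ K + (pdeg p q lam *+ j + d1)).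
    apply: degZ; first exact/homogXn/homogX.
    by apply: degZ => //; exact/homogXn/homog_pt.
  have Pu2 : VC' (P *: u2).
    have -> : P *: u2 = X b ^+ K *: (P ^+ j.+1 *: u1).
      by rewrite /u2 !scalerA exprS; congr (_ *: _); ring.
    exact: HK.
  have [s hs [v Vv ePu]] : exists2 s, exists a : L, S_homog a s & exists2 v, V v & P *: u2 = s *: m + v.
    have [_ [v [[s ->] Vv eP]]] := Pu2.
    have hPu : deg M (pdeg p q lam + d2) (P *: u2) by apply: degZ => //; exact: homog_pt.
    exists (scomp (pdeg p q lam + d2 - d) s); first by eexists; exact: homog_scomp.
    exists (comp (pdeg p q lam + d2) v); first by case: hV => _; apply.
    by rewrite -(comp_id hPu) eP compD (comp_scale _ _ hm).
  have [a ha] := hs.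
  (* [P^n] times [P u2] is negligible, so [s P^n m] lies, up to powers, both in [C] and in [V];
     being negligible, it lets [F3] divide [s] by [P]. *)
  have [s' es'] : exists s', s = s' * P.
    apply: F3 ha _; apply: sat_Z0.
    have e1 : s *: (P ^+ n *: m) + P ^+ n *: v = P ^+ n.+1 *: u2.
      by rewrite exprSr -scalerA ePu scalerDr !scalerA mulrC.
    have [K' HK'] := kn u2; exists K' => c; apply: VC; last first.
      by exists (X c ^+ K' * (s * P ^+ n)); rewrite !scalerA mulrA.
    have -> : X c ^+ K' *: (s *: (P ^+ n *: m)) = - (X c ^+ K' *: (P ^+ n *: v)).
      by apply/eqP; rewrite -addr_eq0 -scalerDr e1 HK'.
    by apply: (submodN hV'); do 2!apply: (submodZ _ hV').
  have {}s'hom : S_homog (a - pdeg p q lam) s'.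
    apply: homog_divr (homog_pt lam) _; first exact: pt_neq0.
    by rewrite -es'.
  (* Subtracting a multiple of [m] makes [P *: u2] fall into [V]; enlarging [V]
     by the difference contradicts its maximality. *)
  pose s'' := scomp (d2 - d) s'; pose u3 := u2 - s'' *: m.
  have e3 : u3 = comp d2 (u2 - s' *: m) by rewrite compB (comp_id hu2) (comp_scale _ _ hm).
  have hu3 : deg M d2 u3 by rewrite e3; exact: deg_comp.
  have Pu3 : V (P *: u3).
    rewrite e3 -(compZ _ _ (homog_pt lam)); case: (hV) => _; apply.
    by rewrite scalerBr ePu es' scalerA [P * s']mulrC addrAC subrr add0r.
  have nu3 : ~ sat VC' u3.
    move=> H; apply: nb; rewrite -/u2 -[u2](subrK (s'' *: m)).
    by apply: (submodD hsVC') => //; apply/sat_sub/CVC; eexists.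
  have hV3 := hsubD (hsub_cyclic hu3) hV.
  have V3C : forall y, (exists a b, [/\ exists s, a = s *: u3, V b & y = a + b]) -> C y -> sat0 y.
    have hI : hsub (fun y => (exists a b, [/\ exists s, a = s *: u3, V b & y = a + b]) /\ C y).
      by case: hV3 => h1 h2; case: hC => h3 h4; split=> [|l y [? ?]]; [exact: submodI|split; [exact: h2|exact: h4]].
    suff H : forall y, (exists a b, [/\ exists s, a = s *: u3, V b & y = a + b]) /\ C y -> sat0 y.
      by move=> y h1 h2; exact: H.
    apply: (hsub_ind hI hZ0') => l y hy [[_ [v1 [[c0 ->] Vv1 ey]]] Cy].
    pose c := scomp (l - d2) c0.
    have {}ey : y = c *: u3 + comp l v1 by rewrite -(comp_id hy) ey compD (comp_scale _ _ hu3).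
    have Vv1' : V (comp l v1) by case: (hV) => _; apply.
    (* If [P] divides [c], then [c u3] is in [V]. Otherwise both [c] and [P] carry [u3] into
       [C + V], which would put [u3] in its saturation. *)
    have [[t ec]|cP] : (exists t, c = t * P) \/ comax P c.
    - have [->|c0'] := eqVneq c 0; first by left; exists 0; rewrite mul0r.
      exact: (pt_coprime hp hq lam (homog_scomp (a := l - d2) (s := c0)) c0').
    - apply: (VC _ _ Cy); rewrite ey ec -scalerA; apply: (submodD hV') => //.
      exact: (submodZ _ hV').
    case: nu3; apply: (sat_comax hVC' cP); first exact: VVC.
    have -> : c *: u3 = y - comp l v1 by rewrite ey addrK.
    by apply: (submodB hVC'); [exact: CVC|exact: VVC].
  apply: nu3; apply/sat_sub/VVC; apply: (Vmax _ hV3 _ V3C).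
    by move=> u' Vu'; exists 0, u'; split=> //; [exists 0; rewrite scale0r|rewrite add0r].
  by exists u3, 0; split; [exists 1; rewrite scale1r|exact: submod0 hV'|rewrite addr0].
have inter u : C u -> V u -> sat0 u by move=> h1 h2; exact: VC.
have [H|H] := indecomposable_split hp hq indecM hC hV inter gen.
  case: nm; apply: (submodZ _ hZ0'); apply: H; by exists 1; rewrite scale1r.
exists lam, n.+1, (- d); split=> // N g cg; apply/(coh_isoP hp hq).
have [hg gg ann] := cg; rewrite opprK in hg.
pose G (x : N) (y : M) := exists2 s, x = s *: g & y = s *: m.
have hG : hrel G.
  split=> [|s x y x' y' [t -> ->] [t' -> ->]|l x y [s -> ->]].
  - by exists 0; rewrite scale0r.
  - by exists (s * t + t'); rewrite scalerDl scalerA.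
  - by exists (scomp (l - d) s); exact: comp_scale.
exists G; split=> // [x|y|x|y [s es ->]].
- by have [s ->] := gg x; apply: sat_sub; exists (s *: m); exists s.
- have hR := hsub_submod (hsub_rrng hG); apply: (sat_idem hR); apply: sat_mono (gen y) => z.
  move=> [a [b [[s ->] /H Vb ->]]]; apply: (submodD (sat_submod hR)); last exact: (sat0_sat hR).
  by apply: sat_sub; exists (s *: g); exists s.
(* A homogeneous kernel element is a form times [g]. If the form had order [a] at most [n] at the
   point, multiplying by [P^(n-a)] would contradict [F3]. *)
- apply: (hsub_ind (hsub_rker hG) (sat0_submod N)) => z {x} x hx Gx.
  have [s hs es] := cyclic_homog cg hx.
  have [t et e0] := Gx; have /eqP : s *: g = t *: g by rewrite -es.
  rewrite -subr_eq0 -scalerBl => /eqP /ann [r er].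
  have sm : Z0 (s *: m).
    rewrite -[s](subrK t) er scalerDl -e0 addr0 -scalerA.
    by apply: (submodZ _ hZ0'); exact: kn.
  have [s0|s0] := eqVneq s 0; first by rewrite es s0 scale0r; exact: submod0 (sat0_submod _).
  have [[t' et']|[a [h [an eh nd]]]] := pt_valuation p q lam n.+1 s0.
    by apply: sat_sub; rewrite es; apply/ann; exists t'.
  exfalso; have hh : S_homog (z - d - pdeg p q lam *+ a) h.
    by apply: (pt_homog_pow hq); rewrite -eh.
  have [t' et'] : exists t', h = t' * P.
    apply: (F3 _ _ hh); have -> : h *: (P ^+ n *: m) = P ^+ (n - a) *: (s *: m).
      by rewrite eh !scalerA; congr (_ *: _); rewrite mulrCA -exprD subnK.
    exact: (submodZ _ hZ0').
  by have := nd t'; rewrite et' eqxx.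
- have [t ->] := (ann s).1 (esym es); rewrite -scalerA.
  by apply: (submodZ _ hZ0'); exact: kn.
Qed.

End TorsionSummand.

(** * Homotopy classes of curves *)

Section Topology.
Variable R : realType.
Local Open Scope classical_set_scope.

Lemma within_comp (X Y Z : topologicalType) (A : set Y) (f : Y -> Z) (c : X -> Y) :
  {within A, continuous f} -> continuous c -> (forall x, A (c x)) -> continuous (f \o c).
Proof.
move=> /subspace_continuousP hf hc hA x U hU.
have /hc h : nbhs (c x) [set y | A y -> U (f y)] by exact: (hf _ (hA x) _ hU).
exact: (@filterS _ (nbhs x) _ (c @^-1` [set y | A y -> U (f y)]) _ (fun y H => H (hA y)) h).
Qed.

Lemma compact_unif (X Y : pseudoMetricType R) (K : set X) (g : X -> Y) (e : R) :
  compact K -> continuous g -> 0 < e ->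
  exists2 d, 0 < d & forall u v, K u -> ball u d v -> ball (g u) e (g v).
Proof.
move=> /compact_near_coveringP cK cg e0.
have e20 : 0 < e / 2 by rewrite divr_gt0.
pose P (d : R) (x : X) := forall v, ball x d v -> ball (g x) e (g v).
have H : \forall d \near (0 : R)^'+, K `<=` P d.
  apply: cK => x Kx.
  have /nbhs_ballP[n /= n0 hn] : nbhs x (g @^-1` ball (g x) (e / 2)).
    by apply: cg; exact: nbhsx_ballx.
  have n20 : 0 < n / 2 by rewrite divr_gt0.
  exists (ball x (n / 2), [set d : R | d < n / 2]).
    split; first exact: nbhsx_ballx.
    exact: nbhs_right_lt.
  move=> [y d] /= [xy dn] v yv; rewrite [e]splitr; apply: (ball_triangle (y := g x)).
    apply: ball_sym; apply: hn; apply: le_ball xy; rewrite ler_pdivrMr //.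
    by rewrite ler_pMr // ler1n.
  apply: hn; rewrite [n]splitr; apply: ball_triangle xy _.
  by apply: le_ball yv; exact: ltW.
have [d [d0 hd]] : exists d, 0 < d /\ K `<=` P d.
  have : nbhs ((0 : R)^'+) ([set y | 0 < y] `&` [set d | K `<=` P d]).
    by apply: filterI => //; exact: nbhs_right_gt.
  by move=> /filter_ex[d [? ?]]; exists d.
by exists d => // u v Ku uv; exact: hd uv.
Qed.

(** Curves are controlled only on the unit interval; composing with this retraction gives maps
    continuous on all of [R]. *)
Definition clamp (t : R) : R := Num.min 1 (Num.max 0 t).

Lemma clamp_continuous : continuous clamp.
Proof.
move=> x; apply: continuous_min; first exact: cst_continuous.
by apply: continuous_max; [exact: cst_continuous|exact: cvg_id].
Qed.

Lemma clamp_itv t : 0 <= clamp t <= 1.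
Proof.
by rewrite /clamp le_min ler01 le_max lexx ge_min lexx.
Qed.

Lemma clamp_id t : 0 <= t <= 1 -> clamp t = t.
Proof.
by move=> /andP[t0 t1]; rewrite /clamp (max_idPr t0) (min_idPr t1).
Qed.

Lemma clamp0 t : t <= 0 -> clamp t = 0.
Proof. by move=> t0; rewrite /clamp (max_idPl t0) (min_idPr ler01). Qed.

Lemma clamp1 t : 1 <= t -> clamp t = 1.
Proof.
by move=> t1; rewrite /clamp (max_idPr (le_trans ler01 t1)) (min_idPl t1).
Qed.

Definition cross (z w : R * R) := z.1 * w.2 - z.2 * w.1.
Definition dot (z w : R * R) := z.1 * w.1 + z.2 * w.2.
(** The oriented angle from [z] to [w], correct when it is acute, that is, when [dot z w] is
    positive. *)
Definition ang (z w : R * R) := atan (cross z w / dot z w).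

Lemma ang_rot z w : 0 < dot z w -> exists2 r, 0 < r &
  w = (r * (z.1 * cos (ang z w) - z.2 * sin (ang z w)),
       r * (z.1 * sin (ang z w) + z.2 * cos (ang z w))).
Proof.
move=> d0; set al := ang z w.
have c0 : 0 < cos al by rewrite cos_gt0_pihalf // atan_gtNpi2 atan_ltpi2.
have es : sin al = cross z w / dot z w * cos al.
  rewrite -(atanK (cross z w / dot z w)) -/(ang z w) -/al /tan divfK //; exact: lt0r_neq0.
have nz : 0 < z.1 ^+ 2 + z.2 ^+ 2.
  rewrite lt0r addr_ge0 ?sqr_ge0 // andbT; apply/eqP => e.
  have z1 : z.1 = 0 by apply/eqP; rewrite -sqrf_eq0; apply/eqP; have := sqr_ge0 z.1; have := sqr_ge0 z.2; lra.
  have z2 : z.2 = 0 by apply/eqP; rewrite -sqrf_eq0; apply/eqP; have := sqr_ge0 z.1; have := sqr_ge0 z.2; lra.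
  by move: d0; rewrite /dot z1 z2 !mul0r addr0 ltxx.
exists (dot z w / ((z.1 ^+ 2 + z.2 ^+ 2) * cos al)); first by rewrite divr_gt0 // mulr_gt0.
have h1 := lt0r_neq0 d0; have h2 := lt0r_neq0 nz; have h3 := lt0r_neq0 c0.
rewrite es [LHS]surjective_pairing; move: h1; rewrite /cross /dot => h1.
by congr pair; field; rewrite h1 h2 h3.
Qed.

(** The angle swept along [g], measured on a grid that has to be fine enough for each step to be
    acute. *)
Definition winding N (g : R -> R * R) : R :=
  \sum_(i < N) ang (g (i%:R / N%:R)) (g (i.+1%:R / N%:R)).

Lemma winding_rot N (g : R -> R * R) : (0 < N)%N ->
  (forall i, (i < N)%N -> 0 < dot (g (i%:R / N%:R)) (g (i.+1%:R / N%:R))) ->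
  exists2 r, 0 < r & g 1 = (r * ((g 0).1 * cos (winding N g) - (g 0).2 * sin (winding N g)),
       r * ((g 0).1 * sin (winding N g) + (g 0).2 * cos (winding N g))).
Proof.
move=> N0 H; pose A m := \sum_(i < m) ang (g (i%:R / N%:R)) (g (i.+1%:R / N%:R)).
suff : forall m, (m <= N)%N -> exists2 r, 0 < r &
    g (m%:R / N%:R) = (r * ((g 0).1 * cos (A m) - (g 0).2 * sin (A m)),
       r * ((g 0).1 * sin (A m) + (g 0).2 * cos (A m))).
  by move=> /(_ N (leqnn _)); rewrite divff ?pnatr_eq0 -?lt0n.
elim=> [|m IH] mN.
  exists 1; rewrite // /A big_ord0 cos0 sin0 mul0r !mulr1 !mulr0 subr0 add0r !mul1r.
  exact: surjective_pairing.
have [r r0 e] := IH (ltnW mN); have [r' r'0 ->] := ang_rot (H m mN).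
exists (r * r'); first exact: mulr_gt0.
have -> : A m.+1 = A m + ang (g (m%:R / N%:R)) (g (m.+1%:R / N%:R)).
  by rewrite /A big_ord_recr.
rewrite cosD sinD; move: (ang _ _) => al; rewrite e /=.
by congr pair; ring.
Qed.

Lemma cover_cross u v : cross (@annulus_cover R u) (annulus_cover v) =
  (2 - u.2) * (2 - v.2) * sin (2 * pi * (v.1 - u.1)).
Proof. by rewrite /cross /= [2 * pi * (_ - _)]mulrBr sinB; ring. Qed.

Lemma cover_dot u v : dot (@annulus_cover R u) (annulus_cover v) =
  (2 - u.2) * (2 - v.2) * cos (2 * pi * (v.1 - u.1)).
Proof. by rewrite /dot /= [2 * pi * (_ - _)]mulrBr cosB; ring. Qed.

(** A horizontal step of one quarter is an angle of [pi / 2], the bound within which [atan] inverts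
    [tan]. *)
Lemma ang_cover u v : u.2 <= 1 -> v.2 <= 1 -> `|v.1 - u.1| < 1 / 4 ->
  ang (@annulus_cover R u) (annulus_cover v) = 2 * pi * (v.1 - u.1).
Proof.
move=> u1 v1; rewrite ltr_norml => /andP[h1 h2].
rewrite /ang cover_cross cover_dot -mulf_div divff ?mul1r; last first.
  by apply: mulf_neq0; apply: lt0r_neq0; lra.
apply: tanK; rewrite in_itv /=; have := pi_gt0 R; move: (v.1 - u.1) h1 h2 => x h1 h2 p0.
by apply/andP; split; nra.
Qed.

Lemma winding_cover N (c : R -> R * R) : (0 < N)%N ->
  (forall i, (i <= N)%N -> (c (i%:R / N%:R)).2 <= 1) ->
  (forall i, (i < N)%N -> `|(c (i.+1%:R / N%:R)).1 - (c (i%:R / N%:R)).1| < 1 / 4) ->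
  winding N (@annulus_cover R \o c) = 2 * pi * ((c 1).1 - (c 0).1).
Proof.
move=> N0 h1 h2; rewrite /winding.
rewrite (eq_bigr (fun i : 'I_N => 2 * pi * ((c (i.+1%:R / N%:R)).1 - (c (i%:R / N%:R)).1))).
  rewrite -mulr_sumr -(big_mkord xpredT (fun i => (c (i.+1%:R / N%:R)).1 - (c (i%:R / N%:R)).1)).
  rewrite telescope_sumr // mul0r divff // pnatr_eq0 -lt0n //.
by move=> i _; apply: ang_cover; [apply: h1; exact: ltnW|apply: h1|apply: h2].
Qed.

Lemma cont_fst (X : topologicalType) (f : X -> R * R) :
  continuous f -> continuous (fun x => (f x).1).
Proof. by move=> hf x; apply: cvg_comp (hf x) _; exact: cvg_fst. Qed.

Lemma cont_snd (X : topologicalType) (f : X -> R * R) :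
  continuous f -> continuous (fun x => (f x).2).
Proof. by move=> hf x; apply: cvg_comp (hf x) _; exact: cvg_snd. Qed.

Lemma cont_pair (X Y Z : topologicalType) (f : X -> Y) (g : X -> Z) :
  continuous f -> continuous g -> continuous (fun x => (f x, g x)).
Proof. by move=> hf hg x; apply: cvg_pair; [exact: hf|exact: hg]. Qed.

Lemma cont_D (X : topologicalType) (f g : X -> R) :
  continuous f -> continuous g -> continuous (fun x => f x + g x).
Proof. by move=> hf hg x; apply: cvgD; [exact: hf|exact: hg]. Qed.

Lemma cont_B (X : topologicalType) (f g : X -> R) :
  continuous f -> continuous g -> continuous (fun x => f x - g x).
Proof. by move=> hf hg x; apply: cvgB; [exact: hf|exact: hg]. Qed.

Lemma cont_M (X : topologicalType) (f g : X -> R) :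
  continuous f -> continuous g -> continuous (fun x => f x * g x).
Proof. by move=> hf hg x; apply: cvgM; [exact: hf|exact: hg]. Qed.

Lemma cont_sum (X : topologicalType) n (f : 'I_n -> X -> R) :
  (forall i, continuous (f i)) -> continuous (fun x => \sum_i f i x).
Proof.
elim: n f => [|n IH] f hf.
  rewrite [X in continuous X](_ : _ = fun=> 0); first exact: cst_continuous.
  by apply/funext => x; rewrite big_ord0.
rewrite [X in continuous X](_ : _ = fun x => f ord0 x + \sum_i f (lift ord0 i) x); last first.
  by apply/funext => x; rewrite big_ord_recl.
by apply: cont_D => //; apply: IH => i.
Qed.

Lemma cont_cover (X : topologicalType) (f : X -> R * R) :
  continuous f -> continuous (fun x => annulus_cover (f x)).
Proof.
move=> hf; have h1 := cont_fst hf; have h2 := cont_snd hf.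
have hc (a : R) : continuous (fun _ : X => a) by move=> x; exact: cvg_cst.
have h3 : continuous (fun x => 2 * pi * (f x).1) by apply: cont_M => //; exact: hc.
have h4 : continuous (fun x => 2 - (f x).2) by apply: cont_B => //; exact: hc.
apply: cont_pair; apply: cont_M => //.
  by move=> x; apply: continuous_comp; [exact: h3|exact: continuous_cos].
by move=> x; apply: continuous_comp; [exact: h3|exact: continuous_sin].
Qed.

Lemma cont_ang (X : topologicalType) (f g : X -> R * R) :
  continuous f -> continuous g -> (forall x, 0 < dot (f x) (g x)) ->
  continuous (fun x => ang (f x) (g x)).
Proof.
move=> hf hg d0.
have f1 := cont_fst hf; have f2 := cont_snd hf; have g1 := cont_fst hg; have g2 := cont_snd hg.
have hcross : continuous (fun x => cross (f x) (g x)) by apply: cont_B; exact: cont_M.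
have hdot : continuous (fun x => dot (f x) (g x)) by apply: cont_D; exact: cont_M.
move=> x; apply: (continuous_comp (f := fun x => cross (f x) (g x) / dot (f x) (g x))); last exact: continuous_atan.
apply: cvgM; first exact: hcross.
by apply: cvgV; [exact/lt0r_neq0|exact: hdot].
Qed.

Lemma trig_period (n : int) (x : R) :
  cos (x + 2 * pi * n%:~R) = cos x /\ sin (x + 2 * pi * n%:~R) = sin x.
Proof.
have nat_case m y : cos (y + 2 * pi * m%:R) = cos y /\ sin (y + 2 * pi * m%:R) = sin y :> R.
  elim: m y => [|m IH] y; first by rewrite mulr0 addr0.
  have -> : y + 2 * pi * m.+1%:R = y + 2 * pi * m%:R + pi *+ 2.
    by rewrite [m.+1%:R]mulrSr mulrDr mulr1 addrA mulr_natl.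
  by rewrite cosD2pi sinD2pi.
case: n => n; first exact: nat_case.
have [<- <-] := nat_case n.+1 (x + 2 * pi * (Negz n)%:~R).
by rewrite NegzE mulrNz mulrN -!pmulrn subrK.
Qed.

Lemma cover_period (n : int) (u : R * R) :
  annulus_cover (u.1 + n%:~R, u.2) = annulus_cover u.
Proof.
rewrite /annulus_cover /= mulrDr; have [-> ->] := trig_period n (2 * pi * u.1).
by [].
Qed.

Lemma cos_eq1 (x : R) : cos x = 1 -> exists n : int, x = 2 * pi * n%:~R.
Proof.
move=> cx; have p0 := pi_gt0 R; have p20 : 0 < 2 * pi :> R by rewrite mulr_gt0.
pose n := Num.floor (x / (2 * pi)); exists n.
pose y := x + 2 * pi * (- n)%:~R.
have cy : cos y = 1 by have [-> _] := trig_period (- n) x.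
have [y0 y1] : 0 <= y /\ y < 2 * pi.
  have h1 : n%:~R <= x / (2 * pi) by exact: floor_le.
  have h2 : x / (2 * pi) < n%:~R + 1 by have := floorD1_gt (x / (2 * pi)); rewrite intrD.
  move: h1 h2; rewrite ler_pdivlMr // ltr_pdivrMr // /y mulrNz.
  by move=> h1 h2; split; nra.
have [yp|y0'] := ltP 0 y; last first.
  have : y = 0 by apply/eqP; rewrite eq_le y0 y0'.
  by rewrite /y mulrNz mulrN => /eqP; rewrite subr_eq0 => /eqP.
have s0 : 0 < sin (y / 2) by apply: sin_gt0_pi; apply/andP; split; nra.
have : cos y = 1 - 2 * sin (y / 2) ^+ 2.
  have -> : y = (y / 2) *+ 2 by rewrite -mulr_natr divfK.
  by rewrite cos_mulr2n sin2cos2 -mulr_natr -[X in _ = _ - _ * (_ - cos X ^+ 2)](_ : y / 2 = _ ); first ring; rewrite -[in RHS]mulr_natr divfK.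
by rewrite cy => e; nra.
Qed.

(** The radius [2 - y] is positive, so comparing norms recovers [y]; the scalar product of the two
    equal images then shows that the angle difference has cosine one. *)
Lemma cover_inj (u v : R * R) : u.2 <= 1 -> v.2 <= 1 ->
  annulus_cover u = annulus_cover v ->
  u.2 = v.2 /\ exists n : int, v.1 = u.1 + n%:~R.
Proof.
move=> u1 v1 e.
have d := cover_dot u v; have c := cover_cross u v.
rewrite -e in d c.
have du : dot (annulus_cover u) (annulus_cover u) = (2 - u.2) ^+ 2.
  by rewrite cover_dot subrr mulr0 cos0 mulr1 expr2.
have dv : dot (annulus_cover u) (annulus_cover u) = (2 - v.2) ^+ 2.
  by rewrite e cover_dot subrr mulr0 cos0 mulr1 expr2.
have e2 : u.2 = v.2.
  by move: du; rewrite dv => /eqP; rewrite eqf_sqr => /orP[]/eqP ?; lra.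
split=> //; have [|n en] := @cos_eq1 (2 * pi * (v.1 - u.1)).
  have : (2 - u.2) ^+ 2 = (2 - u.2) ^+ 2 * cos (2 * pi * (v.1 - u.1)).
    by rewrite -{1}du d -e2 expr2.
  move=> /esym; rewrite -[X in _ = X]mulr1; apply: mulfI.
  by rewrite expf_neq0 //; apply: lt0r_neq0; lra.
exists n; have p0 := pi_gt0 R.
have : v.1 - u.1 = n%:~R by apply: (mulfI (_ : 2 * pi != 0)) en; rewrite mulf_neq0 // lt0r_neq0.
by move=> <-; rewrite addrC subrK.
Qed.

End Topology.

(** * Homotopies in the annulus and translations of lifts *)

Section Homotopy.
Variable R : realType.
Local Open Scope classical_set_scope.
Local Notation cover := (@annulus_cover R).

Definition strip_curve (c : curve R) :=
  curve_continuous c /\ forall t, 0 <= t <= 1 -> 0 <= (c t).2 <= 1.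

Lemma clamp_curve (c : curve R) : curve_continuous c -> continuous (c \o @clamp R).
Proof.
move=> hc; apply: (within_comp hc (@clamp_continuous R)) => t; exact: clamp_itv.
Qed.

Lemma inv_lt (d : R) : 0 < d -> exists2 N, (0 < N)%N & N%:R^-1 < d.
Proof.
move=> d0; have i0 : 0 <= d^-1 by rewrite invr_ge0 ltW.
have lt := archi_boundP i0; have b0 := le_lt_trans i0 lt.
exists (Num.bound d^-1); first by rewrite -(ltr0n R).
by rewrite -[ltRHS]invrK ltf_pV2 ?posrE ?invr_gt0.
Qed.

Lemma grid_itv (N i : nat) : (0 < N)%N -> (i <= N)%N -> 0 <= (i%:R / N%:R : R) <= 1.
Proof.
move=> N0 iN; rewrite divr_ge0 ?ler0n //= ler_pdivrMr ?ltr0n // mul1r ler_nat //.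
Qed.

Lemma grid_step (N i : nat) (d : R) : (0 < N)%N -> N%:R^-1 < d ->
  ball (i%:R / N%:R : R) d (i.+1%:R / N%:R).
Proof.
move=> N0 Nd; rewrite /ball /= -mulrBl -natr1 opprD addrA subrr add0r mulN1r normrN.
by rewrite gtr0_norm // invr_gt0 ltr0n.
Qed.

(** Twice the scalar product is the sum of the squared norms, at least two, minus the squared
    distance, less than one half. *)
Lemma annulus_dot (z w : R * R) : annulus z -> annulus w -> ball z (1 / 2) w -> 0 < dot z w.
Proof.
move=> /andP[z1 _] /andP[w1 _] [h1 h2]; move: h1 h2; rewrite /ball /= !ltr_norml /dot.
move=> /andP[a1 a2] /andP[b1 b2].
have : (z.1 - w.1) ^+ 2 < 1 / 4 by nra.
have : (z.2 - w.2) ^+ 2 < 1 / 4 by nra.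
nra.
Qed.

(* The total angular variation of [H (s, -)] is continuous in [s] and locally
   constant modulo pi, hence constant. *)
Lemma lift_diff (g h c c' : curve R) H : strip_curve c -> strip_curve c' ->
  (forall t, 0 <= t <= 1 -> g t = cover (c t)) ->
  (forall t, 0 <= t <= 1 -> h t = cover (c' t)) ->
  annulus_homotopy g h H ->
  (forall s, 0 <= s <= 1 -> cross (H (s, 0)) (H (s, 1)) * dot (H (0, 0)) (H (0, 1)) =
     dot (H (s, 0)) (H (s, 1)) * cross (H (0, 0)) (H (0, 1))) ->
  (c 1).1 - (c 0).1 = (c' 1).1 - (c' 0).1.
Proof.
move=> [cc cs] [cc' cs'] gE hE [cH aH H0 H1] E.
pose Hc (u : R * R) := H (clamp u.1, clamp u.2).
have cHc : continuous Hc.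
  apply: (within_comp (c := fun u => (clamp u.1, clamp u.2)) cH).
    apply: cont_pair.
      by move=> u; apply: continuous_comp; [exact: cvg_fst|exact: clamp_continuous].
    by move=> u; apply: continuous_comp; [exact: cvg_snd|exact: clamp_continuous].
  by move=> u; split; exact: clamp_itv.
have HcE s t : 0 <= s <= 1 -> 0 <= t <= 1 -> Hc (s, t) = H (s, t).
  by move=> hs ht; rewrite /Hc /= !clamp_id.
have aHc u : annulus (Hc u) by apply: aH; exact: clamp_itv.
have cK : compact (`[0%R, 1%R]%classic `*` `[0%R, 1%R]%classic : set (R * R)).
  by apply: compact_setX; exact: segment_compact.
have cI : compact (`[0%R, 1%R]%classic : set R) by exact: segment_compact.
(* One half keeps consecutive grid points of the homotopy at acute angles; one quarter is what
   [ang_cover] asks of the lifts. *)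
have half0 : 0 < 1 / 2 :> R by rewrite divr_gt0.
have quart0 : 0 < 1 / 4 :> R by rewrite divr_gt0.
have [d1 d10 Hd1] := compact_unif cK cHc half0.
have [d2 d20 Hd2] := compact_unif cI (clamp_curve cc) quart0.
have [d3 d30 Hd3] := compact_unif cI (clamp_curve cc') quart0.
pose d := Num.min d1 (Num.min d2 d3).
have d0 : 0 < d by rewrite !lt_min d10 d20 d30.
have [N N0 Nd] := inv_lt d0.
have step i e : d <= e -> ball (i%:R / N%:R : R) e (i.+1%:R / N%:R).
  by move=> de; apply: le_ball de _ _; exact: grid_step.
pose A s := winding N (fun t => Hc (s, t)).
have dots s i : (i < N)%N -> 0 < dot (Hc (s, i%:R / N%:R)) (Hc (s, i.+1%:R / N%:R)).
  move=> iN; have Es t : Hc (s, t) = Hc (clamp s, t) by rewrite /Hc /= (clamp_id (clamp_itv s)).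
  rewrite (Es (i%:R / N%:R)) (Es (i.+1%:R / N%:R)).
  apply: annulus_dot => //; apply: Hd1.
    split => /=; rewrite in_itv /=; [exact: clamp_itv|apply: grid_itv => //; exact: ltnW].
  split=> /=; first exact: ballxx.
  by apply: step; rewrite /d ge_min lexx.
have cA : continuous A.
  apply: (cont_sum (f := fun (i : 'I_N) s =>
    ang (Hc (s, i%:R / N%:R)) (Hc (s, i.+1%:R / N%:R)))) => i.
  have sec t : continuous (fun s => Hc (s, t)).
    have ct : continuous (fun s : R => (s, t)).
      by apply: (cont_pair (f := fun s : R => s) (g := fun _ : R => t)) => x; [exact: cvg_id|exact: cvg_cst].
    by move=> s; apply: (continuous_comp (f := fun s => (s, t)) (g := Hc)); [exact: ct|exact: cHc].
  by apply: cont_ang => // s; exact: dots.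
have A_cover (f e : curve R) s : 0 <= s <= 1 -> (forall t, 0 <= t <= 1 -> 0 <= (e t).2 <= 1) ->
   (forall t, 0 <= t <= 1 -> f t = cover (e t)) -> (forall t, 0 <= t <= 1 -> H (s, t) = f t) ->
   (forall i, (i < N)%N -> ball (e (i%:R / N%:R)) (1 / 4) (e (i.+1%:R / N%:R))) ->
   A s = 2 * pi * ((e 1).1 - (e 0).1).
  move=> hs es fE HE be; rewrite -(@winding_cover R N e) //.
  - apply: eq_bigr => i _.
    have gi := grid_itv N0 (ltnW (ltn_ord i)); have gi' := grid_itv N0 (ltn_ord i).
    by rewrite !HcE // !HE // !fE.
  - by move=> i iN; have /andP[] := es _ (grid_itv N0 iN).
  - by move=> i iN; have [b1 _] := be i iN; rewrite distrC.
have unitI i : (i <= N)%N -> `[0%R, 1%R]%classic (i%:R / N%:R : R).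
  by move=> iN; rewrite /= in_itv /=; exact: grid_itv.
have A0 : A 0 = 2 * pi * ((c 1).1 - (c 0).1).
  apply: (A_cover g c) => //; first by rewrite lexx ler01.
  move=> i iN; have := Hd2 _ (i.+1%:R / N%:R) (unitI i (ltnW iN)).
  rewrite /= !clamp_id ?grid_itv //; last exact: ltnW.
  by apply; apply: step; rewrite /d !ge_min lexx orbT.
have A1 : A 1 = 2 * pi * ((c' 1).1 - (c' 0).1).
  apply: (A_cover h c') => //; first by rewrite lexx ler01.
  move=> i iN; have := Hd3 _ (i.+1%:R / N%:R) (unitI i (ltnW iN)).
  rewrite /= !clamp_id ?grid_itv //; last exact: ltnW.
  by apply; apply: step; rewrite /d !ge_min lexx !orbT.
have I0 : 0 <= (0 : R) <= 1 by rewrite lexx ler01.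
have I1 : 0 <= (1 : R) <= 1 by rewrite lexx ler01.
(* [H (s, 1)] is a positive multiple of [H (s, 0)] rotated by [A s], so the hypothesis on [cross]
   and [dot] says that [A s] and [A 0] agree modulo [pi]. *)
have sinA s : 0 <= s <= 1 -> sin (A s - A 0) = 0.
  move=> hs.
  have rot s' : 0 <= s' <= 1 -> exists2 m, 0 < m &
      cross (H (s', 0)) (H (s', 1)) = m * sin (A s') /\ dot (H (s', 0)) (H (s', 1)) = m * cos (A s').
    move=> hs'; have [r r0 e] := winding_rot (g := fun t => Hc (s', t)) N0 (dots s').
    rewrite /= !HcE // -/(A s') in e.
    have /andP[z1 _] := aH _ _ hs' I0.
    exists (r * ((H (s', 0)).1 ^+ 2 + (H (s', 0)).2 ^+ 2)).
      by rewrite mulr_gt0 // (lt_le_trans ltr01).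
    by rewrite e /cross /dot /=; split; ring.
  have [m m0 [e1 e2]] := rot _ hs; have [m' m'0 [e1' e2']] := rot _ I0.
  have := E s hs; rewrite e1 e2 e1' e2' sinB => e.
  have mm : m * m' != 0 by rewrite mulf_neq0 // lt0r_neq0.
  apply: (mulfI mm); rewrite mulr0.
  have -> : m * m' * (sin (A s) * cos (A 0) - cos (A s) * sin (A 0)) =
    m * sin (A s) * (m' * cos (A 0)) - m * cos (A s) * (m' * sin (A 0)) by ring.
  by rewrite e subrr.
have A01 : A 1 = A 0.
  apply/eqP; rewrite -subr_eq0; apply/negP => /negP ne.
  (* Truncated to absolute value at most one, the difference is still a nonzero value of
     [A s - A 0], and its sine cannot vanish. *)
  pose b := A 1 - A 0; pose v := if 0 < b then Num.min b 1 else Num.max b (-1).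
  have v0 : sin v != 0.
    have p0 := pi_ge2 R; rewrite /v; case: ltP => b0.
      by rewrite lt0r_neq0 // sin_gt0_pi // lt_min b0 ltr01 gt_min; apply/andP; split=> //; apply/orP; right; lra.
    have bn : b < 0 by rewrite lt_neqAle ne.
    rewrite -oppr_eq0 -sinN lt0r_neq0 // sin_gt0_pi // oppr_gt0 gt_max bn /=.
    by apply/andP; split; [lra|rewrite ltrNl lt_max; apply/orP; right; lra].
  have [s hs es] : exists2 s, 0 <= s <= 1 & A s - A 0 = v.
    suff [s] : exists2 s, s \in `[0%R, 1%R]%R & A s - A 0 = v.
      by rewrite in_itv /= => hs ev; exists s.
    apply: (IVT (f := fun s => A s - A 0) ler01).
      by apply: continuous_subspaceT; apply: cont_B => // x; exact: cvg_cst.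
    rewrite /= subrr -/b /v; case: ltP => b0.
      by rewrite le_min (ltW b0) ler01 ge_min lexx.
    by rewrite le_max lexx ge_max b0 oppr_le0 ler01.
  by move: v0; rewrite -es sinA ?eqxx.
have p0 : 2 * pi != 0 :> R by rewrite mulf_neq0 // lt0r_neq0 // pi_gt0.
by apply: (mulfI p0); rewrite -A0 -A1.
Qed.

(** Each end gives an integral shift; equality of the horizontal displacements makes the two shifts
    coincide. *)
Lemma homotopic_lift (g h c c' : curve R) : strip_curve c -> strip_curve c' ->
  (forall t, 0 <= t <= 1 -> g t = cover (c t)) ->
  (forall t, 0 <= t <= 1 -> h t = cover (c' t)) -> homotopic g h ->
  exists n : int, c' 0 = ((c 0).1 + n%:~R, (c 0).2) /\ c' 1 = ((c 1).1 + n%:~R, (c 1).2).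
Proof.
move=> sc sc' gE hE [H hH ends].
have I0 : 0 <= (0 : R) <= 1 by rewrite lexx ler01.
have I1 : 0 <= (1 : R) <= 1 by rewrite lexx ler01.
have dE : (c 1).1 - (c 0).1 = (c' 1).1 - (c' 0).1.
  apply: (lift_diff sc sc' gE hE hH) => s hs.
  have [e1 e2] := ends s hs; have [e3 e4] := ends 0 I0.
  by rewrite e1 e2 e3 e4 mulrC.
have [_ _ H0 H1] := hH; have [e1 e2] := ends 1 I1.
have c0 : cover (c 0) = cover (c' 0) by rewrite -gE // -hE // -H1 // e1.
have c1 : cover (c 1) = cover (c' 1) by rewrite -gE // -hE // -H1 // e2.
have bnd (e : curve R) t : strip_curve e -> 0 <= t <= 1 -> (e t).2 <= 1.
  by move=> [_ es] /es /andP[].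
have [y0 [n x0]] := cover_inj (bnd _ _ sc I0) (bnd _ _ sc' I0) c0.
have [y1 _] := cover_inj (bnd _ _ sc I1) (bnd _ _ sc' I1) c1.
exists n; rewrite y0 y1 -x0; split; first exact: surjective_pairing.
by rewrite [LHS]surjective_pairing; congr pair; move: dE; rewrite x0; lra.
Qed.

(** The strip is convex, so segments between points of the two lifts stay inside it. *)
Lemma straight_homotopy (g h c c' : curve R) : strip_curve c -> strip_curve c' ->
  (forall t, 0 <= t <= 1 -> g t = cover (c t)) ->
  (forall t, 0 <= t <= 1 -> h t = cover (c' t)) ->
  exists2 H, annulus_homotopy g h H & forall s t, 0 <= t <= 1 -> H (s, t) =
    cover ((1 - s) * (c t).1 + s * (c' t).1, (1 - s) * (c t).2 + s * (c' t).2).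
Proof.
move=> [cc cs] [cc' cs'] gE hE.
pose f (u : R * R) := ((1 - u.1) * (c (clamp u.2)).1 + u.1 * (c' (clamp u.2)).1,
    (1 - u.1) * (c (clamp u.2)).2 + u.1 * (c' (clamp u.2)).2).
have cfst : continuous (fun u : R * R => u.1) by move=> u; exact: cvg_fst.
have csnd : continuous (fun u : R * R => u.2) by move=> u; exact: cvg_snd.
have c1 : continuous (fun u : R * R => 1 - u.1) by apply: cont_B => // u; exact: cvg_cst.
have comp2 (e : curve R) : curve_continuous e -> continuous (fun u : R * R => e (clamp u.2)).
  move=> /clamp_curve ce u.
  by apply: (continuous_comp (f := fun u : R * R => u.2) (g := e \o @clamp R)); [exact: csnd|exact: ce].
have cf : continuous f.
  apply: cont_pair; apply: cont_D; apply: cont_M => //.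
  - exact/cont_fst/comp2.
  - exact/cont_fst/comp2.
  - exact/cont_snd/comp2.
  - exact/cont_snd/comp2.
exists (fun u => cover (f u)); last by move=> s t ht; rewrite /f /= clamp_id.
split.
- by apply: continuous_subspaceT; exact: cont_cover.
- move=> s t hs ht; rewrite /f /= clamp_id //.
  have /andP[a0 a1] := cs _ ht; have /andP[b0 b1] := cs' _ ht; have /andP[s0 s1] := hs.
  move: (c t).2 (c' t).2 a0 a1 b0 b1 => a b a0 a1 b0 b1.
  rewrite /annulus /annulus_cover /=; set y := _ + s * b; set x := 2 * pi * _.
  have y0 : 0 <= y by rewrite addr_ge0 // mulr_ge0 // subr_ge0.
  have y1 : y <= 1 by rewrite /y; nra.
  rewrite !exprMn -mulrDr cos2Dsin2 mulr1.
  by apply/andP; split; nra.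
- by move=> t ht; rewrite /f /= subr0 !mul1r !mul0r !addr0 clamp_id // gE // -surjective_pairing.
- by move=> t ht; rewrite /f /= subrr !mul0r !mul1r !add0r clamp_id // hE // -surjective_pairing.
Qed.

Lemma homotopic_translate (g h c c' : curve R) (n : int) :
  strip_curve c -> strip_curve c' ->
  (forall t, 0 <= t <= 1 -> g t = cover (c t)) ->
  (forall t, 0 <= t <= 1 -> h t = cover (c' t)) ->
  c' 0 = ((c 0).1 + n%:~R, (c 0).2) -> c' 1 = ((c 1).1 + n%:~R, (c 1).2) ->
  homotopic g h.
Proof.
move=> [cc cs] sc' gE hE e0 e1.
pose d : curve R := fun t => ((c t).1 + n%:~R, (c t).2).
have sd : strip_curve d.
  split=> //; rewrite /curve_continuous.
  have cd : continuous (d \o @clamp R).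
    have cc0 := clamp_curve cc; apply: cont_pair; last exact: cont_snd cc0.
    by apply: cont_D; [exact: cont_fst cc0|move=> x; exact: cvg_cst].
  apply: (subspace_eq_continuous (f := d \o @clamp R)); last exact: continuous_subspaceT.
  by move=> t; rewrite inE /= => ht; rewrite clamp_id.
have gE' t : 0 <= t <= 1 -> g t = cover (d t).
  by move=> ht; rewrite gE // /d cover_period.
have [H hH HE] := straight_homotopy sd sc' gE' hE; exists H => // s hs.
have I0 : 0 <= (0 : R) <= 1 by rewrite lexx ler01.
have I1 : 0 <= (1 : R) <= 1 by rewrite lexx ler01.
have mix (x : R) : (1 - s) * x + s * x = x by ring.
by rewrite !HE // e0 e1 /= !mix gE' // gE'.
Qed.

Lemma curve_pow_lift (g : curve R) n : loop g -> exists c : curve R,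
  [/\ strip_curve c, c 1 = ((c 0).1 + n%:R, (c 0).2) &
      forall t, 0 <= t <= 1 -> curve_pow g n t = cover (c t)].
Proof.
move=> [c [cc cs c1 gE]].
have I0 : 0 <= (0 : R) <= 1 by rewrite lexx ler01.
have I1 : 0 <= (1 : R) <= 1 by rewrite lexx ler01.
have c11 : (c 1).1 = (c 0).1 + 1 by rewrite c1.
have c12 : (c 1).2 = (c 0).2 by rewrite c1 /= addr0.
(* A sum of [n] clamped increments, the [i]-th of which varies only while [n t] runs from [i] to
   [i + 1]; continuity then follows without gluing. *)
pose d : curve R := fun t => ((c 0).1 + \sum_(i < n) ((c (clamp (n%:R * t - i%:R))).1 - (c 0).1),
  (c 0).2 + \sum_(i < n) ((c (clamp (n%:R * t - i%:R))).2 - (c 0).2)).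
have dE (m : nat) (t : R) : 0 <= t <= 1 -> m%:R <= n%:R * t < m%:R + 1 ->
    d t = ((c (n%:R * t - m%:R)).1 + m%:R, (c (n%:R * t - m%:R)).2).
  move=> /andP[t0 t1] /andP[h1 h2].
  have lo (i : nat) : (i < m)%N -> clamp (n%:R * t - i%:R) = 1.
    by move=> im; apply: clamp1; have : i.+1%:R <= m%:R :> R by [rewrite ler_nat|]; rewrite -natr1; lra.
  have hi (i : nat) : (m < i)%N -> clamp (n%:R * t - i%:R) = 0.
    by move=> im; apply: clamp0; have : m.+1%:R <= i%:R :> R by [rewrite ler_nat|]; rewrite -natr1; lra.
  have mid : clamp (n%:R * t - m%:R) = n%:R * t - m%:R.
    by apply: clamp_id; apply/andP; split; lra.
  have sumE (f : R * R -> R) : \sum_(i < n) (f (c (clamp (n%:R * t - i%:R))) - f (c 0)) =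
      (f (c 1) - f (c 0)) *+ m + (f (c (n%:R * t - m%:R)) - f (c 0)).
    pose F i := f (c (clamp (n%:R * t - i%:R))) - f (c 0).
    have ltm : \sum_(0 <= i < m) F i = (f (c 1) - f (c 0)) *+ m.
      rewrite (eq_big_nat _ _ (F2 := fun=> f (c 1) - f (c 0))) => [|i /andP[_ im]].
        by rewrite sumr_const_nat subn0.
      by rewrite /F lo.
    rewrite -(big_mkord xpredT F); have [mn|nm] := ltnP m n.
      rewrite (@big_cat_nat _ _ _ m) //= ?(ltnW mn) // ltm; congr (_ + _).
      rewrite big_ltn // {1}/F mid big_nat big1 ?addr0 // => i /andP[mi _].
      by rewrite /F hi // subrr.
    (* The integer part reaches [n] only at [t = 1], where all increments are complete and the
       remaining term vanishes. *)
    have em : m = n.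
      apply/eqP; rewrite eqn_leq nm andbT -(ler_nat R); apply: (le_trans h1).
      by rewrite ler_piMr.
    have et : n%:R * t - m%:R = 0 by rewrite em in h1 *; have : n%:R * t <= n%:R by [rewrite ler_piMr|]; lra.
    by rewrite -{1}em ltm et subrr addr0.
  rewrite /d (sumE fst) (sumE snd) /= c11 c12 subrr mul0rn add0r.
  have -> : ((c 0).1 + 1 - (c 0).1) = 1 by rewrite addrAC subrr add0r.
  by congr pair; ring.
have dfl (t : R) : 0 <= t <= 1 -> exists2 m : nat, m%:R <= n%:R * t < m%:R + 1 &
    (Num.floor (n%:R * t) = m%:Z).
  move=> /andP[t0 t1]; have nt0 : 0 <= n%:R * t by rewrite mulr_ge0.
  have f0 : (0 <= Num.floor (n%:R * t))%R by rewrite floor_ge0.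
  exists (absz (Num.floor (n%:R * t))); last by rewrite gez0_abs.
  have e : (absz (Num.floor (n%:R * t)))%:R = (Num.floor (n%:R * t))%:~R :> R.
    by rewrite -{2}(gez0_abs f0) -pmulrn.
  by rewrite e floor_le /=; have := floorD1_gt (n%:R * t); rewrite intrD.
have fr (t : R) m : m%:R <= n%:R * t < m%:R + 1 -> 0 <= n%:R * t - m%:R <= 1.
  by move=> /andP[h1 h2]; apply/andP; split; lra.
exists d; split.
- split=> [|t ht].
    apply: continuous_subspaceT; have cc0 := clamp_curve cc.
    have cl i : continuous (fun t : R => c (clamp (n%:R * t - i%:R))).
      move=> t; apply: (continuous_comp (f := fun t : R => n%:R * t - i%:R) (g := c \o @clamp R)); last exact: cc0.
      by apply: cvgB; [apply: cvgM; [exact: cvg_cst|exact: cvg_id]|exact: cvg_cst].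
    apply: cont_pair; apply: cont_D; try by move=> t; exact: cvg_cst.
      apply: (cont_sum (f := fun (i : 'I_n) (t : R) => (c (clamp (n%:R * t - i%:R))).1 - (c 0).1)) => i.
      by apply: cont_B; [exact/cont_fst/cl|move=> t; exact: cvg_cst].
    apply: (cont_sum (f := fun (i : 'I_n) (t : R) => (c (clamp (n%:R * t - i%:R))).2 - (c 0).2)) => i.
    by apply: cont_B; [exact/cont_snd/cl|move=> t; exact: cvg_cst].
  have [m hm _] := dfl t ht; rewrite (dE m) //=.
  by have /andP[/ltW -> /ltW ->] := cs _ (fr _ _ hm).
- rewrite (dE n 1 I1) ?(dE 0%N 0 I0); last 2 first.
  + by rewrite mulr0 lexx add0r ltr01.
  + by rewrite mulr1 lexx ltrDl ltr01.
  by rewrite mulr0 mulr1 subrr subr0 /= addr0.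
move=> t ht; have [m hm em] := dfl t ht.
rewrite (dE m) // /curve_pow em -pmulrn gE /=.
by have := cover_period m%:Z (c (n%:R * t - m%:R)); rewrite -pmulrn => ->.
Qed.

Lemma loop_pow_homotopic (g g' : curve R) n : loop g -> loop g' ->
  freely_homotopic (curve_pow g n) (curve_pow g' n).
Proof.
move=> /(curve_pow_lift n)[c [sc c1 gE]] /(curve_pow_lift n)[c' [sc' c1' gE']].
have [H hH HE] := straight_homotopy sc sc' gE gE'; exists H => // s hs.
have I0 : 0 <= (0 : R) <= 1 by rewrite lexx ler01.
have I1 : 0 <= (1 : R) <= 1 by rewrite lexx ler01.
rewrite !HE // c1 c1' /=.
have := cover_period n%:Z ((1 - s) * (c 0).1 + s * (c' 0).1, (1 - s) * (c 0).2 + s * (c' 0).2).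
by rewrite -pmulrn /= => <-; congr (cover (_, _)); ring.
Qed.

(** Every intermediate curve is closed, so [cross] of its ends is zero and [lift_diff] applies; the
    displacement of the lift counts the turns. *)
Lemma loop_pow_homotopic_inj (g g' : curve R) n n' : loop g -> loop g' ->
  freely_homotopic (curve_pow g n) (curve_pow g' n') -> n = n'.
Proof.
move=> /(curve_pow_lift n)[c [sc c1 gE]] /(curve_pow_lift n')[c' [sc' c1' gE']] [H hH ends].
have cross0 z : cross z z = 0 :> R by rewrite /cross mulrC subrr.
have : (c 1).1 - (c 0).1 = (c' 1).1 - (c' 0).1.
  apply: (lift_diff sc sc' gE gE' hH) => s hs.
  by rewrite (ends s hs) (ends 0) ?lexx ?ler01 // !cross0 mul0r mulr0.
rewrite c1 c1' /= ![_ + _%:R - _]addrAC !subrr !add0r => /eqP.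
by rewrite eqr_nat => /eqP.
Qed.

End Homotopy.

(** * The parametrization *)

Section Lifts.
Variables (R : realType) (p q : nat).
Hypotheses (hp : (0 < p)%N) (hq : (0 < q)%N).
Local Open Scope classical_set_scope.

Lemma frac_translate (r : nat) (i i' n : int) : (0 < r)%N ->
  i'%:~R / r%:R = i%:~R / r%:R + n%:~R :> R <-> i' = i + r%:Z * n.
Proof.
move=> r0; have rn0 : r%:R != 0 :> R by rewrite pnatr_eq0 -lt0n.
split=> [e|->].
  apply/eqP; rewrite -(eqr_int R) intrD intrM -pmulrn; apply/eqP.
  by apply: (mulIf (invr_neq0 rn0)); rewrite e; field.
by rewrite intrD intrM -pmulrn; field.
Qed.

Lemma strip_arc_curve (x y x' y' : R) (c : curve R) : 0 <= y <= 1 -> 0 <= y' <= 1 ->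
  strip_arc (x, y) (x', y') c -> strip_curve c.
Proof.
move=> hP hQ [cc c0 c1 ci _]; split=> // t /andP[t0 t1].
move: t0; rewrite le_eqVlt => /predU1P[<-|t0]; first by rewrite c0.
move: t1; rewrite le_eqVlt => /predU1P[->|t1]; first by rewrite c1.
by have /andP[/ltW -> /ltW ->] : 0 < (c t).2 < 1 by apply: ci; rewrite t0.
Qed.

Local Notation cover := (@annulus_cover R).

(** Translating the strip by [n] moves mark number [i] to number [i + r n]. Heights and denominators
    are left free so that bridging and peripheral arcs are covered at once. *)
Lemma arc_homotopic (r r' : nat) (y y' : R) (i j i' j' : int) (c c' : curve R) :
  (0 < r)%N -> (0 < r')%N -> 0 <= y <= 1 -> 0 <= y' <= 1 ->
  strip_arc (i%:~R / r%:R, y) (j%:~R / r'%:R, y') c ->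
  strip_arc (i'%:~R / r%:R, y) (j'%:~R / r'%:R, y') c' ->
  homotopic (cover \o c) (cover \o c') <->
  exists n : int, i' = i + r%:Z * n /\ j' = j + r'%:Z * n.
Proof.
move=> r0 r0' hy hy' h h'; have s := strip_arc_curve hy hy' h.
have s' := strip_arc_curve hy hy' h'.
have [_ c0 c1 _ _] := h; have [_ c0' c1' _ _] := h'.
split=> [/(homotopic_lift s s' (fun t _ => erefl) (fun t _ => erefl))[n]|[n [ej ei]]].
  rewrite c0 c1 c0' c1' => -[[/(frac_translate _ _ _ r0) e0] [/(frac_translate _ _ _ r0') e1]].
  by exists n.
apply: (homotopic_translate (n := n) s s' (fun t _ => erefl) (fun t _ => erefl)).
  by rewrite c0 c0'; congr pair; exact/frac_translate.
by rewrite c1 c1'; congr pair; exact/frac_translate.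
Qed.

Lemma bridging_homotopic j i j' i' (c c' : curve R) :
  bridging_lift p q j i c -> bridging_lift p q j' i' c' ->
  homotopic (cover \o c) (cover \o c') <-> exists n : int, j' = j + q%:Z * n /\ i' = i + p%:Z * n.
Proof. by apply: arc_homotopic; rewrite // lexx ler01. Qed.

Lemma inner_homotopic i j i' j' (c c' : curve R) :
  inner_lift p i j c -> inner_lift p i' j' c' ->
  homotopic (cover \o c) (cover \o c') <-> exists n : int, i' = i + p%:Z * n /\ j' = j + p%:Z * n.
Proof. by move=> [_ h] [_ h']; apply: arc_homotopic h h'; rewrite // lexx ler01. Qed.

Lemma outer_homotopic i j i' j' (c c' : curve R) :
  outer_lift q i j c -> outer_lift q i' j' c' ->
  homotopic (cover \o c) (cover \o c') <-> exists n : int, i' = i + q%:Z * n /\ j' = j + q%:Z * n.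
Proof. by move=> [_ h] [_ h']; apply: arc_homotopic h h'; rewrite // lexx ler01. Qed.

Let cid_R : continuous (fun t : R => t). Proof. by move=> t; exact: cvg_id. Qed.
Let ccst (a : R) : continuous (fun _ : R => a). Proof. by move=> t; exact: cvg_cst. Qed.

Lemma bridging_exists j i : exists c : curve R, bridging_lift p q j i c.
Proof.
exists (fun t => (j%:~R / q%:R + t * (i%:~R / p%:R - j%:~R / q%:R), t)); split.
- apply: continuous_subspaceT; apply: cont_pair => //.
  by apply: cont_D => //; apply: cont_M.
- by rewrite mul0r addr0.
- by rewrite mul1r addrC subrK.
- by [].
- by move=> t t' _ _ [].
Qed.

Lemma peripheral_exists (r : nat) (i j : int) (y : R) : (0 < r)%N ->
  2 <= j - i -> y = 0 \/ y = 1 ->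
  exists c : curve R, strip_arc (i%:~R / r%:R, y) (j%:~R / r%:R, y) c.
Proof.
move=> r0 ij hy; have ab : i%:~R / r%:R < j%:~R / r%:R :> R.
  by rewrite ltr_pM2r ?invr_gt0 ?ltr0n // ltr_int; lia.
move: (i%:~R / r%:R) (j%:~R / r%:R) ab => a b ab.
(* The factor [1 - 2 y] is [1] on the lower boundary and [-1] on the upper one, so the parabola
   bends into the strip. *)
exists (fun t => (a + t * (b - a), y + (1 - 2 * y) * (t * (1 - t)))); split.
- apply: continuous_subspaceT; apply: cont_pair.
    by apply: cont_D => //; apply: cont_M.
  apply: cont_D => //; apply: cont_M => //; apply: cont_M => //; exact: cont_B.
- by rewrite !mul0r mulr0 !addr0.
- by rewrite subrr !mulr0 mul1r addr0 addrC subrK.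
- by move=> t /andP[t0 t1]; case: hy => -> /=; apply/andP; split; nra.
- move=> t t' _ _ [/addrI e _]; apply: mulIf e; rewrite subr_eq0 eq_sym.
  by rewrite (lt_eqF ab).
Qed.

Lemma inner_exists i j : 2 <= j - i -> exists c : curve R, inner_lift p i j c.
Proof.
by move=> ij; have [//||c hc] := @peripheral_exists p i j 1 _ ij; [right|exists c].
Qed.

Lemma outer_exists i j : 2 <= j - i -> exists c : curve R, outer_lift q i j c.
Proof.
by move=> ij; have [//||c hc] := @peripheral_exists q i j 0 _ ij; [left|exists c].
Qed.

Lemma loop_exists : exists g : curve R, loop g.
Proof.
pose c : curve R := fun t => (t, 1 / 2); exists (cover \o c), c; split=> //.
- by apply: continuous_subspaceT; exact: cont_pair.
- by move=> t _ /=; apply/andP; split; lra.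
- by rewrite /c [RHS]surjective_pairing /=; congr pair; lra.
Qed.

End Lifts.

(** * The sheaf attached to a curve, and its invariants *)

Section Parametrization.
Variables (k : closedFieldType) (R : realType) (p q : nat).
Hypotheses (hp : (0 < p)%N) (hq : (0 < q)%N).
Local Notation S := (Sring k).
Local Notation L := (Lgrp p q).
Local Notation X := (X k).
Local Notation pt := (@point_prime k p q).
Local Notation Lx := (Lx p q).
Local Notation cover := (@annulus_cover R).
Implicit Types (M N : gmod k p q).

(** Powers of distinct points are comaximal, so divisibility would make [pt mu] a unit; for a single
    point, cancellation bounds the exponent. *)
Lemma pt_pow_dvd lam mu n m t : (0 < m)%N -> pt lam ^+ n = t * pt mu ^+ m ->
  lam = mu /\ (m <= n)%N.
Proof.
move=> m0 e; have emu : lam = mu.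
  apply/eqP; apply/negP => /negP ne.
  have [K HK] : comax (pt mu) (pt lam ^+ n) by apply/comaxXn/comax_pt; rewrite // eq_sym.
  have [|r] := @S_sat_dvd k (pt mu) 1 K (pt_neq0 p hq mu).
    move=> b; have [s [s' ->]] := HK b; exists (s + s' * (t * pt mu ^+ m.-1)).
    by rewrite e mulr1 mulrDl -!mulrA -exprSr prednK.
  by move/esym/eqP; rewrite (negPf (pt_nonunit hp hq mu r)).
split=> //; rewrite leqNgt; apply/negP => lt.
have : pt lam ^+ n * 1 = pt lam ^+ n * (t * pt lam ^+ (m - n).-1 * pt lam).
  rewrite mulr1 {1}e emu -!mulrA -exprSr prednK ?subn_gt0 // mulrCA -exprD subnKC //.
  exact: ltnW.
move=> /(S_mulfI (S_expf_neq0 n (pt_neq0 p hq lam)))/esym/eqP.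
by rewrite (negPf (pt_nonunit hp hq lam _)).
Qed.

Lemma cyclic_pt_iso M N lam mu n m l l' (g : M) (g' : N) : (0 < n)%N -> (0 < m)%N ->
  cyclic (pt lam ^+ n) l g -> cyclic (pt mu ^+ m) l' g' -> coh_iso M N ->
  lam = mu /\ n = m.
Proof.
move=> n0 m0 cg cg' iso.
have [t et] : exists t, pt lam ^+ n = t * pt mu ^+ m.
  apply/(cyclic_kill cg')/(coh_iso_kill hp hq iso)/(cyclic_kill cg).
  by exists 1; rewrite mul1r.
have [t' et'] : exists t, pt mu ^+ m = t * pt lam ^+ n.
  apply/(cyclic_kill cg)/(coh_iso_kill hp hq (coh_iso_sym hp hq iso))/(cyclic_kill cg').
  by exists 1; rewrite mul1r.
have [e mn] := pt_pow_dvd m0 et; have [_ nm] := pt_pow_dvd n0 et'.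
by split=> //; apply/eqP; rewrite eqn_leq nm.
Qed.

Lemma cyclic0_not_killed M l (g : M) lam n : cyclic 0 l g -> ~ (forall u : M, sat0 (pt lam ^+ n *: u)).
Proof.
move=> cg /(cyclic_kill cg)[t]; rewrite mulr0 => e.
by have := S_expf_neq0 n (pt_neq0 p hq lam); rewrite e eqxx.
Qed.

Lemma pt_zero : pt (Some 0) = X false.
Proof. by rewrite /= eqxx. Qed.

(** A curve in the annulus determines the marks of its lifts only up to translation; one choice is
    fixed here. *)
Lemma bridging_index (g : {g : curve R | bridging_curve p q g}) :
  {ji : int * int | exists c, bridging_lift p q ji.1 ji.2 c /\ sval g = cover \o c}.
Proof. by apply: cid; case: g => g [j [i [c h]]] /=; exists (j, i), c. Qed.

Lemma inner_index (g : {g : curve R | inner_curve p g}) :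
  {ij : int * int | exists c, inner_lift p ij.1 ij.2 c /\ sval g = cover \o c}.
Proof. by apply: cid; case: g => g [i [j [c h]]] /=; exists (i, j), c. Qed.

Lemma outer_index (g : {g : curve R | outer_curve q g}) :
  {ij : int * int | exists c, outer_lift q ij.1 ij.2 c /\ sval g = cover \o c}.
Proof. by apply: cid; case: g => g [i [j [c h]]] /=; exists (i, j), c. Qed.

Lemma cycle_index (x : {x : k * curve R | exists n, param_cycle n x}) :
  {n : nat | param_cycle n (sval x)}.
Proof. by apply: cid; case: x. Qed.

(** A peripheral arc from [i] to [j] passes [j - i - 1] intermediate marks, which is the length of
    its sheaf and is positive because [j - i] is at least two. On the inner boundary [j] fixes the
    top of the uniserial sheaf and [i] its socle; on the outer boundary the roles are exchanged.
    Cycles carry no twist, both variables being invertible at their points. *)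
Definition sheaf (d : datum k R p q) : gmod k p q :=
  match d with
  | Bridging g => let ji := sval (bridging_index g) in
      cyc (homog0 (k := k) (p := p) (q := q) 0) (Lx true *~ ji.2 - Lx false *~ ji.1)
  | Inner g => let ij := sval (inner_index g) in
      cyc (homogXn (n := absz (ij.2 - ij.1 - 1)%R) (homogX (k := k) p q true)) (Lx true *~ ij.2)
  | Outer g => let ij := sval (outer_index g) in
      cyc (homogXn (n := absz (ij.2 - ij.1 - 1)%R) (homogX (k := k) p q false)) (- (Lx false *~ ij.1))
  | Cycle x => cyc (homogXn (n := sval (cycle_index x)) (homog_pt (p := p) (q := q) (Some (sval x).1))) 0
  end.

Lemma absz_gap (i j : int) : 2 <= j - i -> (0 < absz (j - i - 1)%R)%N.
Proof. by move=> h; rewrite absz_gt0; apply/eqP; lia. Qed.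

Lemma sheaf_bridging j i c (g : {g : curve R | bridging_curve p q g}) :
  bridging_lift p q j i c -> sval g = cover \o c ->
  exists x : sheaf (Bridging k g), cyclic 0 (Lx true *~ i - Lx false *~ j) x.
Proof.
move=> h e; have [y cy] := cyc_cyclic (homog0 (k := k) (p := p) (q := q) 0)
  (Lx true *~ (sval (bridging_index g)).2 - Lx false *~ (sval (bridging_index g)).1).
exists y; move: y cy; rewrite -/(sheaf (Bridging k g)).
have [c' [h' e']] := svalP (bridging_index g).
move: (sval (bridging_index g)).1 (sval (bridging_index g)).2 h' => j' i' h' y cy.
have [n [-> ->]] : exists n : int, j = j' + q%:Z * n /\ i = i' + p%:Z * n.
  apply/(bridging_homotopic hp hq h' h); rewrite -e -e'.
  have := (bridging_homotopic hp hq h' h').2; rewrite -e'; apply.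
  by exists 0; rewrite !mulr0 !addr0.
have -> // : Lx true *~ (i' + p%:Z * n) - Lx false *~ (j' + q%:Z * n)
   = Lx true *~ i' - Lx false *~ j'.
rewrite -!mulrNz; apply/Lx_eqP; exists n; split; ring.
Qed.

(** The twist changes by [p n x_1 = q n x_2], and [x_2] is invertible at the point where [x_1]
    vanishes. *)
Lemma inner_shift i j i' j' n : i' = i + p%:Z * n -> j' = j + p%:Z * n ->
  forall M N (x : M) (y : N),
  cyclic (X true ^+ absz (j - i - 1)%R) (Lx true *~ j) x ->
  cyclic (X true ^+ absz (j' - i' - 1)%R) (Lx true *~ j') y -> coh_iso M N.
Proof.
move=> ei ej M N x y cx cy.
have eij : j' - i' - 1 = j - i - 1 by rewrite ei ej; ring.
rewrite eij in cy.
have el : Lx true *~ j' = Lx true *~ j + Lx false *~ (q%:Z * n).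
  rewrite -[LHS]addr0 -(mulr0z (Lx false)); apply/Lx_eqP; exists n.
  by rewrite ej; split; ring.
rewrite el in cy; apply: (cyclic_shiftMz hp hq cx cy (homogX p q false)).
apply: comaxXn; rewrite -pt_zero; exact: (comax_pt hp hq (lam := Some 0) (mu := None)).
Qed.

Lemma outer_shift i j i' j' n : i' = i + q%:Z * n -> j' = j + q%:Z * n ->
  forall M N (x : M) (y : N),
  cyclic (X false ^+ absz (j - i - 1)%R) (- (Lx false *~ i)) x ->
  cyclic (X false ^+ absz (j' - i' - 1)%R) (- (Lx false *~ i')) y -> coh_iso M N.
Proof.
move=> ei ej M N x y cx cy.
have eij : j' - i' - 1 = j - i - 1 by rewrite ei ej; ring.
rewrite eij in cy.
have el : - (Lx false *~ i') = - (Lx false *~ i) + Lx true *~ (- (p%:Z * n)).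
  rewrite [RHS]addrC -!mulrNz -[LHS]add0r -(mulr0z (Lx true)); apply/Lx_eqP; exists n.
  by rewrite ei; split; ring.
rewrite el in cy; apply: (cyclic_shiftMz hp hq cx cy (homogX p q true)).
apply: comaxXn; rewrite -pt_zero; exact: (comax_pt hp hq (lam := None) (mu := Some 0)).
Qed.

Lemma sheaf_inner i j c (g : {g : curve R | inner_curve p g}) :
  inner_lift p i j c -> sval g = cover \o c ->
  forall N (x : N), cyclic (X true ^+ absz (j - i - 1)%R) (Lx true *~ j) x ->
  coh_iso (sheaf (Inner k q g)) N.
Proof.
move=> h e N x cx.
have [y cy] := cyc_cyclic (homogXn (n := absz ((sval (inner_index g)).2 - (sval (inner_index g)).1 - 1)%R)
  (homogX (k := k) p q true)) (Lx true *~ (sval (inner_index g)).2).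
rewrite /sheaf; have [c' [h' e']] := svalP (inner_index g).
move: (sval (inner_index g)).1 (sval (inner_index g)).2 h' y cy => i' j' h' y cy.
have [n [ei ej]] : exists n : int, i = i' + p%:Z * n /\ j = j' + p%:Z * n.
  apply/(inner_homotopic hp h' h); rewrite -e -e'.
  have := (inner_homotopic hp h' h').2; rewrite -e'; apply.
  by exists 0; rewrite !mulr0 !addr0.
exact: (inner_shift ei ej cy cx).
Qed.

Lemma sheaf_outer i j c (g : {g : curve R | outer_curve q g}) :
  outer_lift q i j c -> sval g = cover \o c ->
  forall N (x : N), cyclic (X false ^+ absz (j - i - 1)%R) (- (Lx false *~ i)) x ->
  coh_iso (sheaf (Outer k p g)) N.
Proof.
move=> h e N x cx.
have [y cy] := cyc_cyclic (homogXn (n := absz ((sval (outer_index g)).2 - (sval (outer_index g)).1 - 1)%R)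
  (homogX (k := k) p q false)) (- (Lx false *~ (sval (outer_index g)).1)).
rewrite /sheaf; have [c' [h' e']] := svalP (outer_index g).
move: (sval (outer_index g)).1 (sval (outer_index g)).2 h' y cy => i' j' h' y cy.
have [n [ei ej]] : exists n : int, i = i' + q%:Z * n /\ j = j' + q%:Z * n.
  apply/(outer_homotopic hq h' h); rewrite -e -e'.
  have := (outer_homotopic hq h' h').2; rewrite -e'; apply.
  by exists 0; rewrite !mulr0 !addr0.
exact: (outer_shift ei ej cy cx).
Qed.

Lemma bridging_sheaf (g : {g : curve R | bridging_curve p q g}) : exists j i c,
  [/\ bridging_lift p q j i c, sval g = cover \o c & exists x : sheaf (Bridging k g),
    cyclic 0 (Lx true *~ i - Lx false *~ j) x].
Proof.
have [c [h e]] := svalP (bridging_index g).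
exists (sval (bridging_index g)).1, (sval (bridging_index g)).2, c; split=> //.
exact: cyc_cyclic.
Qed.

Lemma inner_sheaf (g : {g : curve R | inner_curve p g}) : exists i j c,
  [/\ inner_lift p i j c, sval g = cover \o c & exists x : sheaf (Inner k q g),
    cyclic (X true ^+ absz (j - i - 1)%R) (Lx true *~ j) x].
Proof.
have [c [h e]] := svalP (inner_index g).
exists (sval (inner_index g)).1, (sval (inner_index g)).2, c; split=> //.
exact: cyc_cyclic.
Qed.

Lemma outer_sheaf (g : {g : curve R | outer_curve q g}) : exists i j c,
  [/\ outer_lift q i j c, sval g = cover \o c & exists x : sheaf (Outer k p g),
    cyclic (X false ^+ absz (j - i - 1)%R) (- (Lx false *~ i)) x].
Proof.
have [c [h e]] := svalP (outer_index g).
exists (sval (outer_index g)).1, (sval (outer_index g)).2, c; split=> //.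
exact: cyc_cyclic.
Qed.

Lemma param_cycle_uniq n m (x y : k * curve R) : param_cycle n x -> param_cycle m y ->
  freely_homotopic x.2 y.2 <-> n = m.
Proof.
move=> [_ _ [g lg ->]] [_ _ [g' lg' ->]]; split; first exact: loop_pow_homotopic_inj.
by move=> ->; exact: loop_pow_homotopic.
Qed.

Lemma sheaf_cycle n (x : {x : k * curve R | exists n, param_cycle n x}) :
  param_cycle n (sval x) ->
  exists y : sheaf (Cycle p q x), cyclic (pt (Some (sval x).1) ^+ n) 0 y.
Proof.
move=> h; have h' := svalP (cycle_index x).
have -> : n = sval (cycle_index x).
  apply/(param_cycle_uniq h h'); have [_ _ [g lg ->]] := h.
  exact: loop_pow_homotopic.
exact: cyc_cyclic.
Qed.

(* [None] for vector bundles, [Some lam] for the tube at the point [lam]. *)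
Definition support (d : datum k R p q) : option (option k) :=
  match d with
  | Bridging _ => None
  | Inner _ => Some None
  | Outer _ => Some (Some 0)
  | Cycle x => Some (Some (sval x).1)
  end.

Lemma sheaf_support d : match support d with
  | None => exists l (x : sheaf d), cyclic 0 l x
  | Some lam => exists n l (x : sheaf d), (0 < n)%N /\ cyclic (pt lam ^+ n) l x
  end.
Proof.
case: d => [g|g|g|x].
- have [c [h e]] := svalP (bridging_index g).
  by have [x cx] := sheaf_bridging h e; eexists; exists x; exact: cx.
- have [i [j [c [[ij _] _ [x cx]]]]] := inner_sheaf g.
  by exists (absz (j - i - 1)%R), (Lx true *~ j), x; split=> //; exact: absz_gap.
- have [i [j [c [[ij _] _ [x cx]]]]] := outer_sheaf g.
  exists (absz (j - i - 1)%R), (- (Lx false *~ i)), x; split; first exact: absz_gap.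
  by rewrite pt_zero.
- have h := svalP (cycle_index x); have [y cy] := sheaf_cycle h.
  by exists (sval (cycle_index x)), 0, y; split=> //; case: h.
Qed.

Lemma sheaf_indecomposable d : indecomposable (sheaf d).
Proof.
have := sheaf_support d; case: (support d) => [lam [n [l [x [n0 cx]]]]|[l [x cx]]].
  apply: (uniform_indecomposable hp hq).
  - exact: cyclic_sat0 cx.
  - exact: (cyclic_pt_uniform hp hq cx).
  - apply: (cyclic_neq0 hp hq cx) => t; rewrite -(prednK n0) exprSr mulrA.
    exact: (pt_nonunit hp hq).
apply: (uniform_indecomposable hp hq).
- exact: cyclic_sat0 cx.
- exact: cyclic0_uniform cx.
- by apply: (cyclic_neq0 hp hq cx) => t; rewrite mulr0 eq_sym oner_neq0.
Qed.

Lemma sheaf_tube d lam : support d = Some lam -> tube lam (sheaf d).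
Proof.
move=> e; have := sheaf_support d; rewrite e => -[n [l [x [n0 cx]]]].
split; first exact: cyclic_pt_finite_length cx.
exists n, [::] => u [v ->]; exists (fun=> 0); rewrite kcomb0.
case: (cx) => _ gen _; have [s ->] := gen v.
by rewrite scalerA mulrC (cyclic_rho cx).
Qed.

Lemma sheaf_vector_bundle d : support d = None -> vector_bundle (sheaf d).
Proof.
move=> e; have := sheaf_support d; rewrite e => -[l [x cx]].
exact: (cyclic0_vector_bundle hp hq cx).
Qed.

(** Annihilation by a power of the prime passes to isomorphic sheaves, and it excludes line bundles
    and all other points. *)
Lemma tube_support M d lam : tube lam M -> coh_iso M (sheaf d) -> support d = Some lam.
Proof.
move=> [_ [n fd]] iso.
have kM (u : M) : sat0 (pt lam ^+ n *: u).
  apply: ((findim_satP hp hq (hsub_image M (homogXn (n := n) (homog_pt lam)))).1 fd).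
  by exists u.
have kF := coh_iso_kill hp hq iso kM.
have := sheaf_support d; case: (support d) => [mu [m [l [x [m0 cx]]]]|[l [x cx]]].
  by have [t /(pt_pow_dvd m0)[->]] := (cyclic_kill cx _).1 kF.
by case: (cyclic0_not_killed cx kF).
Qed.

(** The isomorphism makes [sheaf d] a subobject of [M]; supported at a point, it would be a nonzero
    subobject of finite length. *)
Lemma vector_bundle_support M d : vector_bundle M -> coh_iso M (sheaf d) -> support d = None.
Proof.
move=> vb /(coh_iso_sym hp hq)/(coh_isoP hp hq)[G qG].
have := @sheaf_tube d; case: (support d) => [lam /(_ lam erefl)[fl _]|//].
have [nz _] := sheaf_indecomposable d; case: nz; apply: (vb _ G) => //.
by apply/(is_monoP hp hq); split; [exact: (qiso_mor hp hq qG)|case: qG].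
Qed.

Lemma iso_support d e : coh_iso (sheaf d) (sheaf e) -> support d = support e.
Proof.
have := @sheaf_tube d; have := @sheaf_vector_bundle d.
case: (support d) => [lam _ /(_ lam erefl) tb /(tube_support tb) ->//|].
by move=> /(_ erefl) vb _ /(vector_bundle_support vb) ->.
Qed.

Lemma sheaf_iso d e : same_datum d e <-> coh_iso (sheaf d) (sheaf e).
Proof.
have cyc0 (x : {x : k * curve R | exists n, param_cycle n x}) : (sval x).1 <> 0.
  by case: x => [[lam g] [n [/= /eqP h _ _]]].
case: d e => [g|g|g|x] [h|h|h|y]; rewrite /same_datum; try (by split=> // /iso_support);
  try (by split=> // /iso_support[] e; case: (cyc0 y));
  try (by split=> // /iso_support[] e; case: (cyc0 x)).
- have [j [i [c [hc ec [x cx]]]]] := bridging_sheaf g.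
  have [j' [i' [c' [hc' ec' [y cy]]]]] := bridging_sheaf h.
  rewrite ec ec' (bridging_homotopic hp hq hc hc'); split.
    move=> [n [ej ei]]; apply: (cyclic_iso hp hq cx).
    suff -> : Lx true *~ i - Lx false *~ j = Lx true *~ i' - Lx false *~ j' by exact: cy.
    by rewrite -!mulrNz; apply/Lx_eqP; exists (- n); rewrite ej ei; split; ring.
  move=> /(cyclic0_iso_inj hp hq cx cy); rewrite -!mulrNz => /Lx_eqP[n [e1 e2]].
  exists (- n); split; lia.
- have [i [j [c [hc ec [x cx]]]]] := inner_sheaf g.
  have [i' [j' [c' [hc' ec' [y cy]]]]] := inner_sheaf h.
  rewrite ec ec' (inner_homotopic hp hc hc'); split.
    by move=> [n [ei ej]]; exact: (inner_shift ei ej cx cy).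
  move=> iso; have [ij _] := hc; have [ij' _] := hc'.
  have [_ en] := cyclic_pt_iso (lam := None) (mu := None) (absz_gap ij) (absz_gap ij') cx cy iso.
  rewrite -en in cy.
  (* The twist is determined modulo multiples of [x_2], hence [j] modulo [p]; equality of lengths
     then moves [i] by the same amount. *)
  have [z] := cyclicX_iso_inj hp hq (absz_gap ij) cx cy iso.
  rewrite -[LHS]addr0 -(mulr0z (Lx false)) => /Lx_eqP[n [e1 _]].
  exists (- n); split; lia.
- have [i [j [c [hc ec [x cx]]]]] := outer_sheaf g.
  have [i' [j' [c' [hc' ec' [y cy]]]]] := outer_sheaf h.
  rewrite ec ec' (outer_homotopic hq hc hc'); split.
    by move=> [n [ei ej]]; exact: (outer_shift ei ej cx cy).
  move=> iso; have [ij _] := hc; have [ij' _] := hc'.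
  have [cx0 cy0] := (cx, cy); rewrite -pt_zero in cx0 cy0.
  have [_ en] := cyclic_pt_iso (absz_gap ij) (absz_gap ij') cx0 cy0 iso.
  rewrite -en in cy.
  have [z] := cyclicX_iso_inj hp hq (absz_gap ij) cx cy iso.
  rewrite [RHS]addrC -!mulrNz -[LHS]add0r -(mulr0z (Lx true)) => /Lx_eqP[n [_ e2]].
  exists (- n); split; lia.
- have hx := svalP (cycle_index x); have hy := svalP (cycle_index y).
  have [x' cx] := sheaf_cycle hx; have [y' cy] := sheaf_cycle hy.
  rewrite (param_cycle_uniq hx hy); split=> [[e1 e2]|iso].
    by apply: (cyclic_iso hp hq cx); rewrite e1 e2; exact: cy.
  have [_ n0 _] := hx; have [_ m0 _] := hy.
  by have [[->] ->] := cyclic_pt_iso n0 m0 cx cy iso.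
Qed.

Lemma sheaf_surj M : indecomposable M -> exists d, coh_iso M (sheaf d).
Proof.
move=> indec; have [[l Hl]|[e [f [hf f0 kf]]]] := torsion_free_classification hp hq indec.
  have [a [b el]] := Lx_surj l.
  (* Bridging arcs give twists [i x_1 - j x_2], whence the sign of [b]. *)
  have [c hc] := bridging_exists R p q (- b) a.
  pose g : {g : curve R | bridging_curve p q g} :=
    exist _ (cover \o c) (ex_intro _ (- b) (ex_intro _ a (ex_intro _ c (conj hc erefl)))).
  have [x cx] := sheaf_bridging (g := g) hc erefl.
  exists (Bridging k g); apply: (coh_iso_sym hp hq); apply: (Hl _ x).
  by rewrite el -[b in Lx false *~ b]opprK mulrNz.
have kf' (u : M) : sat0 (f *: u) by rewrite kf; exact: submod0 (sat0_submod M).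
have [lam [n [l [n0 Hl]]]] := torsion_classification hp hq indec hf f0 kf'.
have [a [b el]] := Lx_surj l.
case: lam Hl => [lam|] Hl.
  have [lam0|lam0] := eqVneq lam 0.
    (* A gap of [n + 1] gives length [n]; the coefficient [a] of [x_1] in the twist is absorbed
       later, [x_1] being invertible at this point. *)
    have ij : 2 <= (- b + n%:Z + 1) - (- b) by lia.
    have [c hc] := outer_exists R hp hq ij.
    pose g : {g : curve R | outer_curve q g} :=
      exist _ (cover \o c) (ex_intro _ (- b) (ex_intro _ (- b + n%:Z + 1) (ex_intro _ c (conj hc erefl)))).
    exists (Outer k p g); apply: (coh_iso_sym hp hq).
    have [x cx] := cyc_cyclic (homogXn (n := n) (homogX (k := k) p q false)) (- (Lx false *~ (- b))).
    have en : absz ((- b + n%:Z + 1) - (- b) - 1)%R = n by lia.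
    have iso1 := sheaf_outer (g := g) hc erefl (x := x); rewrite en in iso1.
    apply: (coh_iso_trans hp hq (iso1 cx)).
    have [y cy] := cyc_cyclic (homogXn (n := n) (homogX (k := k) p q false)) l.
    have iso2 : coh_iso (cyc (homogXn (n := n) (homogX (k := k) p q false)) l) M.
      by apply: (Hl _ y); rewrite lam0 pt_zero.
    apply: (coh_iso_trans hp hq _ iso2).
    have cy' : cyclic (X false ^+ n) (- (Lx false *~ (- b)) + Lx true *~ a) y.
      by rewrite mulrNz opprK addrC -el.
    apply: (cyclic_shiftMz hp hq cx cy' (homogX p q true)).
    apply: comaxXn; rewrite -pt_zero; exact: (comax_pt hp hq (lam := None) (mu := Some 0)).
  have [g lg] := loop_exists R.
  have hx : param_cycle n (lam, curve_pow g n) by split=> //; exists g.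
  pose x : {x : k * curve R | exists n, param_cycle n x} :=
    exist _ (lam, curve_pow g n) (ex_intro _ n hx).
  exists (Cycle p q x); apply: (coh_iso_sym hp hq).
  have [y cy] := @sheaf_cycle n x hx.
  (* Both variables are invertible at this point, so the twist [a x_1 + b x_2] is reached from zero
     in two steps. *)
  have [z cz] := cyc_cyclic (homogXn (n := n) (homog_pt (p := p) (q := q) (Some lam))) (Lx true *~ a).
  have [w cw] := cyc_cyclic (homogXn (n := n) (homog_pt (p := p) (q := q) (Some lam))) l.
  have cz' : cyclic (pt (Some lam) ^+ n) (0 + Lx true *~ a) z by rewrite add0r.
  have cw' : cyclic (pt (Some lam) ^+ n) (Lx true *~ a + Lx false *~ b) w by rewrite -el.
  have i1 : coh_iso (sheaf (Cycle p q x)) _ := cyclic_shiftMz hp hq cy cz' (homogX p q true)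
    (comaxXn n (comax_pt hp hq (lam := None) (mu := Some lam) isT)).
  apply: (coh_iso_trans hp hq i1).
  have c2 : comax (X false) (pt (Some lam) ^+ n).
    by apply: comaxXn; rewrite -pt_zero; apply: (comax_pt hp hq); apply/eqP => -[e0]; rewrite -e0 eqxx in lam0.
  have i2 := cyclic_shiftMz hp hq cz cw' (homogX p q false) c2.
  by apply: (coh_iso_trans hp hq i2); exact: Hl cw.
have ij : 2 <= a - (a - n%:Z - 1) by lia.
have [c hc] := inner_exists R hp hq ij.
pose g : {g : curve R | inner_curve p g} :=
  exist _ (cover \o c) (ex_intro _ (a - n%:Z - 1) (ex_intro _ a (ex_intro _ c (conj hc erefl)))).
exists (Inner k q g); apply: (coh_iso_sym hp hq).
have [x cx] := cyc_cyclic (homogXn (n := n) (homogX (k := k) p q true)) (Lx true *~ a).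
have en : absz (a - (a - n%:Z - 1) - 1)%R = n by lia.
have iso1 := sheaf_inner (g := g) hc erefl (x := x); rewrite en in iso1.
apply: (coh_iso_trans hp hq (iso1 cx)).
have [y cy] := cyc_cyclic (homogXn (n := n) (homogX (k := k) p q true)) l.
apply: (coh_iso_trans hp hq _ (Hl _ y cy)).
have cy' : cyclic (X true ^+ n) (Lx true *~ a + Lx false *~ b) y by rewrite -el.
apply: (cyclic_shiftMz hp hq cx cy' (homogX p q false)).
apply: comaxXn; rewrite -pt_zero; exact: (comax_pt hp hq (lam := Some 0) (mu := None)).
Qed.

End Parametrization.

Theorem theorem3p4 (k : closedFieldType) (R : realType) (p q : nat)
    (hp : (1 <= p)%N) (hpq : (p <= q)%N) :
  exists F : datum k R p q -> gmod k p q,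
  [/\ (* F is a bijection from curves up to homotopy to ind(coh-X(p,q)) up to
         isomorphism *)
      parametrizes (@same_datum k R p q) (@indecomposable k p q) F,
      (* (1) indecomposable vector bundles; [(j/q), (i/p)] gives
         O(i x_1 - j x_2) *)
      parametrizes
        (fun g h => homotopic (sval g) (sval h))
        (fun M => indecomposable M /\ vector_bundle M)
        (fun g => F (Bridging k g)) /\
      (forall j i c (g : {g : curve R | bridging_curve p q g}),
        bridging_lift p q j i c -> sval g = @annulus_cover R \o c ->
        cyclic_sheaf 0 (Lx1 p q *~ i - Lx2 p q *~ j) (F (Bridging k g))),
      (* (2) the tube of rank p *)
      parametrizes
        (fun g h => homotopic (sval g) (sval h))
        (fun M => indecomposable M /\ tube None M)
        (fun g => F (Inner k q g)) /\
      (forall i j c (g : {g : curve R | inner_curve p g}),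
        inner_lift p i j c -> sval g = @annulus_cover R \o c ->
        cyclic_sheaf (Sx1 k ^+ absz (j - i - 1)%R) (Lx1 p q *~ j)
          (F (Inner k q g))),
      (* (2) the tube of rank q *)
      parametrizes
        (fun g h => homotopic (sval g) (sval h))
        (fun M => indecomposable M /\ tube (Some 0) M)
        (fun g => F (Outer k p g)) /\
      (forall i j c (g : {g : curve R | outer_curve q g}),
        outer_lift q i j c -> sval g = @annulus_cover R \o c ->
        cyclic_sheaf (Sx2 k ^+ absz (j - i - 1)%R) (- (Lx2 p q *~ i))
          (F (Outer k p g))) &
      (* (3) the homogeneous tubes *)
      parametrizes
        (fun x y => (sval x).1 = (sval y).1 /\
                    freely_homotopic (sval x).2 (sval y).2)
        (fun M => indecomposable M /\
                  exists2 lam : k, lam != 0 & tube (Some lam) M)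
        (fun x => F (Cycle p q x)) /\
      (forall n (x : {x : k * curve R | exists n, param_cycle n x}),
        param_cycle n (sval x) ->
        cyclic_sheaf (point_prime p q (Some (sval x).1) ^+ n) 0
          (F (Cycle p q x)))].
Proof.
have hq : (0 < q)%N := leq_trans hp hpq.
exists (@sheaf k R p q).
(* Each clause is the restriction of the global bijection to data of prescribed support, since the
   support can be read off from the sheaf. *)
have restrict (A : Type) (in_ : A -> datum k R p q) (eqA : A -> A -> Prop)
    (c : gmod k p q -> Prop) (s : pred (option (option k))) :
    (forall a b, same_datum (in_ a) (in_ b) <-> eqA a b) ->
    (forall d, s (support d) <-> exists a, d = in_ a) ->
    (forall d : datum k R p q, s (support d) -> c (sheaf d)) ->
    (forall M (d : datum k R p q), c M -> coh_iso M (sheaf d) -> s (support d)) ->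
    parametrizes eqA (fun M => indecomposable M /\ c M) (fun a => sheaf (in_ a)).
  move=> eqin sin cin cs; split.
  - by move=> a; split; [exact: sheaf_indecomposable|apply: cin; apply/sin; exists a].
  - by move=> a b; rewrite -eqin; exact: sheaf_iso.
  - move=> M [/(sheaf_surj R hp hq)[d iso] cM]; have /sin[a ea] := cs _ _ cM iso.
    by exists a; rewrite -ea.
split.
- by split; [exact: sheaf_indecomposable|exact: sheaf_iso|exact: sheaf_surj].
- split.
    apply: (restrict _ _ _ _ (pred1 None)) => //.
    + by case=> [g|g|g|x]; split=> //; try (by case); exists g.
    + by move=> d /eqP; exact: sheaf_vector_bundle.
    + by move=> M d vb /(vector_bundle_support hp hq vb) ->.
  move=> j i c g h e; exists (sheaf (Bridging k g)).
  have [x [hx gx rx]] := sheaf_bridging k hp hq h e.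
  by split; [exact: coh_iso_refl|exists x].
- split.
    apply: (restrict _ _ _ _ (pred1 (Some None))) => //.
    + by case=> [g|g|g|x]; split=> //; try (by case); exists g.
    + by move=> d /eqP; exact: sheaf_tube.
    + by move=> M d vb /(tube_support hp hq vb) ->.
  move=> i j c g h e.
  have [x cx] := cyc_cyclic (homogXn (n := absz (j - i - 1)%R) (homogX (k := k) p q true)) (Lx p q true *~ j).
  exists (cyc (homogXn (n := absz (j - i - 1)%R) (homogX (k := k) p q true)) (Lx p q true *~ j)).
  by split; [apply: (sheaf_inner hp hq h e cx)|exists x; case: cx].
- split.
    apply: (restrict _ _ _ _ (pred1 (Some (Some 0)))) => //.
    + case=> [g|g|g|x]; split=> //; try (by case); first by exists g.
        by rewrite /= eqxx.
      by have [n [/negP x0 _ _]] := svalP x; move=> /eqP[] /eqP/x0.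
    + by move=> d /eqP; exact: sheaf_tube.
    + by move=> M d vb /(tube_support hp hq vb) ->; rewrite /= eqxx.
  move=> i j c g h e.
  have [x cx] := cyc_cyclic (homogXn (n := absz (j - i - 1)%R) (homogX (k := k) p q false)) (- (Lx p q false *~ i)).
  exists (cyc (homogXn (n := absz (j - i - 1)%R) (homogX (k := k) p q false)) (- (Lx p q false *~ i))).
  by split; [apply: (sheaf_outer hp hq h e cx)|exists x; case: cx].
- split.
    apply: (restrict _ _ _ _ (fun s => if s is Some (Some lam) then lam != 0 else false)) => //.
    + case=> [g|g|g|x]; split=> //=; try (by case); first by rewrite eqxx.
        by exists x.
      by have [n [x0 _ _]] := svalP x.
    + by move=> d; have := @sheaf_tube k R p q hp hq d; case: (support d) => [[lam|]|] // tb l0; exists lam; last exact: tb.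
    + by move=> M d [lam l0 tb] /(tube_support hp hq tb) ->.
  move=> n x h; exists (sheaf (Cycle p q x)).
  have [y [hy gy ry]] := sheaf_cycle p q h.
  by split; [exact: coh_iso_refl|exists y].
Qed.
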